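(* The locus in $\mathrm{Gor}(1,6,6,1)$ of algebras satisfying the Strong Lefschetz Property is $\mathrm{Gor}(1,6,6,1)\setminus\mathbb{X}_{min}$, where $\mathbb{X}_{min}\subset\mathbb{P}(S_3)$ is the closure of the minimal family of cubics in $\mathbb{P}^5$.
   Context: Work over $\mathbb{C}$, with $N=5$. $S=\mathbb{C}[x_0,\dots,x_5]$, $S_3$ the cubic forms, $Q=\mathbb{C}[X_0,\dots,X_5]$ acting on $S$ by $X_i=\partial/\partial x_i$. For $f\in S_3$, $\operatorname{Ann}_f=\{\alpha\in Q:\alpha(f)=0\}$ and $A_f=Q/\operatorname{Ann}_f$. $\mathrm{Gor}(1,6,6,1)$ parametrizes standard graded Artinian Gorenstein $\mathbb{C}$-algebras with Hilbert function $(1,6,6,1)$; via $f\mapsto A_f$ (Macaulay duality) it is identified with $\mathbb{P}(S_3)\setminus\mathcal{C}=\mathbb{P}^{55}\setminus\mathcal{C}$, where $\mathcal{C}$ is the locus of cubics $f$ with $V(f)$ a cone (equivalently, with linearly dependent partial derivatives). A graded Artinian algebra $A=\bigoplus_{i=0}^dA_i$ has the Strong Lefschetz Property (SLP) if there is $L\in A_1$ such that $\cdot L^k:A_i\to A_{i+k}$ has full rank for all $0\le i\le d-1$, $1\le k\le d-i$. For $f\in S_3$, $\operatorname{hess}_f$ is the Hessian determinant, $Z\subset\check{\mathbb{P}}^5$ the closure of the image of the polar map $p\mapsto(\frac{\partial f}{\partial x_0}(p):\dots:\frac{\partial f}{\partial x_5}(p))$, $Z^*$ its dual variety. The minimal family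 consists of the cubics with $\operatorname{hess}_f=0$ identically, $V(f)$ not a cone, $\operatorname{codim}Z=1$, $\dim Z^*=1$; $\mathbb{X}_{min}$ is its closure in $\mathbb{P}(S_3)$. A generic element of $\mathbb{X}_{min}$ is projectively equivalent to $x_0g_0+x_1g_1+x_2g_2+h$ with $g_i\in\mathbb{C}[x_4,x_5]_2$, $h\in\mathbb{C}[x_3,x_4,x_5]_3$. *)

(* Defs.v *)
From HB Require Import structures.
From mathcomp Require Import all_boot all_order all_algebra.
From mathcomp Require Import classical_sets reals complex bigenough.
From mathcomp Require Import ssrcomplements mpoly.

Set Implicit Arguments.
Unset Strict Implicit.
Unset Printing Implicit Defensive.

Import Order.TTheory GRing.Theory Num.Theory BigEnough.
Local Open Scope ring_scope.
Local Open Scope quotient_scope.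
Local Open Scope classical_set_scope.

(* S and Q are both represented by {mpoly K[n]}; in Q, 'X_i stands for the
   operator d/dx_i, so that 'X_[m] acts as the iterated derivative ^`M[m]. *)
Definition dact (K : fieldType) (n : nat) (a f : {mpoly K[n]}) : {mpoly K[n]} :=
  \sum_(m <- msupp a) a@_m *: f^`M[m].

Section ActionTheory.
Context (K : fieldType) (n : nat).
Implicit Types a b f g : {mpoly K[n]}.

Lemma dactwE k a f : (msize a <= k)%N ->
  dact a f = \sum_(m : 'X_{1..n < k}) a@_m *: f^`M[m].
Proof.
move=> le_ak; rewrite /dact (big_mksub 'X_{1..n < k}) //=.
- by rewrite big_rmcond //= => m; move/memN_msupp_eq0->; rewrite scale0r.
- exact: msupp_uniq.
- by move=> m /msize_mdeg_lt /leq_trans; apply.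
Qed.

Lemma dact_linearl f : linear (fun a => dact a f).
Proof.
move=> c a b; pose_big_enough k.
  rewrite !(@dactwE k) // scaler_sumr -big_split /=; apply: eq_bigr => m _.
  by rewrite mcoeffD mcoeffZ scalerDl scalerA.
by close.
Qed.

Lemma dact_linearr a : linear (dact a).
Proof.
move=> c f g; rewrite /dact scaler_sumr -big_split /=; apply: eq_bigr => m _.
by rewrite mderivmD mderivmZ scalerDr !scalerA mulrC.
Qed.

HB.instance Definition _ a :=
  GRing.isLinear.Build K {mpoly K[n]} {mpoly K[n]} _ (dact a) (dact_linearr a).

Lemma dact0l f : dact 0 f = 0.
Proof. by rewrite /dact msupp0 big_nil. Qed.

Lemma dactDl f : {morph (fun a => dact a f) : a b / a + b}.
Proof. by move=> a b; rewrite -[a]scale1r dact_linearl !scale1r. Qed.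

Lemma dactZl c a f : dact (c *: a) f = c *: dact a f.
Proof. by rewrite -[c *: a]addr0 dact_linearl dact0l addr0. Qed.

Lemma dactX m f : dact 'X_[m] f = f^`M[m].
Proof. by rewrite /dact msuppX big_seq1 mcoeffX eqxx scale1r. Qed.

Lemma dact1 f : dact 1 f = f.
Proof. by rewrite -mpolyX0 dactX mderivm0m. Qed.

Lemma dactM a b f : dact (a * b) f = dact a (dact b f).
Proof.
elim/mpolyind: a b => [b|c m a _ _ IHa b]; first by rewrite mul0r !dact0l.
rewrite mulrDl !dactDl IHa; congr (_ + _).
rewrite -scalerAl !dactZl dactX; congr (_ *: _).
clear IHa; elim/mpolyind: b => [|e k b _ _ IHb]; first by rewrite mulr0 !dact0l linear0.
rewrite mulrDr !dactDl IHb mderivmD; congr (_ + _).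
by rewrite -scalerAr !dactZl -mpolyXD !dactX mderivmZ addmC mderivmDm.
Qed.

End ActionTheory.

(* Representatives of the points of P(S_d). They are not quotiented by scaling:
   the sets of cubics defined below are invariant under it. Being nonzero makes
   Ann f a proper ideal. *)
Record ppoint (K : fieldType) (n d : nat) :=
  PPoint { form_of :> dhomog n K d; form_neq0 : form_of != 0 }.

Definition Ann (K : fieldType) (n d : nat) (f : ppoint K n d) :
  {pred {mpoly K[n]}} := fun a => dact a f == 0.

Lemma Ann_idealr_closed (K : fieldType) (n d : nat) (f : ppoint K n d) :
  idealr_closed (Ann f).
Proof.
split=> [||a u v].
- by rewrite unfold_in /Ann dact0l.
- by rewrite unfold_in /Ann dact1; apply: contra (form_neq0 f) => /eqP f0;
     apply/eqP/val_inj.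
- rewrite !unfold_in /Ann => /eqP u0 /eqP v0.
  by rewrite dactDl dactM u0 v0 raddf0 addr0.
Qed.

HB.instance Definition _ (K : fieldType) (n d : nat) (f : ppoint K n d) :=
  isIdealr.Build {mpoly K[n]} (Ann f) (Ann_idealr_closed f).

Definition Aalg (K : fieldType) (n d : nat) (f : ppoint K n d) : Type :=
  {ideal_quot (Ann f)}.

HB.instance Definition _ (K : fieldType) (n d : nat) (f : ppoint K n d) :=
  GRing.ComNzRing.on (Aalg f).

Section AalgModule.
Context (K : fieldType) (n d : nat) (f : ppoint K n d).

Definition Aproj (a : {mpoly K[n]}) : Aalg f := \pi_({ideal_quot (Ann f)}) a.

Definition Ascale (c : K) (x : Aalg f) : Aalg f := Aproj c%:MP * x.

Fact AscaleA c e x : Ascale c (Ascale e x) = Ascale (c * e) x.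
Proof. by rewrite /Ascale mulrA /Aproj mpolyCM rmorphM. Qed.
Fact Ascale1 : left_id 1 Ascale.
Proof. by move=> x; rewrite /Ascale /Aproj rmorph1 mul1r. Qed.
Fact AscaleDr : right_distributive Ascale +%R.
Proof. by move=> c x y; rewrite /Ascale mulrDr. Qed.
Fact AscaleDl x : {morph Ascale^~ x : c e / c + e}.
Proof. by move=> c e; rewrite /Ascale /Aproj mpolyCD rmorphD mulrDl. Qed.
Fact AscaleAl c (x y : Aalg f) : Ascale c (x * y) = Ascale c x * y.
Proof. by rewrite /Ascale mulrA. Qed.

HB.instance Definition _ := GRing.Zmodule_isLmodule.Build K (Aalg f)
  AscaleA Ascale1 AscaleDr AscaleDl.
HB.instance Definition _ := GRing.Lmodule_isLalgebra.Build K (Aalg f) AscaleAl.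

Lemma Aproj_eq0 a : (Aproj a == 0) = (dact a f == 0).
Proof.
by rewrite /Aproj -[0]/(0 : {ideal_quot (Ann f)}) piE Quotient.equivE subr0.
Qed.

Definition Agr (i : nat) : set (Aalg f) :=
  Aproj @` [set a | a \is i.-homog].

End AalgModule.

Definition has_dim (K : fieldType) (V : lmodType K) (W : set V) (r : nat) :=
  exists b : 'I_r -> V,
    W = [set x | exists c : 'I_r -> K, x = \sum_i c i *: b i] /\
    forall c : 'I_r -> K, \sum_i c i *: b i = 0 -> forall i, c i = 0.

(* For u linear and E, F finite-dimensional with u @` E `<=` F. *)
Definition full_rank (K : fieldType) (V W : lmodType K) (u : V -> W)
    (E : set V) (F : set W) :=
  exists p q, [/\ has_dim E p, has_dim F q & has_dim (u @` E) (minn p q)].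

Definition SLP (K : fieldType) (A : lalgType K) (gr : nat -> set A) (d : nat) :=
  exists2 L : A, gr 1%N L &
    forall i k, (0 <= i <= d - 1)%N -> (1 <= k <= d - i)%N ->
      full_rank (fun x => L ^+ k * x) (gr i) (gr (i + k)%N).

(* Subsets of P^(n-1) are given by sets of nonzero vectors of K^n; pclosure X
   consists of all representatives of the points of the Zariski closure. *)
Section ProjectiveGeometry.
Context (K : fieldType) (n : nat).
Implicit Types (X Y Z : set 'rV[K]_n) (v w z : 'rV[K]_n).

Definition vanishes_on (F : {mpoly K[n]}) X :=
  forall v, X v -> F.@[v 0] = 0.

Definition pclosure X : set 'rV[K]_n :=
  [set v : 'rV[K]_n | v != 0 /\ forall d (F : {mpoly K[n]}),
    F \is d.-homog -> vanishes_on F X -> F.@[v 0] = 0].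

Definition pclosed X := pclosure X = X.

Definition pirreducible X :=
  [/\ X !=set0, pclosed X &
      forall Y Z, pclosed Y -> pclosed Z -> X `<=` Y `|` Z ->
        X `<=` Y \/ X `<=` Z].

Definition has_chain X (l : nat) :=
  exists Y : nat -> set 'rV[K]_n,
    (forall i, (i <= l)%N -> pirreducible (Y i) /\ Y i `<=` X) /\
    (forall i, (i < l)%N -> Y i `<` Y i.+1).

(* Krull dimension of the closed set X. *)
Definition pdim X (d : nat) := has_chain X d /\ ~ has_chain X d.+1.

Definition pcodim X (c : nat) := exists2 d, pdim X d & (d + c)%N = n.-1.

(* Affine cone over the embedded projective tangent space to Z at z. *)
Definition tangent Z z : set 'rV[K]_n :=
  [set v : 'rV[K]_n | forall d (F : {mpoly K[n]}), F \is d.-homog -> vanishes_on F Z ->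
    \sum_i (F^`M(i)).@[z 0] * v 0 i = 0].

(* Z is meant to be irreducible, hence of pure dimension. *)
Definition smooth_point Z z :=
  Z z /\ exists2 d, pdim Z d & has_dim (tangent Z z) d.+1.

(* A vector w stands for the hyperplane \sum_i w_i y_i = 0. *)
Definition dual_variety Z : set 'rV[K]_n :=
  pclosure [set w : 'rV[K]_n | w != 0 /\ exists2 z, smooth_point Z z &
    forall v, tangent Z z v -> \sum_i w 0 i * v 0 i = 0].

End ProjectiveGeometry.

Section Hypersurface.
Context (K : fieldType) (n : nat).
Implicit Types f : {mpoly K[n]}.

Definition hess f : {mpoly K[n]} := \det (\matrix_(i, j) (f^`M(i))^`M(j)).

Definition grad f (p : 'rV[K]_n) : 'rV[K]_n := \row_i (f^`M(i)).@[p 0].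

Definition polar_image f : set 'rV[K]_n :=
  pclosure [set v : 'rV[K]_n | v != 0 /\ exists2 p : 'rV[K]_n, p != 0 & v = grad f p].

(* V(f) is a cone with vertex v: it contains the line joining v to any of its
   points. For x = 0 this says that v itself lies on V(f). *)
Definition is_cone f :=
  exists2 v : 'rV[K]_n, v != 0 &
    forall x : 'rV[K]_n, f.@[x 0] = 0 ->
      forall s t, f.@[(s *: v + t *: x) 0] = 0.

End Hypersurface.

Notation cubic K := (ppoint K 6 3).

Definition Gor1661 (K : fieldType) : set (cubic K) :=
  [set f | forall i, has_dim (@Agr K 6 3 f i) (nth 0%N [:: 1; 6; 6; 1]%N i)].

Arguments Gor1661 : clear implicits.

Definition SLP_locus (K : fieldType) : set (cubic K) :=
  [set f | Gor1661 K f /\ SLP (@Agr K 6 3 f) 3].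

Arguments SLP_locus : clear implicits.

Definition minimal_family (K : fieldType) : set (cubic K) :=
  [set f | [/\ hess f = 0, ~ is_cone f, pcodim (polar_image f) 1
             & pdim (dual_variety (polar_image f)) 1]].

Arguments minimal_family : clear implicits.

Definition coords (K : fieldType) (f : dhomog 6 K 3) : 'rV[K]__ :=
  \row_i coord (vbasis (@fullv K (dhomog 6 K 3))) i f.

Definition Xmin (K : fieldType) : set (cubic K) :=
  [set f | pclosure [set coords g | g in minimal_family K] (coords f)].
Arguments Xmin : clear implicits.

(* Main.v *)
(* An element L of degree one is a strong Lefschetz element of A_f exactly when
   f and its hessian determinant do not vanish at L, so that SLP means hess f <> 0
   and the point is that a cubic f in six variables, not a cone, with hess f = 0 is
   a limit of members of the minimal family (the converse holds because the
   coefficients of the hessian are forms in those of f).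

   Let T be the polarisation of f, H(x) the matrix of T(x, -, -). Adding to f
   small multiples of cubes of linear forms, one may assume that H(x) generically
   has rank 5. Its kernel is then spanned by a row k(x) of the adjugate matrix.
   Differentiating T(x, k, -) = 0 gives T(k, k, -) = 0, then that H(k) annihilates
   the image of the Jacobian J of k and that rk H(k) = rk J - 1; hence
   rk H(k) <= 2. Rank 2 is impossible: second order differentiation and the
   dimension count ker H(k) = im J + <x> force T(im J, im J, -) = 0, then all
   derivatives of k lie in im J, hence are apolar to T(x, x, -); but the
   derivatives of top order are constant, and f would be a cone. So every polar
   quadric T(k(x), -, -) is, up to a scalar, the square of a linear form. These
   linear forms turn out to span a plane <y4, y5>, and in suitable coordinates
   f = y0 y4^2 + y1 y4 y5 + y2 y5^2 + h(y3, y4, y5).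

   If h contains y3^3, completing the cube shows that f is projectively equivalent
   to x0 x4^2 + x1 x4 x5 + x2 x5^2 + x3^3; in general f is a limit of such cubics.
   For these, the polar image is the quadric cone y0 y2 = y1^2, of dimension 4, and
   its dual is a conic. Dimensions of closed sets are bounded above through their
   Hilbert functions: a chain of l + 1 irreducible closed sets forces at least
   C(k + l, l) independent forms of degree kD, which is too many on a variety
   parametrised by l variables. *)

Require Import Defs.
From HB Require Import structures.
From mathcomp Require Import all_boot all_order all_algebra.
From mathcomp Require Import perm boolp classical_sets reals complex mpoly.
From mathcomp Require Import ring zify.
Set Implicit Arguments.
Unset Strict Implicit.
Unset Printing Implicit Defensive.
Import Order.TTheory GRing.Theory Num.Theory.
Local Open Scope ring_scope.

(** * Directional derivatives and evaluation of polynomials *)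

(** Corank one matters because the kernel of H(x) is then a line spanned by a polynomial vector,
    which can be differentiated. The perturbations leading there keep the hessian zero: a multiple
    of the cube of a linear form changes H(x) by a matrix of rank at most one, so as long as every
    H(x) has rank at most 4 the new matrices stay singular.

    Linear algebra at one point works only where certain polynomials do not vanish. Its conclusions
    are turned into polynomial identities before the next differentiation.

    The forms l with T(k(x), -, -) = c l^2 span a plane for two reasons. If y1 and y2 are conjugate
    for all these squares, then all of them vanish at y1 or all vanish at y2, because polynomials
    have no zero divisors. And the values of k are mutually conjugate, so they lie in the common
    zeros of the forms l; three independent forms would confine them to dimension 6 - 3 = 3, leaving
    only combinations of three squares.

    Limits in Zariski closures are taken along lines: a one-variable polynomial vanishing at all but
    finitely many parameters is zero. *)

Lemma mderivXU (R : nzRingType) n (i j : 'I_n) :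
  ('X_i : {mpoly R[n]})^`M(j) = (i == j)%:R%:MP.
Proof.
rewrite mderivX mnm1E; case: eqVneq => [->|_]; last by rewrite scale0r mpolyC0.
have -> : (U_(j) - U_(j) = 0)%MM by apply/mnmP => k; rewrite !mnmE subnn.
by rewrite mpolyX0 scale1r mpolyC1.
Qed.

Section DirectionalDerivative.
Context (K : fieldType) (n : nat).
Implicit Types (p q : {mpoly K[n]}) (x y z : 'rV[K]_n).

Definition dird y p : {mpoly K[n]} := \sum_i y 0 i *: p^`M(i).

Lemma dird_is_linear y : linear (dird y).
Proof.
move=> c p q; rewrite /dird scaler_sumr -big_split; apply: eq_bigr => i _.
by rewrite linearP scalerDr !scalerA mulrC.
Qed.
HB.instance Definition _ y :=
  GRing.isLinear.Build K {mpoly K[n]} {mpoly K[n]} _ (dird y) (dird_is_linear y).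

Lemma dirdM y p q : dird y (p * q) = dird y p * q + p * dird y q.
Proof.
rewrite /dird mulr_suml mulr_sumr -big_split; apply: eq_bigr => i _ /=.
by rewrite mderivM scalerDr scalerAl scalerAr.
Qed.

Lemma dirdC y c : dird y c%:MP = 0.
Proof. by rewrite /dird big1 // => i _; rewrite mderivC scaler0. Qed.

Lemma dirdXU y i : dird y 'X_i = (y 0 i)%:MP.
Proof.
rewrite /dird (bigD1 i) //= big1 ?addr0 => [|j ji]; rewrite mderivXU.
  by rewrite eqxx mpolyC1 alg_mpolyC.
by rewrite eq_sym (negPf ji) mpolyC0 scaler0.
Qed.

Lemma dird_comm y z p : dird y (dird z p) = dird z (dird y p).
Proof.
have E u v : dird u (dird v p) =
    \sum_i \sum_j (u 0 i * v 0 j) *: p^`M(j)^`M(i).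
  rewrite {1}/dird; apply: eq_bigr => i _; rewrite (linear_sum (mderiv i)) scaler_sumr.
  by apply: eq_bigr => j _; rewrite /= mderivZ scalerA.
rewrite !E exchange_big; apply: eq_bigr => i _; apply: eq_bigr => j _ /=.
by rewrite mulrC mderiv_comm.
Qed.

Lemma dird_delta i p : dird (delta_mx 0 i) p = p^`M(i).
Proof.
rewrite /dird (bigD1 i) //= big1 ?addr0 => [|j ji]; rewrite mxE eqxx.
  by rewrite eqxx scale1r.
by rewrite (negPf ji) scale0r.
Qed.

Lemma meval_dird y p x : (dird y p).@[x 0] = \sum_i y 0 i * (p^`M(i)).@[x 0].
Proof. by rewrite /dird raddf_sum /=; apply: eq_bigr => i _; rewrite mevalZ. Qed.

End DirectionalDerivative.

Section ChainRule.
Context (K : fieldType) (n : nat) (B : comAlgType K) (d : {linear B -> B}).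
Hypothesis dM : forall a b, d (a * b) = d a * b + a * d b.

Lemma derivation1 : d 1 = 0.
Proof.
by have := dM 1 1; rewrite !mulr1 mul1r -{1}[d 1]addr0 => /addrI.
Qed.

(** The polynomials that obey the chain rule contain the constants and the variables and are closed
    under sums and products. *)
Lemma derivation_mmap (h : 'I_n -> B) (p : {mpoly K[n]}) :
  d (mmap (in_alg B) h p) = \sum_i mmap (in_alg B) h p^`M(i) * d (h i).
Proof.
pose P (p : {mpoly K[n]}) :=
  d (mmap (in_alg B) h p) = \sum_i mmap (in_alg B) h p^`M(i) * d (h i).
have PC c : P c%:MP.
  rewrite /P mmapC /= linearZ /= derivation1 scaler0 big1 // => i _.
  by rewrite mderivC mmap0 mul0r.
have PD a b : P a -> P b -> P (a + b).
  rewrite /P !rmorphD /= raddfD /= => -> ->; rewrite -big_split.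
  by apply: eq_bigr => i _; rewrite /= mderivD rmorphD mulrDl.
have PM a b : P a -> P b -> P (a * b).
  rewrite /P !rmorphM /= dM => -> ->; rewrite mulr_suml mulr_sumr -big_split.
  apply: eq_bigr => i _ /=; rewrite mderivM rmorphD !rmorphM mulrDl /=.
  by rewrite mulrAC -!mulrA.
have PU i : P 'X_i.
  rewrite /P mmapX mmap1U (bigD1 i) //= big1 ?addr0 => [|j ji]; rewrite mderivXU.
    by rewrite eqxx mpolyC1 rmorph1 mul1r.
  by rewrite eq_sym (negPf ji) mpolyC0 mmap0 mul0r.
have Pexp i k : P ('X_i ^+ k).
  elim: k => [|k IH]; first by rewrite expr0 -mpolyC1; exact: PC.
  by rewrite exprS; apply: PM.
elim/mpolyind: p => [|c m p _ _ IH]; first by rewrite -(mpolyC0 n); exact: PC.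
apply: PD => //; rewrite -mul_mpolyC; apply: (PM) => //.
rewrite mpolyXE_id; elim/big_rec: _ => [|i q _ Pq]; last exact: PM.
by rewrite -mpolyC1; exact: PC.
Qed.

End ChainRule.

Section Evaluation.
Context (K : numFieldType) (n : nat).
Implicit Types (p q : {mpoly K[n]}) (x y z : 'rV[K]_n).

(** The parameter 0 is left out so that the lemma can pass to limits: a vanishing known for all
    nonzero e extends to e = 0. *)
Lemma poly_zeros (q : {poly K}) : (forall e, e != 0 -> q.[e] = 0) -> q = 0.
Proof.
move=> q0; apply/eqP/negPn/negP => qn0.
pose s := [seq (i.+1)%:R : K | i <- iota 0 (size q)].
have us : uniq s.
  rewrite map_inj_uniq ?iota_uniq // => i j /eqP; rewrite eqr_nat => /eqP; lia.
have rs : all (root q) s.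
  by apply/allP => _ /mapP[i _ ->]; rewrite rootE q0 // pnatr_eq0.
by have := max_poly_roots qn0 rs us; rewrite size_map size_iota ltnn.
Qed.

Definition restr_curve (h : 'I_n -> {poly K}) p : {poly K} := mmap (in_alg {poly K}) h p.

Lemma horner_restr_curve h p e :
  (restr_curve h p).[e] = p.@[fun i => (h i).[e]].
Proof.
rewrite /restr_curve /meval /mmap horner_sum; apply: eq_bigr => m _.
rewrite hornerM /= alg_polyC hornerC; congr (_ * _).
rewrite /mmap1 -[LHS]/((horner_eval e) _) rmorph_prod; apply: eq_bigr => i _.
by rewrite rmorphXn.
Qed.

Lemma deriv_restr_curve h p :
  (restr_curve h p)^`() = \sum_i restr_curve h p^`M(i) * (h i)^`().
Proof.
exact: (@derivation_mmap _ _ _ (@deriv K) (@derivM K)).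
Qed.

(** The value at 0 serves to compute closures, the derivative at 0 to produce tangent vectors. *)
Lemma curve_tangent (h : 'I_n -> {poly K}) p :
    (forall e, e != 0 -> p.@[fun i => (h i).[e]] = 0) ->
  p.@[fun i => (h i).[0]] = 0 /\
  \sum_i (p^`M(i)).@[fun i => (h i).[0]] * (h i)^`().[0] = 0.
Proof.
move=> p0; have r0 : restr_curve h p = 0.
  by apply: poly_zeros => e en0; rewrite horner_restr_curve p0.
split; first by rewrite -horner_restr_curve r0 horner0.
have := congr1 (fun q : {poly K} => q.[0]) (deriv_restr_curve h p).
rewrite r0 derivC horner0 horner_sum => /esym /=.
by under eq_bigr do rewrite hornerM horner_restr_curve.
Qed.

Lemma mderiv_const p : (forall i, p^`M(i) = 0) -> p = (p@_0%MM)%:MP.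
Proof.
move=> dp; apply/mpolyP => m; rewrite mcoeffC.
case: eqVneq => [->|mn0]; first by rewrite mulr1.
rewrite mulr0; have [i mi] : exists i, m i != 0%N.
  apply/existsP; apply: contraNT mn0; rewrite negb_exists => /forallP h.
  by apply/eqP/mnmP => i; rewrite mnmE; apply/eqP; rewrite -[_ == _]negbK h.
have := congr1 (mcoeff (m - U_(i))%MM) (dp i); rewrite mcoeff_mderiv mcoeff0.
rewrite submK; last first.
  by apply/mnm_lepP => j; rewrite mnm1E; case: eqVneq => [<-|//]; rewrite lt0n.
by move/eqP; rewrite mulrn_eq0 /= => /eqP.
Qed.

Lemma msize_mderiv p i : p != 0 -> (msize p^`M(i) < msize p)%N.
Proof.
move=> pn0; have [->|dn0] := eqVneq p^`M(i) 0.
  by rewrite msize0 lt0n msize_poly_eq0.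
rewrite -mlead_deg //.
set m := mlead _; have mp : (m + U_(i))%MM \in msupp p.
  have := mlead_supp dn0; rewrite -/m !mcoeff_msupp mcoeff_mderiv.
  by apply: contra => /eqP ->; rewrite mul0rn.
have := msize_mdeg_lt mp; rewrite mdegD mdeg1 addn1; lia.
Qed.

(** Since p is zero along every coordinate line, its partial derivatives vanish at all points, hence
    are zero by induction on the size; so p is constant. *)
Lemma mpoly_zero p : (forall x, p.@[x 0] = 0) -> p = 0.
Proof.
have [k] := ubnP (msize p); elim: k p => // k IH p ltp p0.
have [->//|pn0] := eqVneq p 0.
have dp i : p^`M(i) = 0.
  apply: IH => [|x]; first by have := msize_mderiv i pn0; lia.
  pose h (j : 'I_n) : {poly K} := (x 0 j)%:P + (j == i)%:R *: 'X.
  have [|_] := @curve_tangent h p.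
    move=> e _; rewrite -(p0 (\row_j (h j).[e])); apply: meval_eq => j.
    by rewrite mxE.
  rewrite (bigD1 i) //= big1 ?addr0 => [|j ji]; last first.
    by rewrite /h (negPf ji) scale0r addr0 derivC horner0 mulr0.
  rewrite /h eqxx scale1r derivD derivC derivX add0r hornerC mulr1 => <-.
  by apply: meval_eq => j; rewrite hornerD hornerC hornerZ hornerX mulr0 addr0.
have pC := mderiv_const dp; rewrite pC.
by have := p0 0; rewrite {1}pC mevalC => ->.
Qed.

Lemma mpoly_neq0P p : p != 0 -> exists x, p.@[x 0] != 0.
Proof.
move=> pn0; apply: boolp.contrapT => h; case/eqP: pn0; apply: mpoly_zero => x.
by apply/eqP/negPn/negP => px; apply: h; exists x.
Qed.

(** The bridge from linear algebra at generic points, where g does not vanish, to polynomial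
    identities that can be differentiated. *)
Lemma mpoly_zero_generic g p :
  g != 0 -> (forall x, g.@[x 0] != 0 -> p.@[x 0] = 0) -> p = 0.
Proof.
move=> gn0 gp; have /eqP : g * p = 0.
  apply: mpoly_zero => x; rewrite mevalM; have [->|/gp->] := eqVneq g.@[x 0] 0.
    by rewrite mul0r.
  by rewrite mulr0.
by rewrite mulf_eq0 (negPf gn0) => /eqP.
Qed.

End Evaluation.

(** * Symmetric trilinear forms *)

Section Trilinear.
Context (A : comNzRingType) (n : nat).
Implicit Types (t : 'I_n -> 'I_n -> 'I_n -> A) (u v w : 'rV[A]_n).

Definition dotr (v w : 'rV[A]_n) : A := \sum_i v 0 i * w 0 i.

Lemma dotrC v w : dotr v w = dotr w v.
Proof. by apply: eq_bigr => i _; rewrite mulrC. Qed.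
Lemma dotrDl u v w : dotr (u + v) w = dotr u w + dotr v w.
Proof. by rewrite -big_split; apply: eq_bigr => i _; rewrite mxE mulrDl. Qed.
Lemma dotrZl c v w : dotr (c *: v) w = c * dotr v w.
Proof. by rewrite mulr_sumr; apply: eq_bigr => i _; rewrite mxE mulrA. Qed.
Lemma dotrDr u v w : dotr u (v + w) = dotr u v + dotr u w.
Proof. by rewrite dotrC dotrDl !(dotrC u). Qed.
Lemma dotrZr c v w : dotr v (c *: w) = c * dotr v w.
Proof. by rewrite dotrC dotrZl dotrC. Qed.
Lemma dotrNl v w : dotr (- v) w = - dotr v w.
Proof. by rewrite -scaleN1r dotrZl mulN1r. Qed.
Lemma dotrNr v w : dotr v (- w) = - dotr v w.
Proof. by rewrite dotrC dotrNl dotrC. Qed.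
Lemma dotr0l w : dotr 0 w = 0.
Proof. by rewrite -(scale0r 0) dotrZl mul0r. Qed.
Lemma dotr_delta v i : dotr v (delta_mx 0 i) = v 0 i.
Proof.
rewrite /dotr (bigD1 i) //= mxE !eqxx mulr1 big1 ?addr0 // => j ji.
by rewrite mxE (negPf ji) andbF mulr0.
Qed.
Lemma dotr_eq0 v : (forall w, dotr v w = 0) -> v = 0.
Proof. by move=> v0; apply/rowP => i; rewrite -dotr_delta v0 mxE. Qed.
Lemma dotrE v w : dotr v w = (v *m w^T) 0 0.
Proof. by rewrite mxE; apply: eq_bigr => i _; rewrite mxE. Qed.
Lemma dotr_mulmx v w (M : 'M_n) : dotr (v *m M) w = dotr v (w *m M^T).
Proof. by rewrite !dotrE trmx_mul trmxK mulmxA. Qed.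

Definition symt t := forall a b c, t a b c = t b a c /\ t a b c = t a c b.

(** The covector T(u, v, -) of the trilinear form T with coefficients t; [bilmx] below is the matrix
    of T(u, -, -). *)
Definition bil t u v : 'rV[A]_n :=
  \row_c \sum_a \sum_b t a b c * u 0 a * v 0 b.

Definition bilmx t u : 'M[A]_n := \matrix_(b, c) \sum_a t a b c * u 0 a.

Lemma mul_bilmx t u v : v *m bilmx t u = bil t u v.
Proof.
apply/rowP => c; rewrite !mxE exchange_big; apply: eq_bigr => b _ /=.
by rewrite mxE mulr_sumr; apply: eq_bigr => a _; rewrite mulrC.
Qed.

Section Symmetric.
Context (t : 'I_n -> 'I_n -> 'I_n -> A) (ts : symt t).
Local Notation bil := (bil t).
Local Notation bilmx := (bilmx t).

Lemma bilC u v : bil u v = bil v u.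
Proof.
apply/rowP => c; rewrite !mxE exchange_big; apply: eq_bigr => b _ /=.
by apply: eq_bigr => a _; rewrite (proj1 (ts a b c)) mulrAC.
Qed.

Lemma bilDr u v w : bil u (v + w) = bil u v + bil u w.
Proof. by rewrite -!mul_bilmx mulmxDl. Qed.
Lemma bilZr c u v : bil u (c *: v) = c *: bil u v.
Proof. by rewrite -!mul_bilmx scalemxAl. Qed.
Lemma bilDl u v w : bil (u + v) w = bil u w + bil v w.
Proof. by rewrite bilC bilDr !(bilC w). Qed.
Lemma bilZl c u v : bil (c *: u) v = c *: bil u v.
Proof. by rewrite bilC bilZr bilC. Qed.
Lemma bilNr u v : bil u (- v) = - bil u v.
Proof. by rewrite -!mul_bilmx mulNmx. Qed.
Lemma bilNl u v : bil (- u) v = - bil u v.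
Proof. by rewrite bilC bilNr bilC. Qed.
Lemma bil0r u : bil u 0 = 0.
Proof. by rewrite -mul_bilmx mul0mx. Qed.
Lemma bil0l u : bil 0 u = 0.
Proof. by rewrite bilC bil0r. Qed.

Lemma dotr_bilC u v w : dotr (bil u v) w = dotr (bil u w) v.
Proof.
rewrite /dotr; under eq_bigr do rewrite mxE exchange_big mulr_suml.
under [RHS]eq_bigr do rewrite mxE exchange_big mulr_suml.
rewrite exchange_big; apply: eq_bigr => b _; apply: eq_bigr => c _ /=.
rewrite !mulr_suml; apply: eq_bigr => a _.
by rewrite (proj2 (ts a b c)) -!mulrA; congr (_ * (_ * _)); rewrite mulrC.
Qed.

Lemma tr_bilmx u : (bilmx u)^T = bilmx u.
Proof.
by apply/matrixP => b c; rewrite !mxE; apply: eq_bigr => a _; rewrite (proj2 (ts a b c)).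
Qed.

End Symmetric.
End Trilinear.

Lemma map_bil (A B : comNzRingType) (g : {rmorphism A -> B}) n
    (t : 'I_n -> 'I_n -> 'I_n -> A) u v :
  map_mx g (bil t u v) = bil (fun a b c => g (t a b c)) (map_mx g u) (map_mx g v).
Proof.
apply/rowP => c; rewrite !mxE rmorph_sum; apply: eq_bigr => a _.
by rewrite rmorph_sum; apply: eq_bigr => b _; rewrite !rmorphM !mxE.
Qed.

Lemma map_dotr (A B : comNzRingType) (g : {rmorphism A -> B}) n (u v : 'rV[A]_n) :
  g (dotr u v) = dotr (map_mx g u) (map_mx g v).
Proof. by rewrite rmorph_sum; apply: eq_bigr => i _; rewrite rmorphM !mxE. Qed.

Section SymmetricMatrices.
Context (K : fieldType) (n : nat).

(** If all these minors vanish, M is a column times a row. A nonzero minor makes the rank condition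
    polynomial, hence open in the point. *)
Lemma mxrank_gt_minor2 (M : 'M[K]_n) : (1 < \rank M)%N ->
  exists i j k l, M i j * M k l - M i l * M k j != 0.
Proof.
move=> rM; have [M0|] := eqVneq M 0; first by move: rM; rewrite M0 mxrank0.
move=> Mn0; apply: contrapT => h.
have /matrix0Pn[i [j Mij]] := Mn0.
have E : M = (col j M) *m ((M i j)^-1 *: row i M).
  apply/matrixP => k l; rewrite !mxE big_ord1 !mxE.
  have : M i j * M k l - M i l * M k j = 0.
    by apply/eqP/negPn/negP => hh; apply: h; exists i, j, k, l.
  by move/subr0_eq => hh; rewrite mulrCA [M k j * _]mulrC -hh mulKf.
by move: rM; rewrite E ltnNge (leq_trans (mxrankM_maxr _ _)) ?rank_leq_row.
Qed.

Lemma minor2_rank_gt (M : 'M[K]_n) i j k l :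
  M i j * M k l - M i l * M k j != 0 -> (1 < \rank M)%N.
Proof.
apply: contraR; rewrite -leqNgt => rM; have [M0|Mn0] := eqVneq M 0.
  by rewrite M0 !mxE !mul0r subrr.
have rM1 : \rank M = 1%N.
  by apply/eqP; rewrite eqn_leq rM lt0n mxrank_eq0.
have := mulmx_base M; move: (col_base M) (row_base M).
rewrite rM1 => C R <-; rewrite !mxE !big_ord1; apply/eqP; ring.
Qed.

(** The kernel of S has codimension 2 and lies in the hyperplane orthogonal to phi, which also
    contains y outside that kernel. So the hyperplane is ker S + <y>. *)
Lemma ker_codim2 (S : 'M[K]_n) (phi y w : 'rV[K]_n) :
    \rank S = 2 -> phi != 0 ->
    (forall p, p *m S = 0 -> dotr phi p = 0) -> dotr phi y = 0 -> y *m S != 0 ->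
    dotr phi w = 0 ->
  exists r, w *m S = r *: (y *m S).
Proof.
move=> rS phin0 phiS phiy yS phiw.
have n1 : (1 < n)%N by have := rank_leq_row S; rewrite rS.
have rphi : \rank (kermx phi^T) = n.-1.
  rewrite mxrank_ker mxrank_tr -subn1; congr (_ - _)%N; apply/eqP.
  by rewrite eqn_leq rank_leq_row lt0n mxrank_eq0.
have inphi p : dotr phi p = 0 -> (p <= kermx phi^T)%MS.
  move=> pp; apply/sub_kermxP/matrixP => i j; rewrite !ord1.
  by rewrite -dotrE dotrC pp mxE.
have Sphi : (kermx S <= kermx phi^T)%MS.
  apply/row_subP => i; apply: inphi; apply: phiS.
  by rewrite -row_mul mulmx_ker row0.
have sub : (kermx S + y <= kermx phi^T)%MS by rewrite addsmx_sub Sphi inphi.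
have yK : (kermx S :&: y)%MS = 0.
  apply/eqP; rewrite -mxrank_eq0 -leqn0 leqNgt; apply/negP => lt.
  have : \rank (kermx S :&: y) = \rank y.
    apply/eqP; rewrite eqn_leq mxrankS ?capmxSr //=.
    by rewrite (leq_trans (rank_leq_row _)).
  move/eqP; rewrite (mxrank_leqif_sup (capmxSr _ _)) sub_capmx.
  by case/andP => /sub_kermxP yS0 _; case/eqP: yS.
have rsum : \rank (kermx S + y)%MS = n.-1.
  have := mxrank_sum_cap (kermx S) y; rewrite yK mxrank0 addn0 => ->.
  rewrite mxrank_ker rS; have -> : \rank y = 1%N; last first.
    by have := rank_leq_row S; rewrite rS; lia.
  apply/eqP; rewrite eqn_leq rank_leq_row lt0n mxrank_eq0.
  by apply: contra yS => /eqP ->; rewrite mul0mx.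
have : (w <= kermx S + y)%MS.
  have /eqP := rsum; rewrite -rphi (mxrank_leqif_sup sub).
  by move=> h; exact: submx_trans (inphi w phiw) h.
case/sub_addsmxP => -[a r] /= ->; exists (r 0 0); rewrite mulmxDl -mulmxA mulmx_ker mulmx0 add0r.
by rewrite [r]mx11_scalar mul_scalar_mx mxE eqxx mulr1n scalemxAl.
Qed.

End SymmetricMatrices.

(** * Cubics with vanishing hessian *)

Section PointwiseKernel.
Context (K : fieldType) (t : 'I_6 -> 'I_6 -> 'I_6 -> K) (ts : symt t).
Context (X k : 'rV[K]_6) (J : 'M[K]_6) (beta : 'rV[K]_6 -> 'rV[K]_6 -> 'rV[K]_6).
Local Notation bil := (bil t).
Local Notation S := (bilmx t k).
Hypothesis rX : \rank (bilmx t X) = 5.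
Hypothesis kn0 : k != 0.
Hypothesis Xk : bil X k = 0.
(** J is the Jacobian of the kernel map at X. [kJ] will come from Euler's identity, [JX] and [Jk]
    from differentiating T(x, k, -) = 0 and T(k, k, -) = 0. *)
Hypothesis kJ : (k <= J)%MS.
Hypothesis JX : forall y, bil X (y *m J) = - bil k y.
Hypothesis Jk : forall y, bil k (y *m J) = 0.

Lemma kerX v : bil X v = 0 -> (v <= k)%MS.
Proof.
move=> Xv; have kK : (k <= kermx (bilmx t X))%MS by apply/sub_kermxP; rewrite mul_bilmx.
have : (kermx (bilmx t X) <= k)%MS.
  rewrite -(mxrank_leqif_sup kK) mxrank_ker rX rank_rV kn0 //.
by apply: submx_trans; apply/sub_kermxP; rewrite mul_bilmx.
Qed.

(** H(X) maps the image of J onto that of H(k), up to sign, and its kernel <k> lies inside the image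
    of J. *)
Lemma rank_Jacobian : \rank J = (\rank S).+1.
Proof.
have E : J *m bilmx t X = - S.
  apply/row_matrixP => i; rewrite row_mul mul_bilmx // rowE JX -mul_bilmx.
  by rewrite -mulmxN -rowE.
have := mxrank_mul_ker J (bilmx t X); rewrite E mxrank_opp.
suff -> : \rank (J :&: kermx (bilmx t X)) = 1%N by rewrite addn1.
transitivity (\rank k); last by rewrite rank_rV kn0.
apply: eqmx_rank; apply/andP; split; last first.
  by rewrite sub_capmx kJ; apply/sub_kermxP; rewrite mul_bilmx.
apply/row_subP => i; apply: kerX; rewrite -mul_bilmx.
by apply/sub_kermxP; apply: submx_trans (row_sub _ _) (capmxSr _ _).
Qed.

(** J S = 0 gives rk J + rk S <= 6, that is 2 rk S + 1 <= 6. *)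
Lemma rank_polar_quadric : (\rank S <= 2)%N.
Proof.
have JS : J *m S = 0.
  by apply/row_matrixP => i; rewrite row_mul mul_bilmx rowE Jk row0.
by have := mulmx0_rank_max JS; rewrite rank_Jacobian; lia.
Qed.

Hypothesis rS : \rank S = 2.
Hypothesis three : (3 : K) != 0.
Hypothesis two : (2 : K) != 0.
(** [beta y z] stands for the second derivative of the kernel map at X in the directions y and z. *)
Hypothesis Jbeta : forall y z, bil (y *m J) (z *m J) = - bil k (beta y z).
Hypothesis cyc : forall y z w, dotr (bil (y *m J) (z *m J)) w
  + dotr (bil (y *m J) (w *m J)) z + dotr (bil (z *m J) (w *m J)) y = 0.
Hypothesis beta_isotropic : forall y z, dotr (bil k (beta y y)) (beta y z) = 0.

Lemma bilkk : bil k k = 0.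
Proof. by case/submxP: kJ => y {2}->; rewrite Jk. Qed.

(** Write phi for this covector and suppose it nonzero. It kills ker H(k) and, by [cyc], also y, so
    its hyperplane is ker H(k) + <y>. That hyperplane contains every beta(y, z), whence T(k, beta(y,
    z), -) is a multiple of T(k, y, -). The case z = y yields T(k, y, y) = 0, and [cyc] then leaves
    only phi(z) = 0 for all z. *)
Lemma tangent_square y : bil (y *m J) (y *m J) = 0.
Proof.
set phi := bil _ _; apply: contraTeq isT => phin0.
have phik p : bil k p = 0 -> dotr phi p = 0.
  move=> kp; rewrite /phi Jbeta dotrNl (dotr_bilC ts) kp dotr0l oppr0 //.
have phiy : dotr phi y = 0.
  have := cyc y y y; rewrite -/phi -{1 2 3}[dotr phi y]mul1r -!mulrDl => /eqP.
  have -> : 1 + 1 + 1 = 3 :> K by ring.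
  by rewrite mulf_eq0 (negPf three) => /eqP.
have ky : bil k y != 0.
  apply: contra phin0 => /eqP ky; rewrite /phi.
  have /kerX /sub_rVP[c ->] : bil X (y *m J) = 0 by rewrite JX ky oppr0.
  by rewrite bilZr (bilZl ts) bilkk !scaler0.
have rz z : exists r, bil k (beta y z) = r *: bil k y.
  have [] := @ker_codim2 _ _ S phi y (beta y z) rS phin0.
  - by move=> p; rewrite mul_bilmx => /phik.
  - exact: phiy.
  - by rewrite mul_bilmx.
  - by rewrite /phi Jbeta dotrNl beta_isotropic oppr0.
  by move=> r; rewrite !mul_bilmx; exists r.
have [r0 phiE] := rz y.
have r0n : r0 != 0.
  by apply: contra phin0 => /eqP r00; rewrite /phi Jbeta phiE r00 scale0r oppr0.
have kyy : dotr (bil k y) y = 0.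
  have := phiy; rewrite /phi Jbeta phiE dotrNl dotrZl => /eqP.
  by rewrite oppr_eq0 mulf_eq0 (negPf r0n) => /eqP.
case/eqP: phin0; apply: dotr_eq0 => z.
have [r rE] := rz z; have := cyc y y z.
by rewrite -/phi Jbeta rE dotrNl dotrZl kyy mulr0 oppr0 !addr0.
Qed.

Lemma tangent_product y z : bil (y *m J) (z *m J) = 0.
Proof.
have := tangent_square (y + z); rewrite mulmxDl (bilDl ts) !bilDr.
rewrite !tangent_square add0r addr0 [X in _ + X](bilC ts) -mulr2n -scaler_nat => /eqP.
by rewrite scaler_eq0 (negPf two) => /eqP.
Qed.

Hypothesis fX : dotr (bil X X) X != 0.

(** The image of J has dimension 3 and misses X because T(X, X, X) is nonzero, so together they fill
    the 4-dimensional kernel of H(k). The component of w along X vanishes because T(zJ, X, -) = -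
    T(k, z, -) is nonzero for some z. *)
Lemma mem_tangent w :
  bil k w = 0 -> (forall y, bil (y *m J) w = 0) -> exists y, w = y *m J.
Proof.
move=> kw Jw; have XJ y : X != y *m J.
  apply: contra fX => /eqP E; rewrite {2}E JX dotrNl (dotr_bilC ts).
  by rewrite (bilC ts k) Xk dotr0l oppr0.
have sub : (J + X <= kermx S)%MS.
  rewrite addsmx_sub; apply/andP; split; last first.
    by apply/sub_kermxP; rewrite mul_bilmx (bilC ts).
  by apply/row_subP => i; apply/sub_kermxP; rewrite mul_bilmx rowE Jk.
have rJ : (\rank J < \rank (J + X))%N.
  rewrite ltn_neqAle mxrankS ?addsmxSl // andbT.
  rewrite (mxrank_leqif_sup (addsmxSl _ _)) addsmx_sub submx_refl /=.
  by apply/negP => /submxP[y /eqP]; apply/negP.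
have : (w <= J + X)%MS.
  apply: submx_trans (_ : (w <= kermx S)%MS) _.
    by apply/sub_kermxP; rewrite mul_bilmx.
  rewrite -(geq_leqif (mxrank_leqif_sup sub)) mxrank_ker rS.
  by move: rJ; rewrite rank_Jacobian rS.
case/sub_addsmxP => -[y s] /= wE; exists y; rewrite wE.
have {}wE : w = y *m J + s 0 0 *: X.
  by rewrite wE [s in s *m X]mx11_scalar mul_scalar_mx.
have [z kz] : exists z, bil k z != 0.
  apply: contrapT => h; move: rS; suff -> : S = 0 by rewrite mxrank0.
  apply/row_matrixP => i; rewrite rowE mul_bilmx row0.
  by apply/eqP/negPn/negP => kz; apply: h; exists (delta_mx 0 i).
have := Jw z; rewrite wE bilDr tangent_product add0r bilZr (bilC ts _ X) JX.
move/eqP; rewrite scaler_eq0 oppr_eq0 (negPf kz) orbF => /eqP s0.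
by rewrite [s]mx11_scalar s0 mul_scalar_mx scale0r addr0.
Qed.

End PointwiseKernel.

(** Were all cofactors zero, changing one entry (i, j) would leave the determinant zero. But if i
    and j are chosen in the supports of the left and right kernel vectors, adding 1 there makes M
    invertible. *)
Lemma adj_corank1 (K : fieldType) (n : nat) (M : 'M[K]_n) :
  \rank M = n.-1 -> (0 < n)%N -> \adj M != 0.
Proof.
move=> rM n0; apply/eqP => adj0.
have rk (N : 'M[K]_n) : \rank N = n.-1 -> exists i, exists2 u : 'rV_n, u *m N = 0 &
    u 0 i != 0 /\ forall w : 'rV_n, w *m N = 0 -> (w <= u)%MS.
  move=> rN; have rK : \rank (kermx N) = 1%N by rewrite mxrank_ker rN; lia.
  have /rowV0Pn[u uK un0] : kermx N != 0 by rewrite -mxrank_eq0 rK.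
  have /rV0Pn[i ui] := un0.
  exists i, u; first exact/sub_kermxP.
  split=> // w /sub_kermxP wK; apply: submx_trans wK _.
  by rewrite -(mxrank_leqif_sup uK) rK rank_rV un0.
have [i [u uM [ui uker]]] := rk M rM.
have [j [v vM [vj _]]] := rk M^T (etrans (mxrank_tr M) rM).
have {}vM : M *m v^T = 0 by apply: trmx_inj; rewrite trmx_mul trmxK vM trmx0.
have detM : \det M = 0.
  apply/eqP/det0P; exists u => //; apply: contra ui => /eqP ->; by rewrite mxE.
pose N := M + delta_mx i j.
have : \det N = 0.
  rewrite (expand_det_row N i); transitivity (\sum_k N i k * cofactor M i k).
    apply: eq_bigr => k _; congr (_ * _); rewrite /cofactor; congr (_ * \det _).
    by apply/matrixP => a b; rewrite !mxE eq_sym (negPf (neq_lift _ _)) addr0.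
  rewrite big1 // => k _; have -> : cofactor M i k = (\adj M) k i by rewrite mxE.
  by rewrite adj0 (_ : (0 : 'M[K]_n) k i = 0) ?mulr0 // mxE.
move/eqP/det0P => [w wn0]; rewrite mulmxDr => /eqP; rewrite addr_eq0 => /eqP wM.
have wi : w 0 i = 0.
  have : w *m delta_mx i j *m v^T = 0.
    by rewrite -[w *m delta_mx i j]opprK -wM mulNmx -mulmxA vM mulmx0 oppr0.
  move/matrixP/(_ 0 0); rewrite !mxE (bigD1 j) //= big1 => [|k kj].
    rewrite addr0 !mxE (bigD1 i) //= big1 => [|k ki]; last by rewrite mxE (negPf ki) mulr0.
    by rewrite addr0 mxE !eqxx mulr1 => /eqP; rewrite mulf_eq0 (negPf vj) orbF => /eqP.
  rewrite mxE big1 ?mul0r // => l _; rewrite mxE (negPf kj) andbF mulr0 //.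
have : w *m M = 0.
  rewrite wM; apply/eqP; rewrite oppr_eq0; apply/eqP/rowP => l; rewrite !mxE big1 // => k _.
  by rewrite mxE; case: eqVneq => [->|_]; rewrite ?wi ?mul0r ?mulr0.
move/uker/sub_rVP => [c wE]; move: wi; rewrite wE mxE => /eqP.
rewrite mulf_eq0 (negPf ui) orbF => /eqP c0.
by case/eqP: wn0; rewrite wE c0 scale0r.
Qed.

(** * Homogeneous polynomials and Euler's identity *)

Section Homogeneous.
Context (K : numFieldType) (n : nat).
Implicit Types (p q : {mpoly K[n]}).

Lemma dhomog_mderiv d p i : p \is d.-homog -> p^`M(i) \is d.-1.-homog.
Proof.
move/dhomogP => hp; apply/dhomogP => m.
rewrite mcoeff_msupp mcoeff_mderiv mulrn_eq0 /= -mcoeff_msupp => /hp.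
rewrite /= mdegD mdeg1 => <-; lia.
Qed.

Lemma dhomog_euler d p : p \is d.-homog -> \sum_i 'X_i * p^`M(i) = d%:R *: p.
Proof.
move=> /dhomogP hp; rewrite {1 2}[p]mpolyE scaler_sumr.
transitivity (\sum_i \sum_(m <- msupp p) p@_m *: ('X_i * ('X_[m])^`M(i))).
  apply: eq_bigr => i _; rewrite (linear_sum (mderiv i)) mulr_sumr.
  by apply: eq_bigr => m _; rewrite /= mderivZ -scalerAr.
rewrite exchange_big big_seq [RHS]big_seq; apply: eq_bigr => m /hp /= <-.
rewrite -scaler_sumr scalerA mulrC -scalerA; congr (_ *: _).
rewrite mdegE natr_sum scaler_suml; apply: eq_bigr => i _; rewrite mderivX -scalerAr -mpolyXD.
have [->|mi] := eqVneq (m i) 0%N; first by rewrite !scale0r.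
rewrite addmC submK //; apply/mnm_lepP => j; rewrite mnm1E.
by case: eqVneq => [<-|//]; rewrite lt0n.
Qed.

Lemma dhomog0_const p : p \is 0.-homog -> p = (p@_0%MM)%:MP.
Proof.
move=> hp; apply/mpolyP => m; rewrite mcoeffC.
case: eqVneq => [->|mn0]; rewrite ?mulr1 ?mulr0 //.
by apply: (dhomog_nemf_coeff hp); rewrite /= mdeg_eq0 eq_sym; move: mn0; rewrite eq_sym.
Qed.

Lemma dhomog_scale d p (c : K) (x : 'rV[K]_n) :
  p \is d.-homog -> p.@[(c *: x) 0] = c ^+ d * p.@[x 0].
Proof.
move/dhomogP => hp; rewrite !mevalE mulr_sumr big_seq [RHS]big_seq.
apply: eq_bigr => m /hp /= <-; rewrite mulrCA; congr (_ * _).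
rewrite mdegE -prodrXr -big_split; apply: eq_bigr => i _.
by rewrite mxE exprMn.
Qed.

Lemma dhomog_det k (M : 'M[{mpoly K[n]}]_k) :
  (forall i j, M i j \is 1.-homog) -> \det M \is k.-homog.
Proof.
move=> hM; rewrite /determinant; apply: rpred_sum => s _.
suff h : forall I : seq 'I_k, \prod_(i <- I) M i (s i) \is (size I).-homog.
  have := h (index_enum 'I_k); rewrite /index_enum -enumT size_enum_ord => h'.
  case: (odd_perm s); rewrite ?expr0 ?mul1r ?expr1 ?mulN1r ?dhomogN //.
elim=> [|i I IH]; first by rewrite big_nil dhomog1.
by rewrite big_cons /=; apply: dhomogM (hM _ _) IH.
Qed.

End Homogeneous.

(** * Vectors with polynomial entries and their derivatives *)

Section PolynomialVectors.
Context (K : numFieldType) (n : nat).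
Local Notation A := {mpoly K[n]}.
Implicit Types (x y z : 'rV[K]_n) (u v w : 'rV[A]_n).

Definition evalv x w : 'rV[K]_n := map_mx (meval (x 0)) w.
Definition dirv y w : 'rV[A]_n := map_mx (dird y) w.
Definition constv y : 'rV[A]_n := map_mx (@mpolyC n K) y.
Definition genv : 'rV[A]_n := \row_i 'X_i.
Definition consttri (t : 'I_n -> 'I_n -> 'I_n -> K) a b c : A := (t a b c)%:MP.
Definition jacv w x : 'M[K]_n := \matrix_(a, i) ((w 0 i)^`M(a)).@[x 0].

Lemma evalv_gen x : evalv x genv = x.
Proof. by apply/rowP => i; rewrite !mxE mevalXU. Qed.
Lemma evalv_const x y : evalv x (constv y) = y.
Proof. by apply/rowP => i; rewrite !mxE mevalC. Qed.
Lemma dirv_gen y : dirv y genv = constv y.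
Proof. by apply/rowP => i; rewrite !mxE dirdXU. Qed.
Lemma dirv_const y z : dirv y (constv z) = 0.
Proof. by apply/rowP => i; rewrite !mxE dirdC. Qed.
Lemma dirvN y u : dirv y (- u) = - dirv y u.
Proof. by rewrite /dirv raddfN. Qed.
Lemma dirv0 y : dirv y 0 = 0.
Proof. by rewrite /dirv raddf0. Qed.
Lemma dirv_comm y z u : dirv y (dirv z u) = dirv z (dirv y u).
Proof. by apply/rowP => i; rewrite !mxE dird_comm. Qed.

Lemma evalv_dirv x y w : evalv x (dirv y w) = y *m jacv w x.
Proof.
apply/rowP => i; rewrite !mxE meval_dird; apply: eq_bigr => a _.
by rewrite mxE.
Qed.

Lemma evalv_ext w : (forall x, evalv x w = 0) -> w = 0.
Proof.
move=> w0; apply/rowP => i; rewrite mxE; apply: mpoly_zero => x.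
by have /rowP/(_ i) := w0 x; rewrite !mxE.
Qed.

Lemma evalv_ext_generic (g : A) w :
  g != 0 -> (forall x, g.@[x 0] != 0 -> evalv x w = 0) -> w = 0.
Proof.
move=> gn0 w0; apply/rowP => i; rewrite mxE; apply: mpoly_zero_generic gn0 _.
by move=> x gx; have /rowP/(_ i) := w0 x gx; rewrite !mxE.
Qed.

Lemma evalv_neq0 w : w != 0 -> exists x, evalv x w != 0.
Proof.
move=> wn0; apply: contrapT => h; case/eqP: wn0; apply: evalv_ext => x.
by apply/eqP/negPn/negP => wx; apply: h; exists x.
Qed.

Lemma symt_const t : symt t -> symt (consttri t).
Proof. by move=> ts a b c; have [E1 E2] := ts a b c; rewrite /consttri -E1 -E2. Qed.

Lemma evalv_bil t x u v :
  evalv x (bil (consttri t) u v) = bil t (evalv x u) (evalv x v).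
Proof.
rewrite /evalv map_bil.
by apply/rowP => c; rewrite !mxE; apply: eq_bigr => a _; apply: eq_bigr => b _; rewrite /consttri /= mevalC.
Qed.

Lemma meval_dotr x u v : (dotr u v).@[x 0] = dotr (evalv x u) (evalv x v).
Proof. exact: map_dotr. Qed.

Lemma dird_dotr y u v : dird y (dotr u v) = dotr (dirv y u) v + dotr u (dirv y v).
Proof.
rewrite /dotr (linear_sum (dird y)) -big_split; apply: eq_bigr => i _ /=.
by rewrite dirdM !mxE.
Qed.

Lemma dirv_bil t y u v : dirv y (bil (consttri t) u v) =
  bil (consttri t) (dirv y u) v + bil (consttri t) u (dirv y v).
Proof.
apply/rowP => c; rewrite !mxE (linear_sum (dird y)) -big_split; apply: eq_bigr => a _ /=.
rewrite (linear_sum (dird y)) -big_split; apply: eq_bigr => b _ /=.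
by rewrite !dirdM !mxE dirdC mul0r add0r.
Qed.

(** A nonzero directional derivative lowers the total size of the entries; when every coordinate
    derivative is zero, the vector is constant. *)
Lemma dirv_top (P : 'rV[A]_n -> Prop) w :
    w != 0 -> P w -> (forall y u, P u -> P (dirv y u)) ->
  exists2 c : 'rV[K]_n, c != 0 & P (constv c).
Proof.
move=> wn0 Pw PD; have [m] := ubnP (\sum_i msize (w 0%R i)).
elim: m w wn0 Pw => // m IH w wn0 Pw ltm.
have [/existsP[a dn0]|h] := boolP [exists a : 'I_n, dirv (delta_mx 0 a) w != 0].
  apply: (IH _ dn0 (PD _ _ Pw)).
  have /rV0Pn[i wi] := wn0.
  rewrite ltnS in ltm; apply: leq_trans ltm.
  have le j : (msize (dirv (delta_mx 0 a) w 0 j)%R <= msize (w 0 j)%R)%N.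
    rewrite mxE dird_delta; have [->|wj] := eqVneq (w 0 j) 0; first by rewrite mderiv0.
    exact: ltnW (msize_mderiv _ wj).
  rewrite (bigD1 i) //= [X in (_ < X)%N](bigD1 i) //=.
  rewrite -addSn; apply: leq_add; last exact: leq_sum.
  by rewrite mxE dird_delta msize_mderiv.
have wC : w = constv (map_mx (mcoeff 0%MM) w).
  apply/rowP => i; rewrite !mxE; apply: mderiv_const => a.
  move: h; rewrite negb_exists => /forallP/(_ a); rewrite negbK => /eqP/rowP/(_ i).
  by rewrite !mxE dird_delta.
exists (map_mx (mcoeff 0%MM) w); last by rewrite -wC.
by apply: contra wn0 => /eqP c0; rewrite wC c0; apply/eqP/rowP => i; rewrite !mxE mpolyC0.
Qed.

End PolynomialVectors.

(** * The polarisation of a cubic form *)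

Section Polarization.
Context (K : numFieldType) (n : nat) (f : {mpoly K[n]}) (hf : f \is 3.-homog).

(** In this normalisation T(x, x, x) = 6 f(x), T(x, x, -) is twice the gradient, and T(x, -, -) is
    the Hessian matrix with no factor. *)
Definition polar_coef (a b c : 'I_n) : K := (f^`M(a)^`M(b)^`M(c))@_0%MM.

Lemma polar_coef_sym : symt polar_coef.
Proof.
move=> a b c; rewrite /polar_coef; split; first by rewrite (mderiv_comm a b).
by rewrite (mderiv_comm b c).
Qed.

Lemma mderiv2E a b : f^`M(a)^`M(b) = \sum_c (polar_coef a b c) *: 'X_c.
Proof.
have h2 : f^`M(a)^`M(b) \is 1.-homog by do 2 apply: dhomog_mderiv (_ : _ \is _.+1.-homog).
rewrite -[LHS]scale1r -(dhomog_euler h2); apply: eq_bigr => c _.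
by rewrite (dhomog0_const (dhomog_mderiv c h2)) -mul_mpolyC mulrC.
Qed.

Lemma meval_mderiv2 a b (x : 'rV[K]_n) : (f^`M(a)^`M(b)).@[x 0] = bilmx polar_coef x a b.
Proof.
rewrite mderiv2E raddf_sum mxE; apply: eq_bigr => c _ /=.
rewrite mevalZ mevalXU; congr (_ * _).
by rewrite (proj2 (polar_coef_sym a b c)) (proj1 (polar_coef_sym a c b)).
Qed.

Lemma meval_mderiv1 a (x : 'rV[K]_n) :
  (f^`M(a)).@[x 0] = 2^-1 * bil polar_coef x x 0 a.
Proof.
have h1 : f^`M(a) \is 2.-homog by exact: dhomog_mderiv (_ : _ \is _.+1.-homog).
have := congr1 (meval (x 0)) (dhomog_euler h1).
rewrite mevalZ raddf_sum /= => E; apply: (@mulfI _ 2); first by rewrite pnatr_eq0.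
rewrite -E mulrA mulfV ?pnatr_eq0 // mul1r -mul_bilmx mxE.
apply: eq_bigr => b _; rewrite mevalM mevalXU mderiv_comm; congr (_ * _).
exact: meval_mderiv2.
Qed.

Lemma meval_cubic (x : 'rV[K]_n) : f.@[x 0] = 6^-1 * dotr (bil polar_coef x x) x.
Proof.
have := congr1 (meval (x 0)) (dhomog_euler hf).
rewrite mevalZ raddf_sum /= => E; apply: (@mulfI _ 3); first by rewrite pnatr_eq0.
rewrite -E /dotr !mulr_sumr; apply: eq_bigr => a _.
rewrite mevalM mevalXU meval_mderiv1; by field.
Qed.

Lemma meval_hess (x : 'rV[K]_n) : (hess f).@[x 0] = \det (bilmx polar_coef x).
Proof.
rewrite /hess -det_map_mx; congr (\det _); apply/matrixP => a b.
by rewrite -meval_mderiv2 !mxE.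
Qed.

Lemma grad_bil (x : 'rV[K]_n) : grad f x = 2^-1 *: bil polar_coef x x.
Proof. by apply/rowP => a; rewrite [LHS]mxE meval_mderiv1 [RHS]mxE. Qed.

End Polarization.

Lemma mxrank_row'_col' (K : fieldType) n (M : 'M[K]_n) i j :
  (\rank (row' i (col' j M)) <= \rank M)%N.
Proof.
rewrite row'Esub rowsubE; apply: leq_trans (mxrankM_maxr _ _) _.
by rewrite col'Esub -{1}[M]mulmx1 -mulmx_colsub mxrankM_maxl.
Qed.

Lemma adj_neq0_rank (K : fieldType) n (M : 'M[K]_n) :
  \adj M != 0 -> (n.-1 <= \rank M)%N.
Proof.
case/matrix0Pn => i [j].
rewrite mxE /cofactor mulf_eq0 negb_or => /andP[_ d0].
apply: leq_trans (mxrank_row'_col' M j i).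
by rewrite (eqP (_ : row_free _)) // row_free_unit unitmxE unitfE.
Qed.

Lemma addvv_eq0 (K : numFieldType) n m (v : 'rV[{mpoly K[n]}]_m) : v + v = 0 -> v = 0.
Proof.
move=> /rowP vv; apply/rowP => i; have := vv i; rewrite !mxE -mulr2n -mulr_natl.
rewrite -mpolyC_nat => /eqP; rewrite mulf_eq0 mpolyC_eq0 pnatr_eq0 => /eqP //.
Qed.

Lemma cubic_polar0 (K : numFieldType) n (t : 'I_n -> 'I_n -> 'I_n -> K) :
    symt t -> (forall z, dotr (bil t z z) z = 0) ->
  forall u z, dotr (bil t u u) z = 0.
Proof.
move=> ts cub u z; have E c : c * (dotr (bil t u u) z + dotr (bil t u u) z + dotr (bil t u u) z)
    + c ^+ 2 * (dotr (bil t z z) u + dotr (bil t z z) u + dotr (bil t z z) u) = 0.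
  have := cub (u + c *: z).
  rewrite !(bilDl ts) !bilDr !(bilZl ts) !bilZr !dotrDl !dotrDr !dotrZl !dotrZr !cub.
  rewrite !(bilC ts z u) [dotr (bil t u z) u](dotr_bilC ts).
  have -> : dotr (bil t u z) z = dotr (bil t z z) u by rewrite (bilC ts) (dotr_bilC ts).
  by move=> <-; ring.
(* Subtracting the values at c = 1 and c = -1 isolates the part odd in c. *)
have := E 1; have := E (-1); set p := dotr _ _; set q := dotr _ _ => h1 h2.
have /eqP : 6 * p = 0.
  transitivity (1 * (p + p + p) + 1 ^+ 2 * (q + q + q)
    - (-1 * (p + p + p) + (-1) ^+ 2 * (q + q + q))); first by ring.
  by rewrite h1 h2 subrr.
by rewrite mulf_eq0 pnatr_eq0 => /eqP.
Qed.

(** Pair the second derivative of T(x, k, -) = 0 with kw. Symmetry and the other two hypotheses turn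
    the term T(X, kyz, kw) into T(ky, kz, cw). *)
Lemma second_order_cyclic (A : comNzRingType) n (t : 'I_n -> 'I_n -> 'I_n -> A)
    (ts : symt t) (X k ky kz kw kyz cy cz cw : 'rV[A]_n) :
    bil t cz ky + bil t X kyz = - bil t kz cy ->
    bil t X kw = - bil t k cw -> bil t ky kz = - bil t k kyz ->
  dotr (bil t ky kz) cw + dotr (bil t ky kw) cz + dotr (bil t kz kw) cy = 0.
Proof.
move=> h hw hyz; have := congr1 (fun u => dotr u kw) h; rewrite /= dotrDl dotrNl.
rewrite (dotr_bilC ts X kyz kw) hw dotrNl (dotr_bilC ts k cw kyz) -dotrNl -hyz.
rewrite (bilC ts cz ky) (dotr_bilC ts ky cz kw) (dotr_bilC ts kz cy kw).
by move=> E; rewrite [X in X + _]addrC E addNr.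
Qed.

(** The first hypothesis is the derivative of T(ky, ky, ky) = 0; its three terms are equal by
    symmetry. *)
Lemma isotropic_beta (A : comNzRingType) n (t : 'I_n -> 'I_n -> 'I_n -> A)
    (ts : symt t) (k ky kyy kyz : 'rV[A]_n) :
    dotr (bil t kyz ky + bil t ky kyz) ky + dotr (bil t ky ky) kyz = 0 ->
    bil t ky ky = - bil t k kyy ->
  3%:R * dotr (bil t k kyy) kyz = 0.
Proof.
rewrite dotrDl (bilC ts kyz ky) (dotr_bilC ts ky kyz ky) => h hyy.
by move: h; rewrite hyy dotrNl -!opprD => /eqP; rewrite oppr_eq0 => /eqP h; rewrite -h; ring.
Qed.

(** * Polar quadrics of the kernel vectors have rank one *)

Section CorankOne.
Context (K : numFieldType) (t : 'I_6 -> 'I_6 -> 'I_6 -> K) (ts : symt t).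
Local Notation A := {mpoly K[6]}.
Hypothesis nondeg : forall u, (forall v, bil t u v = 0) -> u = 0.
Local Notation bilA := (bil (consttri t)).
Local Notation X := (@genv K 6).
Let tsA : symt (consttri t) := symt_const ts.

Lemma cubic_apolar_const c : dotr (bilA X X) (constv c) = 0 -> c = 0.
Proof.
move=> Xc; have sq x : dotr (bil t x x) c = 0.
  have := congr1 (meval (x 0)) Xc.
  by rewrite meval_dotr evalv_bil evalv_gen evalv_const meval0.
apply: nondeg => v; apply: dotr_eq0 => w; rewrite (bilC ts) (dotr_bilC ts).
have := sq (v + w); rewrite (bilDl ts) !bilDr !dotrDl !sq add0r addr0.
rewrite [bil t w v](bilC ts) -mulr2n => /eqP; rewrite mulrn_eq0 /= => /eqP //.
Qed.

Context (k : 'rV[A]_6).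
Hypothesis Xk : bilA X k = 0.
Local Notation kd y := (dirv y k).
Local Notation kdd y z := (dirv z (dirv y k)).

Lemma kernel_d1 y : bilA X (kd y) = - bilA k (constv y).
Proof.
have := congr1 (dirv y) Xk; rewrite dirv_bil dirv_gen dirv0.
by rewrite (bilC tsA (constv y)) addrC => /eqP; rewrite addr_eq0 => /eqP.
Qed.

(** T(k, k, y) = - T(x, k_y, k), and this is zero because T(x, k, -) = 0. *)
Lemma kernel_isotropic : bilA k k = 0.
Proof.
apply: evalv_ext => x; apply: dotr_eq0 => y.
rewrite -(evalv_const x y) -meval_dotr (dotr_bilC tsA) -[bilA k _]opprK -kernel_d1.
by rewrite dotrNl (dotr_bilC tsA) Xk dotr0l oppr0 meval0.
Qed.

Lemma kernel_tangent y : bilA k (kd y) = 0.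
Proof.
have := congr1 (dirv y) kernel_isotropic; rewrite dirv_bil dirv0 (bilC tsA (kd y)).
exact: addvv_eq0.
Qed.

Lemma kernel_d2 y z : bilA (kd y) (kd z) = - bilA k (kdd y z).
Proof.
have := congr1 (dirv z) (kernel_tangent y); rewrite dirv_bil dirv0 (bilC tsA (kd z)).
by move/eqP; rewrite addr_eq0 => /eqP.
Qed.

Lemma kernel_cyclic y z w : dotr (bilA (kd y) (kd z)) (constv w)
  + dotr (bilA (kd y) (kd w)) (constv z) + dotr (bilA (kd z) (kd w)) (constv y) = 0.
Proof.
apply: (@second_order_cyclic _ _ _ tsA X k _ _ _ (kdd y z)); [|exact: kernel_d1|exact: kernel_d2].
have := congr1 (dirv z) (kernel_d1 y); rewrite dirvN !dirv_bil dirv_gen dirv_const.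
by rewrite bil0r addr0.
Qed.

Lemma kernel_cubic y z w : dotr (bilA (kd y) (kd z)) (kd w) = 0.
Proof.
by rewrite kernel_d2 dotrNl (dotr_bilC tsA) kernel_tangent dotr0l oppr0.
Qed.

Lemma kernel_beta y z : dotr (bilA k (kdd y y)) (kdd y z) = 0.
Proof.
have h := congr1 (dird z) (kernel_cubic y y y); rewrite raddf0 dird_dotr dirv_bil in h.
have /eqP := isotropic_beta tsA h (kernel_d2 y y).
by rewrite -mpolyC_nat mulf_eq0 mpolyC_eq0 pnatr_eq0 => /eqP.
Qed.

Lemma pointwise_kernel_hyps x :
  [/\ bil t x (evalv x k) = 0,
      forall y, bil t x (y *m jacv k x) = - bil t (evalv x k) y &
      forall y, bil t (evalv x k) (y *m jacv k x) = 0].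
Proof.
split=> [|y|y].
- by have := congr1 (evalv x) Xk; rewrite evalv_bil evalv_gen => ->; apply/rowP => i; rewrite !mxE meval0.
- rewrite -evalv_dirv -[x in bil t x]evalv_gen -evalv_bil kernel_d1.
  by rewrite {1}/evalv raddfN /= -/(evalv _ _) evalv_bil evalv_const.
- by rewrite -evalv_dirv -evalv_bil kernel_tangent; apply/rowP => i; rewrite !mxE meval0.
Qed.

Hypothesis kgen : forall x, evalv x k != 0 -> \rank (bilmx t x) = 5.
Hypothesis keuler : forall x, (evalv x k <= jacv k x)%MS.
Hypothesis kn0 : k != 0.

Lemma polar_quadric_rank1 x : (\rank (bilmx t (evalv x k)) <= 1)%N.
Proof.
rewrite leqNgt; apply/negP => /mxrank_gt_minor2[i [j [p [q m0]]]].
pose N := bilmx (consttri t) k.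
pose mu := N i j * N p q - N i q * N p j.
have evN (z : 'rV[K]_6) a b : (N a b).@[z 0] = bilmx t (evalv z k) a b.
  rewrite !mxE raddf_sum; apply: eq_bigr => c _ /=.
  by rewrite mevalM mevalC mxE.
have muE (z : 'rV[K]_6) : mu.@[z 0] = bilmx t (evalv z k) i j * bilmx t (evalv z k) p q
   - bilmx t (evalv z k) i q * bilmx t (evalv z k) p j.
  by rewrite /mu mevalB !mevalM !evN.
have mun0 : mu != 0 by apply: contra m0 => /eqP mu0; rewrite -muE mu0 meval0.
have /rV0Pn[l kl] := kn0.
pose F := dotr (bilA X X) X.
have Fn0 : F != 0.
  apply/eqP => F0; case/eqP: kn0; apply/rowP => i'; apply/eqP; rewrite mxE.
  have cub z : dotr (bil t z z) z = 0.
    have := congr1 (meval (z 0)) F0.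
    by rewrite meval_dotr evalv_bil evalv_gen meval0.
  suff E (z : 'rV[K]_6) : z = 0.
    have := congr1 (fun u : 'rV_6 => u 0 i') (E (delta_mx 0 i')).
    by rewrite !mxE !eqxx => /eqP; rewrite oner_eq0.
  apply: cubic_apolar_const; apply: mpoly_zero => u.
  rewrite meval_dotr evalv_bil evalv_gen evalv_const.
  exact: cubic_polar0.
(* Where g is nonzero, H(k) has rank exactly 2, k is nonzero and the cubic does not vanish, so all
   the pointwise lemmas apply. *)
pose g := mu * k 0 l * F.
have gn0 : g != 0 by rewrite !mulf_neq0.
have good (z : 'rV[K]_6) : g.@[z 0] != 0 ->
    [/\ evalv z k != 0, \rank (bilmx t (evalv z k)) = 2 & dotr (bil t z z) z != 0].
  rewrite !mevalM !mulf_eq0 !negb_or => /andP[/andP[muz klz] Fz].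
  have kz : evalv z k != 0.
    by apply: contra klz => /eqP/rowP/(_ l); rewrite !mxE => ->.
  have [h1 h2 h3] := pointwise_kernel_hyps z.
  split=> //; last by move: Fz; rewrite meval_dotr evalv_bil evalv_gen.
  apply/eqP; rewrite eqn_leq (rank_polar_quadric (kgen kz) kz h1 (keuler z) h2 h3).
  by apply: (@minor2_rank_gt _ _ _ i j p q); rewrite -muE.
have two : (2 : K) != 0 by rewrite pnatr_eq0.
have three : (3 : K) != 0 by rewrite pnatr_eq0.
have b1 z y w : bil t (y *m jacv k z) (w *m jacv k z)
     = - bil t (evalv z k) (evalv z (kdd y w)).
  rewrite -!evalv_dirv -!evalv_bil kernel_d2.
  by rewrite {1}/evalv raddfN.
have b2 z y w v : dotr (bil t (y *m jacv k z) (w *m jacv k z)) v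
  + dotr (bil t (y *m jacv k z) (v *m jacv k z)) w
  + dotr (bil t (w *m jacv k z) (v *m jacv k z)) y = 0.
  have ev a b c : dotr (bil t (a *m jacv k z) (b *m jacv k z)) c
      = (dotr (bilA (kd a) (kd b)) (constv c)).@[z 0].
    by rewrite meval_dotr evalv_bil evalv_const !evalv_dirv.
  by rewrite !ev -!mevalD (kernel_cyclic y w v) meval0.
have b3 z y w : dotr (bil t (evalv z k) (evalv z (kdd y y))) (evalv z (kdd y w)) = 0.
  have := congr1 (meval (z 0)) (kernel_beta y w).
  by rewrite !meval_dotr !evalv_bil meval0.
have tang (z : 'rV[K]_6) y w : g.@[z 0] != 0 -> bil t (y *m jacv k z) (w *m jacv k z) = 0.
  move=> /good[kz rz _]; have [h1 h2 h3] := pointwise_kernel_hyps z.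
  exact: (tangent_product ts (kgen kz) kz h1 (keuler z) h2 h3 rz three two (b1 z) (b2 z) (b3 z)).
have mem (z : 'rV[K]_6) w : g.@[z 0] != 0 -> bil t (evalv z k) w = 0 ->
    (forall y, bil t (y *m jacv k z) w = 0) -> exists y, w = y *m jacv k z.
  move=> gz; have [kz rz Fz] := good z gz; have [h1 h2 h3] := pointwise_kernel_hyps z.
  exact: (mem_tangent ts (kgen kz) kz h1 (keuler z) h2 h3 rz three two (b1 z) (b2 z) (b3 z) Fz).
have E y w : bilA (kd y) (kd w) = 0.
  apply: (evalv_ext_generic gn0) => z gz.
  by rewrite evalv_bil !evalv_dirv tang.
have Ek y w : bilA k (kdd y w) = 0.
  by apply/eqP; rewrite -oppr_eq0 -kernel_d2 E.
have skew a b c : bilA (kd a) (kdd b c) = - bilA (kd b) (kdd a c).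
  have := congr1 (dirv c) (E a b); rewrite dirv_bil dirv0 (bilC tsA _ (kd b)).
  by rewrite addrC => /eqP; rewrite addr_eq0 => /eqP.
(* Skew in a, b and symmetric in b, c: such an expression vanishes, as in the uniqueness of the
   Levi-Civita connection. *)
have Et a b c : bilA (kd a) (kdd b c) = 0.
  have h : bilA (kd a) (kdd b c) = - bilA (kd a) (kdd b c).
    have C u v : kdd u v = kdd v u by rewrite dirv_comm.
    by rewrite [LHS](skew a b c) (C a c) (skew b c a) opprK (C b a) (skew c a b) (C c b).
  by apply: addvv_eq0; rewrite {1}h addNr.
(* At generic points P forces w into the image of J. It is stable under differentiation because the
   second derivatives of k also lie there and P makes w conjugate to that image. *)
pose P (w : 'rV[A]_6) := bilA k w = 0 /\ forall y, bilA (kd y) w = 0.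
have evP z w : P w -> bil t (evalv z k) (evalv z w) = 0 /\
    forall y, bil t (y *m jacv k z) (evalv z w) = 0.
  have ev0 : evalv z 0 = 0 by apply/rowP => i'; rewrite !mxE meval0.
  by case=> P1 P2; split=> [|y]; rewrite -?evalv_dirv -evalv_bil ?P1 ?P2.
have Pd y w : P w -> P (dirv y w).
  move=> Pw; have [P1 P2] := Pw; split=> [|a].
    have := congr1 (dirv y) P1; rewrite dirv_bil dirv0 P2 add0r //.
  have := congr1 (dirv y) (P2 a); rewrite dirv_bil dirv0.
  suff -> : bilA (kdd a y) w = 0 by rewrite add0r.
  apply: (evalv_ext_generic gn0) => z gz; rewrite evalv_bil.
  have [|b|u ->] := mem z (evalv z (kdd a y)) gz.
  - by rewrite -evalv_bil Ek; apply/rowP => i'; rewrite !mxE meval0.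
  - by rewrite -evalv_dirv -evalv_bil Et; apply/rowP => i'; rewrite !mxE meval0.
  by have [_ ->] := evP z w Pw.
have Pk : P k.
  by split=> [|y]; [exact: kernel_isotropic|rewrite (bilC tsA (kd y) k) kernel_tangent].
have [c cn0 Pc] := dirv_top kn0 Pk Pd.
case/eqP: cn0; apply: cubic_apolar_const.
apply: (mpoly_zero_generic gn0) => z gz.
rewrite meval_dotr evalv_bil evalv_gen evalv_const.
have [P1 P2] := evP z _ Pc; rewrite evalv_const in P1 P2.
(* With c = uJ, the value T(z, z, uJ) is - T(k, u, z), which vanishes since T(z, k, -) = 0. *)
have [u ->] := mem z c gz P1 P2.
have [h1 h2 h3] := pointwise_kernel_hyps z.
rewrite (dotr_bilC ts) h2 dotrNl (dotr_bilC ts) (bilC ts _ z) h1 dotr0l oppr0 //.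
Qed.

(** If k always pointed along one vector u, so would all its derivatives. Then rk J <= 1, hence H(u)
    = 0, contradicting the independence of the partial derivatives. *)
Lemma kernel_direction_varies x1 : evalv x1 k != 0 ->
  exists x2, ~~ (evalv x2 k <= evalv x1 k)%MS.
Proof.
move=> kx1; apply: contrapT => h.
have prop x : (evalv x k <= evalv x1 k)%MS.
  by apply/negPn/negP => hx; apply: h; exists x.
set u := evalv x1 k in kx1 prop.
have /rV0Pn[i ui] := kx1.
have E j : (u 0 i) *: k 0 j = (u 0 j) *: k 0 i.
  apply/subr0_eq/mpoly_zero => x; rewrite mevalB !mevalZ.
  have /sub_rVP[c cE] := prop x.
  have {}cE l : (k 0 l).@[x 0] = c * u 0 l.
    by have /rowP/(_ l) := cE; rewrite [LHS]mxE [RHS]mxE.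
  by rewrite !cE; ring.
have [h1 h2 h3] := pointwise_kernel_hyps x1.
have := rank_Jacobian (kgen kx1) kx1 h1 (keuler x1) h2.
have Ju : (jacv k x1 <= u)%MS.
  apply/row_subP => a; apply/sub_rVP; exists ((u 0 i)^-1 * jacv k x1 a i).
  apply/rowP => j; rewrite [LHS]mxE [RHS]mxE; apply: (mulfI ui).
  rewrite -mulrA mulVKf // [jacv k x1 a j]mxE [jacv k x1 a i]mxE [RHS]mulrC.
  by rewrite -!mevalZ -!mderivZ E.
have S0 : bilmx t u != 0.
  apply: contra kx1 => /eqP S0; apply/eqP/nondeg => v.
  by rewrite (bilC ts) // -[bil _ _ _](bilC ts) -mul_bilmx S0 mulmx0.
have := mxrankS Ju; rewrite rank_rV kx1 => le1 Er.
by move: le1; rewrite Er ltnS leqn0 mxrank_eq0 (negPf S0).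
Qed.

End CorankOne.

Lemma row_free_col_mx (K : fieldType) m n (M : 'M[K]_(m, n)) (b : 'rV_n) :
  row_free M -> ~~ (b <= M)%MS -> row_free (col_mx M b).
Proof.
move=> /eqP rM bM; rewrite /row_free -addsmxE eqn_leq addsmxE rank_leq_row -addsmxE /=.
rewrite addn1 -{1}rM ltn_neqAle mxrankS ?addsmxSl // andbT.
by rewrite (mxrank_leqif_sup (addsmxSl _ _)) addsmx_sub submx_refl.
Qed.

Lemma row_free_rV (K : fieldType) n (b : 'rV[K]_n) : b != 0 -> row_free b.
Proof. by move=> b0; rewrite /row_free rank_rV b0. Qed.

Lemma dual_vectors (K : fieldType) m n (L : 'M[K]_(m, n)) : row_free L ->
  exists y : 'I_m -> 'rV[K]_n, forall i j, dotr (row i L) (y j) = (i == j)%:R.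
Proof.
case/row_freeP => Y LY; exists (fun j => (col j Y)^T) => i j.
rewrite dotrE trmxK; have := congr1 (fun M : 'M_m => M i j) LY.
rewrite [X in _ = X]mxE => <-; rewrite !mxE; apply: eq_bigr => l _.
by rewrite !mxE.
Qed.

(** The scalar c avoids a square root. A nonzero diagonal entry supplies l as a row; if the diagonal
    is zero, the minors give M_ab^2 = 0. *)
Lemma symmetric_rank1 (K : numFieldType) n (M : 'M[K]_n) :
    M^T = M -> (\rank M <= 1)%N ->
  exists c (l : 'rV_n), M = c *: (l^T *m l).
Proof.
move=> MT rM; have minor i j k l : M i j * M k l = M i l * M k j.
  apply/eqP; rewrite -subr_eq0; apply: contraTT rM => h.
  by rewrite -ltnNge (minor2_rank_gt h).
have sym i j : M i j = M j i by rewrite -{1}MT mxE.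
have [[i Mii]|diag] := pselect (exists i, M i i != 0).
  exists (M i i)^-1, (row i M); apply/matrixP => a b.
  rewrite !mxE big_ord1 !mxE; apply: (mulfI Mii); rewrite mulVKf //.
  by rewrite (minor i i a b) (sym a i) mulrC.
exists 0, 0; rewrite scale0r; apply/matrixP => a b; rewrite [RHS]mxE.
apply/eqP; have [//|ab] := eqVneq (M a b) 0; case: diag; exists a.
apply: contra ab => /eqP aa; have := minor a a b b.
by rewrite aa mul0r (sym b a) => /esym/eqP; rewrite mulf_eq0 orbb.
Qed.

Lemma square_form_scale (K : fieldType) n (d : K) (l : 'rV[K]_n) :
  (d *: l)^T *m (d *: l) = d ^+ 2 *: (l^T *m l).
Proof.
have -> : (d *: l)^T = d *: l^T by apply/matrixP => i j; rewrite !mxE.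
by rewrite -scalemxAl -scalemxAr scalerA.
Qed.

(** * From rank-one polar quadrics to a basis adapted to the cubic *)

Section RankOnePolars.
Context (K : numFieldType) (t : 'I_6 -> 'I_6 -> 'I_6 -> K) (ts : symt t).
Local Notation A := {mpoly K[6]}.
Hypothesis nondeg : forall u, (forall v, bil t u v = 0) -> u = 0.
Context (k : 'rV[A]_6).
Hypothesis iso : forall x, bil t (evalv x k) (evalv x k) = 0.
Hypothesis rank1 : forall x, (\rank (bilmx t (evalv x k)) <= 1)%N.

Local Notation H := (bilmx t).
Let I s := exists x, s = evalv x k.

Lemma bilmx_inj u v c : H u = c *: H v -> u = c *: v.
Proof.
move=> E; apply/subr0_eq/nondeg => w; rewrite (bilDl ts) (bilNl ts) (bilZl ts).
by rewrite -!mul_bilmx E scalemxAr subrr.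
Qed.

Lemma polar_rank1 s : I s -> exists c (l : 'rV[K]_6), H s = c *: (l^T *m l).
Proof. by case=> x ->; apply: symmetric_rank1 (rank1 x); rewrite tr_bilmx. Qed.

Lemma bil_rank1 s c (l : 'rV[K]_6) v : H s = c *: (l^T *m l) -> bil t s v = (c * dotr v l) *: l.
Proof.
move=> E; rewrite -mul_bilmx E -scalemxAr mulmxA -scalerA; congr (_ *: _).
by rewrite -mul_scalar_mx dotrE -mx11_scalar.
Qed.

Lemma tri_rank1 s c (l : 'rV[K]_6) v w : H s = c *: (l^T *m l) ->
  dotr (bil t s v) w = c * dotr v l * dotr w l.
Proof. by move=> E; rewrite (bil_rank1 _ E) dotrZl (dotrC l). Qed.

(** T(s, s', -) is a multiple of both l and l'. If nonzero, it makes l and l' proportional, hence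
    also s and s', and then [iso] gives zero. *)
Lemma polar_isotropic s s' : I s -> I s' -> bil t s s' = 0.
Proof.
move=> Is Is'; have [c [l E]] := polar_rank1 Is; have [c' [l' E']] := polar_rank1 Is'.
have e1 := bil_rank1 s' E; have e2 := bil_rank1 s E'.
apply/eqP/negPn/negP => n0; have := n0; have := n0.
rewrite {1}e1 scaler_eq0 mulf_eq0 !negb_or => /andP[/andP[cn0 s'l] ln0].
rewrite (bilC ts) {1}e2 scaler_eq0 mulf_eq0 !negb_or => /andP[/andP[c'n0 sl'] l'n0].
have E2 : l' = ((c' * dotr s l')^-1 * (c * dotr s' l)) *: l.
  by rewrite -scalerA -e1 (bilC ts) e2 scalerA mulVf ?scale1r // mulf_neq0.
move: E2; set d := _ * _ => E2.
have s's : s' = (c' * d ^+ 2 / c) *: s.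
  apply: bilmx_inj; rewrite E' E E2 square_form_scale !scalerA.
  by congr (_ *: _); rewrite mulfVK.
case/eqP: n0; rewrite s's bilZr; case: Is => x ->; by rewrite iso scaler0.
Qed.

(* A quadratic form of rank one takes at (y1,y2) the geometric mean of its
   values at y1 and y2, so one of two polynomial functions vanishes. *)
Lemma polar_separated s1 s2 y1 y2 : I s1 -> I s2 ->
    (forall s, I s -> dotr (bil t s y1) y2 = 0) ->
    dotr (bil t s1 y1) y1 != 0 -> dotr (bil t s2 y2) y2 != 0 -> False.
Proof.
case=> x1 -> [x2 ->] sep n1 n2.
pose p y := dotr (bil (consttri t) k (constv y)) (constv y).
have ev y (x : 'rV[K]_6) : (p y).@[x 0] = dotr (bil t (evalv x k) y) y.
  by rewrite meval_dotr evalv_bil !evalv_const.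
have : p y1 * p y2 = 0.
  apply: mpoly_zero => x; rewrite mevalM !ev.
  have Ix : I (evalv x k) by exists x.
  have [c [l E]] := polar_rank1 Ix; have := sep _ Ix.
  rewrite !(tri_rank1 _ _ E) => z.
  transitivity (c * dotr y1 l * dotr y2 l * (c * dotr y1 l * dotr y2 l)); first by ring.
  by rewrite z mulr0.
move/eqP; rewrite mulf_eq0 => /orP[] /eqP p0.
  by case/eqP: n1; rewrite -ev p0 meval0.
by case/eqP: n2; rewrite -ev p0 meval0.
Qed.

Lemma perazzo_basis x1 x2 : evalv x1 k != 0 -> ~~ (evalv x2 k <= evalv x1 k)%MS ->
  exists2 E : 'M[K]_6, E \in unitmx & forall v w : 'rV[K]_6,
  [/\ dotr (bil t (row (inord 0) E) (v *m E)) (w *m E)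
        = 2 * (v 0 (inord 4) * w 0 (inord 4)),
      dotr (bil t (row (inord 1) E) (v *m E)) (w *m E)
        = v 0 (inord 4) * w 0 (inord 5) + v 0 (inord 5) * w 0 (inord 4) &
      dotr (bil t (row (inord 2) E) (v *m E)) (w *m E)
        = 2 * (v 0 (inord 5) * w 0 (inord 5))].
Proof.
set s1 := evalv x1 k; set s2 := evalv x2 k => s1n0 s21.
have I1 : I s1 by exists x1.
have I2 : I s2 by exists x2.
have [c1 [l1 E1]] := polar_rank1 I1; have [c2 [l2 E2]] := polar_rank1 I2.
have Hn0 s c (l : 'rV[K]_6) : s != 0 -> H s = c *: (l^T *m l) -> c != 0 /\ l != 0.
  move=> sn0 E; split; apply: contra sn0 => /eqP z.
    have : H s = 0 *: H s by rewrite E z !scale0r.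
    by move/bilmx_inj; rewrite scale0r => ->.
  have : H s = 0 *: H s by rewrite E z mulmx0 !scaler0.
  by move/bilmx_inj; rewrite scale0r => ->.
have s2n0 : s2 != 0 by apply: contra s21 => /eqP ->; rewrite sub0mx.
have [c1n0 l1n0] := Hn0 _ _ _ s1n0 E1; have [c2n0 l2n0] := Hn0 _ _ _ s2n0 E2.
have l21 : ~~ (l2 <= l1)%MS.
  apply: contra s21 => /sub_rVP[d l2E]; apply/sub_rVP; exists (c2 * d ^+ 2 / c1).
  apply: bilmx_inj; rewrite E2 E1 l2E square_form_scale !scalerA.
  by congr (_ *: _); rewrite mulfVK.
have L2 : row_free (col_mx l1 l2) by apply: row_free_col_mx => //; exact: row_free_rV.
have [y yE] := dual_vectors L2.
have y11 : dotr l1 (y (lshift 1 0)) = 1.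
  by have := yE (lshift 1 0) (lshift 1 0); rewrite rowKu row_id eqxx.
have y12 : dotr l1 (y (rshift 1 0)) = 0.
  by have := yE (lshift 1 0) (rshift 1 0); rewrite rowKu row_id.
have y21 : dotr l2 (y (lshift 1 0)) = 0.
  by have := yE (rshift 1 0) (lshift 1 0); rewrite rowKd row_id.
have y22 : dotr l2 (y (rshift 1 0)) = 1.
  by have := yE (rshift 1 0) (rshift 1 0); rewrite rowKd row_id eqxx.
move: (y (lshift 1 0)) (y (rshift 1 0)) y11 y12 y21 y22 => {yE}{y}y1 y2 y11 y12 y21 y22.
have S2 : row_free (col_mx s1 s2) by apply: row_free_col_mx => //; exact: row_free_rV.
(* Otherwise every polar quadric would be a combination of l1^2 and l2^2, for which y1 and y2 are
   conjugate, against [polar_separated]. *)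
have [x3 s3n] : exists x3, ~~ (evalv x3 k <= col_mx s1 s2)%MS.
  apply: contrapT => h.
  apply: (polar_separated (y1 := y1) (y2 := y2) I1 I2) => [s [x ->]||].
  - have : (evalv x k <= col_mx s1 s2)%MS by apply/negPn/negP => hx; apply: h; exists x.
    rewrite -addsmxE => /sub_addsmxP[[a b] ->] /=.
    rewrite [a]mx11_scalar [b]mx11_scalar !mul_scalar_mx (bilDl ts) !(bilZl ts) dotrDl !dotrZl.
    rewrite (tri_rank1 _ _ E1) (tri_rank1 _ _ E2) !(dotrC _ l1) !(dotrC _ l2) y12 y21.
    by rewrite !(mulr0, mul0r) addr0.
  - by rewrite (tri_rank1 _ _ E1) dotrC y11 !mulr1.
  - by rewrite (tri_rank1 _ _ E2) dotrC y22 !mulr1.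
set s3 := evalv x3 k in s3n.
have I3 : I s3 by exists x3.
have [c3 [l3 E3]] := polar_rank1 I3.
have s3n0 : s3 != 0 by apply: contra s3n => /eqP ->; rewrite sub0mx.
have [c3n0 l3n0] := Hn0 _ _ _ s3n0 E3.
have orth s s' c (l : 'rV[K]_6) : I s -> I s' -> s' != 0 -> H s' = c *: (l^T *m l) -> dotr s l = 0.
  move=> Is Is' s'n0 E; have [cn0 ln0] := Hn0 _ _ _ s'n0 E.
  have := polar_isotropic Is' Is; rewrite (bil_rank1 _ E) => /eqP.
  by rewrite scaler_eq0 mulf_eq0 (negPf cn0) (negPf ln0) orbF => /eqP.
(* If l1, l2, l3 were independent, all values of k would lie in their common zeros, which by
   dimension are <s1, s2, s3>. All polar quadrics would be combinations of three squares, and z1, z2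
   from the dual basis would again be conjugate for all of them. *)
have : (l3 <= col_mx l1 l2)%MS.
  apply/negPn/negP => l3n; have L3 := row_free_col_mx L2 l3n.
  have [z zE] := dual_vectors L3; have S3 := row_free_col_mx S2 s3n.
  set L := col_mx (col_mx l1 l2) l3 in L3 zE; set S := col_mx (col_mx s1 s2) s3 in S3.
  have r1 : row (lshift 1 (lshift 1 0)) L = l1 by rewrite rowKu rowKu row_id.
  have r2 : row (lshift 1 (rshift 1 0)) L = l2 by rewrite rowKu rowKd row_id.
  have r3 : row (rshift 2 0) L = l3 by rewrite rowKd row_id.
  pose z1 := z (lshift 1 (lshift 1 0)); pose z2 := z (lshift 1 (rshift 1 0)).
  have z11 : dotr l1 z1 = 1 by rewrite -r1 zE eqxx.
  have z12 : dotr l1 z2 = 0 by rewrite -r1 zE.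
  have z21 : dotr l2 z1 = 0 by rewrite -r2 zE.
  have z22 : dotr l2 z2 = 1 by rewrite -r2 zE eqxx.
  have z31 : dotr l3 z1 = 0 by rewrite -r3 zE.
  have inK s : I s -> (s <= kermx L^T)%MS.
    move=> Is; apply/sub_kermxP; rewrite /L !tr_col_mx !mul_mx_row.
    have h (l : 'rV[K]_6) c s' : I s' -> s' != 0 -> H s' = c *: (l^T *m l) -> s *m l^T = 0.
      move=> Is' s'n0 E; apply/matrixP => i j; rewrite !ord1 -dotrE.
      by rewrite (orth _ _ _ _ Is Is' s'n0 E) mxE.
    by rewrite (h _ _ _ I1 s1n0 E1) (h _ _ _ I2 s2n0 E2) (h _ _ _ I3 s3n0 E3) !row_mx0.
  have SK : (S <= kermx L^T)%MS by rewrite !col_mx_sub !inK.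
  have KS : (kermx L^T <= S)%MS.
    rewrite -(mxrank_leqif_sup SK) mxrank_ker mxrank_tr (eqP L3) (eqP S3) //.
  apply: (polar_separated (y1 := z1) (y2 := z2) I1 I2) => [s Is||].
  - have := submx_trans (inK s Is) KS; rewrite -addsmxE => /sub_addsmxP[[ab c] ->] /=.
    have /sub_addsmxP[[a b] ->] /= : (ab *m col_mx s1 s2 <= s1 + s2)%MS.
      by rewrite addsmxE submxMl.
    rewrite [a]mx11_scalar [b]mx11_scalar [c]mx11_scalar !mul_scalar_mx.
    rewrite !(bilDl ts) !(bilZl ts) !dotrDl !dotrZl.
    rewrite (tri_rank1 _ _ E1) (tri_rank1 _ _ E2) (tri_rank1 _ _ E3).
    rewrite !(dotrC _ l1) !(dotrC _ l2) !(dotrC _ l3) z12 z21 z31.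
    by rewrite !(mulr0, mul0r) !addr0.
  - by rewrite (tri_rank1 _ _ E1) dotrC z11 !mulr1.
  - by rewrite (tri_rank1 _ _ E2) dotrC z22 !mulr1.
rewrite -addsmxE => /sub_addsmxP[[al be]] /=.
rewrite [al]mx11_scalar [be]mx11_scalar !mul_scalar_mx.
move: (al 0 0) (be 0 0) => {al be} al be l3E.
have s3n1 : ~~ (s3 <= s1)%MS.
  by apply: contra s3n => h; rewrite -addsmxE (submx_trans h) ?addsmxSl.
have s3n2 : ~~ (s3 <= s2)%MS.
  by apply: contra s3n => h; rewrite -addsmxE (submx_trans h) ?addsmxSr.
have ben0 : be != 0.
  apply: contra s3n1 => /eqP be0; apply/sub_rVP; exists (c3 * al ^+ 2 / c1).
  apply: bilmx_inj; rewrite E3 E1 l3E be0 scale0r addr0 square_form_scale !scalerA.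
  by congr (_ *: _); rewrite mulfVK.
have aln0 : al != 0.
  apply: contra s3n2 => /eqP al0; apply/sub_rVP; exists (c3 * be ^+ 2 / c2).
  apply: bilmx_inj; rewrite E3 E2 l3E al0 scale0r add0r square_form_scale !scalerA.
  by congr (_ *: _); rewrite mulfVK.
(* The polar forms of u0, u1, u2 are to be the polarisations of l1^2, l1 l2, l2^2. In u1 the two
   squares are removed from l3^2 = (al l1 + be l2)^2. *)
pose u0 := (2 / c1) *: s1; pose u2 := (2 / c2) *: s2.
pose u1 := (al * be)^-1 *: (c3^-1 *: s3 - (al ^+ 2 / c1) *: s1 - (be ^+ 2 / c2) *: s2).
have T0 v w : dotr (bil t u0 v) w = 2 * (dotr v l1 * dotr w l1).
  rewrite (bilZl ts) dotrZl (tri_rank1 _ _ E1) !mulrA mulfVK //.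
have T2 v w : dotr (bil t u2 v) w = 2 * (dotr v l2 * dotr w l2).
  rewrite (bilZl ts) dotrZl (tri_rank1 _ _ E2) !mulrA mulfVK //.
have T1 v w : dotr (bil t u1 v) w = dotr v l1 * dotr w l2 + dotr v l2 * dotr w l1.
  rewrite (bilZl ts) !(bilDl ts) !(bilNl ts) !(bilZl ts) dotrZl !dotrDl !dotrNl !dotrZl.
  rewrite (tri_rank1 _ _ E1) (tri_rank1 _ _ E2) (tri_rank1 _ _ E3).
  rewrite l3E !dotrDr !dotrZr; field.
  by rewrite c1n0 c2n0 c3n0 aln0 ben0.
have lu c (l : 'rV[K]_6) s : I s -> s != 0 -> H s = c *: (l^T *m l) ->
    [/\ dotr u0 l = 0, dotr u1 l = 0 & dotr u2 l = 0].
  move=> Is sn0 E; have o1 := orth _ _ _ _ I1 Is sn0 E.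
  have o2 := orth _ _ _ _ I2 Is sn0 E; have o3 := orth _ _ _ _ I3 Is sn0 E.
  by split; rewrite !(dotrZl, dotrDl, dotrNl) ?o1 ?o2 ?o3 !(mulr0, oppr0, addr0).
have [u0l1 u1l1 u2l1] := lu _ _ _ I1 s1n0 E1.
have [u0l2 u1l2 u2l2] := lu _ _ _ I2 s2n0 E2.
clearbody u0 u1 u2.
pose U := col_mx (col_mx u0 u1) u2.
(* The common zeros of l1 and l2 have dimension 4, one more than the span of the u's can have; e3
   fills the gap, and y1, y2 complete the basis. *)
have [e3 e3K e3U] : exists2 e3 : 'rV_6, (e3 <= kermx (col_mx l1 l2)^T)%MS & ~~ (e3 <= U)%MS.
  have : ~~ (kermx (col_mx l1 l2)^T <= U)%MS.
    apply/negP => /mxrankS; rewrite mxrank_ker mxrank_tr (eqP L2) => h.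
    by have := leq_trans h (rank_leq_row U).
  by case/row_subPn => i ri; exists (row i (kermx (col_mx l1 l2)^T)) => //; exact: row_sub.
have [e3l1 e3l2] : dotr e3 l1 = 0 /\ dotr e3 l2 = 0.
  move/sub_kermxP: e3K; rewrite tr_col_mx mul_mx_row => h.
  by have := h; rewrite -[RHS]row_mx0 => /eq_row_mx[h1 h2]; rewrite !dotrE h1 h2 !mxE.
pose e (i : 'I_6) := nth 0 [:: u0; u1; u2; e3; y1; y2] i.
pose E : 'M[K]_6 := \matrix_i e i.
have rowE0 : row (inord 0) E = u0 by rewrite rowK /e inordK.
have rowE1 : row (inord 1) E = u1 by rewrite rowK /e inordK.
have rowE2 : row (inord 2) E = u2 by rewrite rowK /e inordK.
have vE v : v *m E = v 0 (inord 0) *: u0 + v 0 (inord 1) *: u1 + v 0 (inord 2) *: u2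
    + v 0 (inord 3) *: e3 + v 0 (inord 4) *: y1 + v 0 (inord 5) *: y2.
  rewrite mulmx_sum_row !big_ord_recl big_ord0 addr0 !rowK /e /= !addrA.
  do ![congr (_ + _)]; congr (v 0 _ *: _); apply: val_inj; by rewrite /= inordK.
have vl1 v : dotr (v *m E) l1 = v 0 (inord 4).
  rewrite vE !dotrDl !dotrZl u0l1 u1l1 u2l1 e3l1 !(dotrC _ l1) y11 y12.
  by rewrite !(mulr0, mulr1, add0r, addr0).
have vl2 v : dotr (v *m E) l2 = v 0 (inord 5).
  rewrite vE !dotrDl !dotrZl u0l2 u1l2 u2l2 e3l2 !(dotrC _ l2) y21 y22.
  by rewrite !(mulr0, mulr1, add0r, addr0).
exists E; last by move=> v w; rewrite rowE0 rowE1 rowE2 T0 T1 T2 !vl1 !vl2.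
rewrite -row_free_unit -kermx_eq0; apply/rowV0P => v /sub_kermxP vE0.
have v4 : v 0 (inord 4) = 0 by rewrite -vl1 vE0 dotr0l.
have v5 : v 0 (inord 5) = 0 by rewrite -vl2 vE0 dotr0l.
move: vE0; rewrite vE v4 v5 !scale0r !addr0 => vE0.
have v3 : v 0 (inord 3) = 0.
  apply/eqP/negPn/negP => v3; case/negP: e3U.
  have -> : e3 = (v 0 (inord 3))^-1 *: - (v 0 (inord 0) *: u0 + v 0 (inord 1) *: u1 + v 0 (inord 2) *: u2).
    move/eqP: vE0; rewrite addrC addr_eq0 => /eqP <-.
    by rewrite scalerA mulVf // scale1r.
  rewrite scalemx_sub // eqmx_opp -!addsmxE !addmx_sub ?scalemx_sub //.
  - by apply: submx_trans (addsmxSl _ _); rewrite -addsmxE addsmxSl.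
  - by apply: submx_trans (addsmxSl _ _); rewrite -addsmxE addsmxSr.
  - exact: addsmxSr.
move: vE0; rewrite v3 scale0r addr0 => vE0.
have Tv a b : v 0 (inord 0) * (2 * (dotr a l1 * dotr b l1))
   + v 0 (inord 1) * (dotr a l1 * dotr b l2 + dotr a l2 * dotr b l1)
   + v 0 (inord 2) * (2 * (dotr a l2 * dotr b l2)) = 0.
  rewrite -T0 -T1 -T2 -!dotrZl -!dotrDl -!(bilZl ts) -!(bilDl ts) vE0 (bil0l ts) dotr0l //.
have v0 : v 0 (inord 0) = 0.
  have := Tv y1 y1; rewrite !(dotrC _ l1) !(dotrC _ l2) y11 y21.
  by rewrite !(mulr0, mulr1, add0r, addr0) => /eqP; rewrite mulf_eq0 pnatr_eq0 orbF => /eqP.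
have v1 : v 0 (inord 1) = 0.
  have := Tv y1 y2; rewrite !(dotrC _ l1) !(dotrC _ l2) y11 y21 y12 y22.
  by rewrite !(mulr0, mulr1, mul0r, add0r, addr0).
have v2 : v 0 (inord 2) = 0.
  have := Tv y2 y2; rewrite !(dotrC _ l1) !(dotrC _ l2) y12 y22.
  by rewrite !(mulr0, mulr1, add0r, addr0) => /eqP; rewrite mulf_eq0 pnatr_eq0 orbF => /eqP.
apply/rowP => i; rewrite mxE -(inord_val i).
by case: i => -[|[|[|[|[|[|]]]]]] //= _.
Qed.

End RankOnePolars.

(** * Normal form of a cubic whose Hessian matrix has generic rank 5 *)

Section NormalForm.
Context (K : numFieldType) (t : 'I_6 -> 'I_6 -> 'I_6 -> K) (ts : symt t).
Local Notation A := {mpoly K[6]}.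
Hypothesis nondeg : forall u, (forall v, bil t u v = 0) -> u = 0.
Hypothesis sing : forall x, \det (bilmx t x) = 0.
Local Notation M := (bilmx (consttri t) (@genv K 6)).

Lemma evalv_bilmx_gen (x : 'rV[K]_6) : map_mx (meval (x 0)) M = bilmx t x.
Proof.
apply/matrixP => b c; rewrite !mxE raddf_sum; apply: eq_bigr => a _ /=.
by rewrite mevalM mevalC mxE mevalXU.
Qed.

Lemma normal_form_corank1 x0 : \rank (bilmx t x0) = 5 ->
  exists2 E : 'M[K]_6, E \in unitmx & forall v w : 'rV[K]_6,
  [/\ dotr (bil t (row (inord 0) E) (v *m E)) (w *m E)
        = 2 * (v 0 (inord 4) * w 0 (inord 4)),
      dotr (bil t (row (inord 1) E) (v *m E)) (w *m E)
        = v 0 (inord 4) * w 0 (inord 5) + v 0 (inord 5) * w 0 (inord 4) &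
      dotr (bil t (row (inord 2) E) (v *m E)) (w *m E)
        = 2 * (v 0 (inord 5) * w 0 (inord 5))].
Proof.
move=> rx0.
have detM : \det M = 0.
  by apply: mpoly_zero => x; rewrite -det_map_mx evalv_bilmx_gen sing.
have evadj x i : evalv x (row i (\adj M)) = row i (\adj (bilmx t x)).
  by rewrite /evalv map_row map_mx_adj evalv_bilmx_gen.
have [i ki] : exists i, row i (\adj (bilmx t x0)) != 0.
  apply: contrapT => h; have := @adj_corank1 _ _ (bilmx t x0) rx0 isT.
  case/eqP; apply/row_matrixP => i; rewrite row0.
  by apply/eqP/negPn/negP => hh; apply: h; exists i.
pose k := row i (\adj M).
have kn0 : k != 0.
  apply: contra ki => /eqP k0; rewrite -evadj -/k k0.
  by apply/eqP/rowP => j; rewrite !mxE meval0.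
have Xk : bil (consttri t) (@genv K 6) k = 0.
  by rewrite -mul_bilmx -row_mul mul_adj_mx detM raddf0 row0.
have kgen x : evalv x k != 0 -> \rank (bilmx t x) = 5.
  move=> kx; apply/eqP; rewrite eqn_leq; apply/andP; split.
    rewrite -ltnS ltn_neqAle rank_leq_row andbT; apply/negP => r6.
    have : bilmx t x \in unitmx by rewrite -row_free_unit.
    by rewrite unitmxE sing unitr0.
  apply: (@adj_neq0_rank _ 6 (bilmx t x)); apply: contra kx => /eqP adj0.
  by rewrite evadj adj0 row0.
have khom j : k 0 j \is 5.-homog.
  rewrite !mxE /cofactor -signr_odd; case: odd; rewrite ?expr0 ?mul1r ?expr1 ?mulN1r ?dhomogN;
  apply: dhomog_det => a b; rewrite !mxE; apply: rpred_sum => c _;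
  rewrite mxE mul_mpolyC; apply: dhomogZ; by rewrite dhomogX /= mdeg1.
clearbody k.
have keuler x : (evalv x k <= jacv k x)%MS.
  (* The entries of k are cofactors of size 5, so Euler's identity makes 5 k(x) the derivative of k
     in the direction x. *)
  apply/submxP; exists (5^-1 *: x); rewrite -evalv_dirv; apply/rowP => j.
  have := congr1 (meval (x 0)) (dhomog_euler (khom j)).
  rewrite mevalZ raddf_sum /= => h.
  have -> : evalv x k 0 j = (k 0 j).@[x 0] by rewrite [LHS]mxE.
  have -> : evalv x (dirv (5^-1 *: x) k) 0 j = (dird (5^-1 *: x) (k 0 j)).@[x 0].
    by rewrite [LHS]mxE [dirv _ _ _ _]mxE.
  apply: (@mulfI _ 5); first by rewrite pnatr_eq0.
  rewrite -h meval_dird mulr_sumr; apply: eq_bigr => a _.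
  by rewrite mevalM mevalXU mxE !mulrA mulfV ?pnatr_eq0 // mul1r.
have iso x : bil t (evalv x k) (evalv x k) = 0.
  by rewrite -evalv_bil (kernel_isotropic ts Xk); apply/rowP => j; rewrite !mxE meval0.
have rk1 := polar_quadric_rank1 ts nondeg Xk kgen keuler kn0.
have [x1 kx1] := evalv_neq0 kn0.
have [x2 kx2] := kernel_direction_varies ts nondeg Xk kgen keuler kx1.
exact: (perazzo_basis ts nondeg iso rk1 kx1 kx2).
Qed.

End NormalForm.

(** * Perturbing by cubes of linear forms *)

Section Perturbation.
Context (K : numFieldType).
Implicit Types (f g : dhomog 6 K 3) (l : 'rV[K]_6) (s : K).

Definition perazzo_std (y : 'rV[K]_6) : K :=
  y 0 (inord 0) * y 0 (inord 4) ^+ 2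
  + y 0 (inord 1) * y 0 (inord 4) * y 0 (inord 5)
  + y 0 (inord 2) * y 0 (inord 5) ^+ 2 + y 0 (inord 3) ^+ 3.

(** Stated for forms rather than for points of projective space, so that the members of a pencil
    need not be shown nonzero. *)
Definition in_closure f := forall d (F : {mpoly K[_]}), F \is d.-homog ->
  vanishes_on F [set coords (form_of g) | g in minimal_family K]%classic -> F.@[coords f 0] = 0.

(** The roots of q are the finitely many excluded members of the pencil. A form vanishing at all the
    others vanishes on the whole line, in particular at s = 0. *)
Lemma in_closure_line f g (q : {poly K}) : q != 0 ->
  (forall s, q.[s] != 0 -> in_closure (f + s *: g)) -> in_closure f.
Proof.
move=> qn0 H d F hF van.
pose h i : {poly K} := (coords f 0 i)%:P + coords g 0 i *: 'X.
have hs s : F.@[coords (f + s *: g) 0] = F.@[fun i => (h i).[s]].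
  apply: meval_eq => i; rewrite /h hornerD hornerC hornerZ hornerX !mxE.
  by rewrite linearD linearZ /= mulrC.
have : q * restr_curve h F = 0.
  apply: poly_zeros => s _; rewrite hornerM horner_restr_curve -hs.
  by have [->|qs] := eqVneq q.[s] 0; rewrite ?mul0r // (H s qs d F) // mulr0.
move/eqP; rewrite mulf_eq0 (negPf qn0) => /eqP r0.
have := hs 0; rewrite -horner_restr_curve r0 horner0 => <-.
by rewrite scale0r addr0.
Qed.

Local Notation polar f := (polar_coef (mpoly_of_dhomog f)).

Definition free_partials f := forall u, (forall v, bil (polar f) u v = 0) -> u = 0.

Lemma dhomogP3 f : (f : {mpoly K[6]}) \is 3.-homog.
Proof. exact: dhomog_is_dhomog. Qed.

Lemma polar_coef_line f g s a b c :
  polar (f + s *: g) a b c = polar f a b c + s * polar g a b c.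
Proof. by rewrite /polar_coef /= !mderivD !mderivZ mcoeffD mcoeffZ. Qed.

Lemma bilmx_line f g s u : bilmx (polar (f + s *: g)) u = bilmx (polar f) u + s *: bilmx (polar g) u.
Proof.
apply/matrixP => b c; rewrite !mxE mulr_sumr -big_split; apply: eq_bigr => a _ /=.
by rewrite polar_coef_line mulrDl mulrA.
Qed.

(** Flattening the matrices H(e_a) into rows turns the independence of the partial derivatives into
    a rank condition, affine in s along a pencil. *)
Definition polar_rows f : 'M[K]_(6, 6 * 6) := \matrix_a mxvec (bilmx (polar f) (delta_mx 0 a)).

Lemma mul_polar_rows f u : u *m polar_rows f = mxvec (bilmx (polar f) u).
Proof.
rewrite mulmx_sum_row; under eq_bigr do rewrite rowK -linearZ /=.
rewrite -linear_sum; congr mxvec; apply/matrixP => b c; rewrite summxE [RHS]mxE.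
apply: eq_bigr => a _; rewrite mxE [bilmx _ _ _ _]mxE (bigD1 a) //= big1 => [|i ia].
  by rewrite mxE !eqxx addr0 mulr1 mulrC.
by rewrite mxE (negPf ia) andbF mulr0.
Qed.

Lemma free_partialsP f : free_partials f <-> row_free (polar_rows f).
Proof.
rewrite -kermx_eq0; split=> [nd|/rowV0P h u fu].
  apply/rowV0P => u /sub_kermxP; rewrite mul_polar_rows => /(canRL mxvecK).
  rewrite linear0 => u0; apply: nd => v; rewrite (bilC (polar_coef_sym _)).
  by rewrite (bilC (polar_coef_sym _)) -(bilC (polar_coef_sym _)) (bilC (polar_coef_sym _)) -mul_bilmx u0 mulmx0.
apply: h; apply/sub_kermxP; rewrite mul_polar_rows.
suff -> : bilmx (polar f) u = 0 by rewrite linear0.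
by apply/row_matrixP => i; rewrite rowE mul_bilmx row0.
Qed.

(** With B a right inverse of the rows of f, the determinant of the rows of f + s g times B is a
    polynomial in s with value 1 at s = 0. *)
Lemma free_partials_open f g : free_partials f ->
  exists2 q : {poly K}, q != 0 & forall s, q.[s] != 0 -> free_partials (f + s *: g).
Proof.
move=> /free_partialsP/row_freeP[B fB].
pose M : 'M[{poly K}]_6 := map_mx polyC (polar_rows f *m B) + 'X *: map_mx polyC (polar_rows g *m B).
have M_s s : map_mx (horner_eval s) M = polar_rows (f + s *: g) *m B.
  have -> : polar_rows (f + s *: g) = polar_rows f + s *: polar_rows g.
    apply/row_matrixP => i; rewrite linearD linearZ /= !rowK bilmx_line.
    by rewrite linearD linearZ.
  rewrite mulmxDl -scalemxAl /M; move: (_ *m B) (_ *m B) => P Q.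
  by apply/matrixP => i j; rewrite !mxE /horner_eval hornerD hornerM hornerX !hornerC.
have M_det s : (\det M).[s] = \det (polar_rows (f + s *: g) *m B).
  by rewrite -M_s det_map_mx.
exists (\det M).
  apply: contraTneq isT => M0; have := M_det 0.
  by rewrite M0 horner0 scale0r addr0 fB det1 => /eqP; rewrite eq_sym oner_eq0.
move=> s; rewrite M_det => dn0; apply/free_partialsP/row_freeP.
exists (B *m invmx (polar_rows (f + s *: g) *m B)).
by rewrite mulmxA mulmxV // unitmxE unitfE.
Qed.

Definition linear_form l : {mpoly K[6]} := \sum_i l 0 i *: 'X_i.

Lemma meval_linear_form l (x : 'rV[K]_6) : (linear_form l).@[x 0] = dotr l x.
Proof. by rewrite /linear_form raddf_sum; apply: eq_bigr => i _; rewrite /= mevalZ mevalXU. Qed.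

Lemma mderiv_linear_form l a : (linear_form l)^`M(a) = (l 0 a)%:MP.
Proof.
rewrite /linear_form (linear_sum (mderiv a)) (bigD1 a) //= big1 ?addr0 => [|j ja].
  by rewrite mderivZ mderivXU eqxx mpolyC1 alg_mpolyC.
by rewrite mderivZ mderivXU (negPf ja) mpolyC0 scaler0.
Qed.

Lemma linear_form_homog l : linear_form l \is 1.-homog.
Proof. by apply: rpred_sum => i _; apply: dhomogZ; rewrite dhomogX /= mdeg1. Qed.

Lemma cube_homog l : linear_form l ^+ 3 \is 3.-homog.
Proof. exact: (dhomogMn 3 (linear_form_homog l)). Qed.

Definition cube l : dhomog 6 K 3 := DHomog (cube_homog l).

Lemma polar_coef_cube l a b c : polar (cube l) a b c = 6 * l 0 a * l 0 b * l 0 c.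
Proof.
have d2 i : (linear_form l ^+ 3)^`M(i) = 3 *: ((l 0 i) *: linear_form l ^+ 2).
  rewrite !exprS expr0 mulr1 !mderivM mderiv_linear_form -!mul_mpolyC mpolyC_nat; ring.
have d1 i : (linear_form l ^+ 2)^`M(i) = 2 *: ((l 0 i) *: linear_form l).
  rewrite expr2 !mderivM mderiv_linear_form -!mul_mpolyC mpolyC_nat; ring.
rewrite /polar_coef /= d2 !mderivZ d1 !mderivZ mderiv_linear_form !mcoeffZ mcoeffC eqxx mulr1.
ring.
Qed.

Lemma bilmx_cube l u : bilmx (polar (cube l)) u = (6 * dotr u l) *: (l^T *m l).
Proof.
apply/matrixP => b c; rewrite !mxE big_ord1 !mxE /dotr mulr_sumr mulr_suml.
by apply: eq_bigr => a _; rewrite polar_coef_cube; ring.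
Qed.

(** A vector killed by the sum is killed by H and by l, since l is outside the row space of H. By
    symmetry that row space is the orthogonal of ker H, so l is nonzero on ker H and the kernel
    shrinks strictly. *)
Lemma rank_add_square (H : 'M[K]_6) l (e : K) : H^T = H ->
  ~~ (l <= H)%MS -> e != 0 -> (\rank H < \rank (H + e *: (l^T *m l))%R)%N.
Proof.
move=> HT lH en0; set H' := (X in (_ < \rank X)%N).
have kerH' (u : 'rV_6) : u *m H' = 0 -> u *m H = 0 /\ dotr u l = 0.
  rewrite mulmxDr -scalemxAr mulmxA => uH'.
  have {}uH' : u *m H = - (e * dotr u l) *: l.
    move/eqP: uH'; rewrite addr_eq0 => /eqP ->; rewrite scaleNr -scalerA.
    by congr (- (_ *: _)); rewrite -mul_scalar_mx dotrE -mx11_scalar.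
  have [z|n0] := eqVneq (dotr u l) 0; first by rewrite uH' z mulr0 oppr0 scale0r.
  case/negP: lH; have cn0 : - (e * dotr u l) != 0 by rewrite oppr_eq0 mulf_neq0.
  by apply/submxP; exists ((- (e * dotr u l))^-1 *: u); rewrite -scalemxAl uH' scalerA mulVf ?scale1r.
have [v vH vl] : exists2 v : 'rV_6, v *m H = 0 & dotr v l != 0.
  apply: contrapT => h; case/negP: lH.
  have HK : (H <= kermx (kermx H)^T)%MS.
    by apply/sub_kermxP; rewrite -[H in H *m _]HT -trmx_mul mulmx_ker trmx0.
  have KH : (kermx (kermx H)^T <= H)%MS.
    rewrite -(mxrank_leqif_sup HK) mxrank_ker mxrank_tr mxrank_ker subKn //.
    exact: rank_leq_row.
  apply: submx_trans KH; apply/sub_kermxP/trmx_inj; rewrite trmx_mul trmxK trmx0.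
  apply/row_matrixP => i; rewrite row_mul row0; apply/matrixP => a b.
  rewrite !ord1 -dotrE [RHS]mxE; apply/eqP/negPn/negP => n0; apply: h.
  by exists (row i (kermx H)) => //; rewrite -row_mul mulmx_ker row0.
have sub : (kermx H' <= kermx H)%MS.
  by apply/row_subP => i; have := row_sub i (kermx H') => /sub_kermxP/kerH'[h _]; apply/sub_kermxP.
have : (\rank (kermx H') < \rank (kermx H))%N.
  rewrite ltn_neqAle mxrankS // andbT (mxrank_leqif_sup sub); apply: contra vl => KK.
  have /(submx_trans) /(_ KK) /sub_kermxP/kerH'[_ ->] // : (v <= kermx H)%MS.
  exact/sub_kermxP.
by rewrite !mxrank_ker ltnNge => h; rewrite ltnNge; apply: contra h => /leq_sub2l.
Qed.

(** Induction on how far the rank at some point is from 5. If no H(x) has rank 5, all ranks are at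
    most 4, and adding s l^3 keeps them at most 5 while raising the rank at a chosen point. *)
Lemma in_closure_perturb :
    (forall f, free_partials f -> (forall x, \det (bilmx (polar f) x) = 0) ->
       (exists x, \rank (bilmx (polar f) x) = 5) -> in_closure f) ->
  forall f, free_partials f -> (forall x, \det (bilmx (polar f) x) = 0) -> in_closure f.
Proof.
move=> base.
have detrank f x : (\rank (bilmx (polar f) x) <= 5)%N <-> \det (bilmx (polar f) x) = 0.
  rewrite -ltnS ltn_neqAle rank_leq_row andbT; split=> [|d0].
    move=> r6; apply/eqP; apply: contraNT r6 => dn0.
    by rewrite -[_ == _]/(row_free _) row_free_unit unitmxE unitfE.
  apply: contraTN isT => r6; have : bilmx (polar f) x \in unitmx by rewrite -row_free_unit.
  by rewrite unitmxE d0 unitr0.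
suff main m : forall f, free_partials f -> (forall x, (\rank (bilmx (polar f) x) <= 5)%N) ->
    (exists x, (5 <= m + \rank (bilmx (polar f) x))%N) -> in_closure f.
  move=> f nd df; apply: (main 5 f nd) => [x|]; first by apply/detrank.
  by exists 0; rewrite leq_addr.
elim: m => [|m IH] f nd df [x0 rx0].
  apply: base => //; first by move=> x; apply/detrank.
  by exists x0; apply/eqP; rewrite eqn_leq df.
have [[x5 rx5]|no5] := pselect (exists x, \rank (bilmx (polar f) x) = 5).
  by apply: IH => //; exists x5; rewrite rx5 leq_addl.
have lt5 x : (\rank (bilmx (polar f) x) <= 4)%N.
  by rewrite -ltnS ltn_neqAle df andbT; apply/eqP => h; apply: no5; exists x.
(* Maximality ensures that x1 is nonzero: H(0) = 0, and a maximal rank of 0 would make f zero. *)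
have [x1 rx1 mx1] : exists2 x1, (\rank (bilmx (polar f) x0) <= \rank (bilmx (polar f) x1))%N &
    forall x, (\rank (bilmx (polar f) x) <= \rank (bilmx (polar f) x1))%N.
  have [j] := ubnP (5 - \rank (bilmx (polar f) x0)); elim: j x0 {rx0} => // j IHj x0 ltj.
  have [[y lty]|h] := pselect (exists y, (\rank (bilmx (polar f) x0) < \rank (bilmx (polar f) y))%N).
    have [|z le1 mz] := IHj y; first by have := lt5 y; lia.
    by exists z => //; apply: leq_trans le1; exact: ltnW.
  by exists x0 => // x; rewrite leqNgt; apply/negP => hx; apply: h; exists x.
have x1n0 : x1 != 0.
  apply/eqP => x10; have : f = 0.
    apply: val_inj; apply: mpoly_zero => x /=; rewrite (meval_cubic (dhomogP3 f)).
    have : bilmx (polar f) x = 0.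
      apply/eqP; rewrite -mxrank_eq0 -leqn0; apply: leq_trans (mx1 x) _.
      rewrite x10; have -> : bilmx (polar f) 0 = 0; last by rewrite mxrank0.
      by apply/row_matrixP => i; rewrite rowE mul_bilmx row0 (bil0l (polar_coef_sym _)).
    by move=> h; rewrite -mul_bilmx h mulmx0 dotr0l mulr0.
  move=> f0; have /rowP/(_ 0) : delta_mx 0 0 = 0 :> 'rV[K]_6.
    apply: nd => v; rewrite f0 -mul_bilmx; have -> : bilmx (polar (0 : dhomog 6 K 3)) (delta_mx 0 0) = 0 :> 'M[K]_6.
      apply/matrixP => b c; rewrite !mxE big1 // => a _.
      by rewrite /polar_coef /= !mderiv0 mcoeff0 mul0r.
    by rewrite mulmx0.
  by rewrite !mxE !eqxx => /eqP; rewrite oner_eq0.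
pose H := bilmx (polar f) x1.
have HT : H^T = H by rewrite tr_bilmx //; exact: polar_coef_sym.
(* One coordinate form is nonzero at x1 and one is outside the row space of H; one of the two, or
   their sum, has both properties. *)
have [l lx lH] : exists2 l : 'rV[K]_6, dotr x1 l != 0 & ~~ (l <= H)%MS.
  have /rV0Pn[a xa] := x1n0.
  have xl1 : dotr x1 (delta_mx 0 a) != 0 by rewrite dotr_delta.
  have [lH|lH] := boolP ((delta_mx 0 a : 'rV[K]_6) <= H)%MS; last by exists (delta_mx 0 a).
  have [b bH] : exists b, ~~ ((delta_mx 0 b : 'rV[K]_6) <= H)%MS.
    apply: contrapT => h; have := lt5 x1; rewrite -/H leqNgt => /negP; apply.
    have : (1%:M <= H)%MS.
      apply/row_subP => i; rewrite rowE mulmx1; apply/negPn/negP => hh.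
      by apply: h; exists i.
    by move/mxrankS; rewrite mxrank1; apply: leq_trans.
  have [x2|x2] := eqVneq (dotr x1 (delta_mx 0 b)) 0; last by exists (delta_mx 0 b).
  exists (delta_mx 0 a + delta_mx 0 b); first by rewrite dotrDr x2 addr0.
  by apply: contra bH => h; rewrite -[delta_mx 0 b](addKr (delta_mx 0 a)) addmx_sub ?eqmx_opp.
have [q qn0 qnd] := free_partials_open (cube l) nd.
apply: (@in_closure_line f (cube l) (q * 'X)); first by rewrite mulf_neq0 ?polyX_eq0.
move=> s; rewrite hornerM hornerX mulf_eq0 negb_or => /andP[qs sn0].
have Hs x : bilmx (polar (f + s *: cube l)) x = bilmx (polar f) x + (s * (6 * dotr x l)) *: (l^T *m l).
  by rewrite bilmx_line bilmx_cube scalerA.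
apply: IH; first exact: qnd.
  move=> x; rewrite Hs; apply: leq_trans (mxrank_add _ _) _.
  have := lt5 x; set r := \rank (bilmx _ _) => r4; apply: (@leq_trans (r + 1)%N); last by rewrite addn1.
  rewrite leq_add2l; apply: leq_trans (mxrank_scale _ _) _.
  by apply: leq_trans (mxrankM_maxr _ _) (rank_leq_row _).
exists x1; have : (\rank H < \rank (bilmx (polar (f + s *: cube l)%R) x1))%N.
  by rewrite Hs; apply: rank_add_square => //; rewrite !mulf_neq0 ?pnatr_eq0.
by rewrite /H; move: rx0 rx1; lia.
Qed.

End Perturbation.

Local Open Scope classical_set_scope.

(** * Hilbert functions and chains of irreducible closed sets *)

Section Counting.

Lemma expn_leq_bin k l : ((k.+1) ^ l <= l`! * 'C(k + l, l))%N.
Proof.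
elim: l => [|l IH]; first by rewrite bin0.
have E : (l.+1 * 'C((k + l).+1, l.+1) = (k + l).+1 * 'C(k + l, l))%N by rewrite mul_bin_diag.
rewrite expnS factS addnS [(l.+1 * _)%N]mulnC -mulnA E mulnCA.
by apply: leq_mul => //; rewrite ltnS leq_addr.
Qed.

Lemma bin_leq_expn a r : ('C(a + r, r) <= a.+1 ^ r)%N.
Proof.
elim: r => [|r IH]; first by rewrite bin0.
have E : (r.+1 * 'C((a + r).+1, r.+1) = (a + r).+1 * 'C(a + r, r))%N by rewrite mul_bin_diag.
rewrite addnS -(leq_pmul2l (ltn0Sn r)) E expnS mulnA.
apply: leq_mul => //; rewrite mulnS; nia.
Qed.

Lemma bin_growth (c m l : nat) : (m < l)%N -> exists k,
  ('C(k * c + m, m) < 'C(k + l, l))%N.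
Proof.
(* The left side grows like k^m and the right side like k^l. This k gives l! (k c + 1)^m <= k (k +
   1)^m < (k + 1)^l. *)
move=> ml; pose k := (l`! * (c.+1) ^ m)%N; exists k.
rewrite -(ltn_pmul2l (fact_gt0 l)); apply: leq_trans (expn_leq_bin k l).
apply: (@leq_ltn_trans (l`! * (k * c).+1 ^ m)%N).
  by rewrite leq_mul2l bin_leq_expn orbT.
apply: (@leq_ltn_trans (l`! * (k.+1 * c.+1) ^ m)%N).
  by rewrite leq_mul2l; apply/orP; right; case: (m) => // m'; rewrite leq_exp2r //; nia.
rewrite expnMn [(k.+1 ^ m * _)%N]mulnC mulnA -/k.
apply: (@leq_trans (k.+1 ^ m.+1)%N); last by rewrite leq_pexp2l.
by rewrite expnS ltn_pmul2r ?expn_gt0 //.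
Qed.

End Counting.

Section HomogeneousComposition.
Context (K : numFieldType).

Lemma dhomog_bigprod (I : Type) (r : seq I) n (q : I -> {mpoly K[n]}) (d : I -> nat) :
  (forall i, q i \is (d i).-homog) -> \prod_(i <- r) q i \is (\sum_(i <- r) d i).-homog.
Proof.
move=> hq; elim: r => [|i r IH]; first by rewrite !big_nil dhomog1.
by rewrite !big_cons; apply: dhomogM.
Qed.

Lemma dhomog_comp n m d e (p : {mpoly K[n]}) (psi : n.-tuple {mpoly K[m]}) :
    p \is d.-homog -> (forall i, tnth psi i \is e.-homog) ->
  p \mPo psi \is (d * e).-homog.
Proof.
move=> /dhomogP hp hpsi; rewrite comp_mpolyE big_seq; apply: rpred_sum => mm /hp /= <-.
apply: rpredZ; have -> : (mdeg mm * e = \sum_(i < n) e * mm i)%N.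
  by rewrite mdegE big_distrl; apply: eq_bigr => i _; rewrite mulnC.
by apply: dhomog_bigprod => i; apply: dhomogMn.
Qed.

End HomogeneousComposition.

Section Dimension.
Context (K : numFieldType) (n : nat).
Implicit Types (X Y Z : set 'rV[K]_n) (v w : 'rV[K]_n).

Lemma pclosed_sep Y v : pclosed Y -> v != 0 -> ~ Y v ->
  exists d (F : {mpoly K[n]}), [/\ F \is d.-homog, vanishes_on F Y & F.@[v 0] != 0].
Proof.
move=> Yc v0 nYv; apply: contrapT => h; apply: nYv; rewrite -Yc; split=> // d F hF van.
by apply/eqP/negPn/negP => Fv; apply: h; exists d, F.
Qed.

Lemma pclosed_neq0 Y v : pclosed Y -> Y v -> v != 0.
Proof. by move=> <- []. Qed.

Lemma pclosed_zeros (S : {mpoly K[n]} -> Prop) : (forall F, S F -> exists d, F \is d.-homog) ->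
  pclosed [set v : 'rV[K]_n | v != 0 /\ forall F, S F -> F.@[v 0] = 0].
Proof.
move=> hS; apply/seteqP; split=> v /=.
  move=> [v0 h]; split=> // F SF; have [d hF] := hS F SF; apply: (h d F hF).
  by move=> w [_ /(_ F SF)].
by move=> [v0 h]; split=> // d F hF; apply.
Qed.

Lemma pirreducible_prod Y (F G : {mpoly K[n]}) d e :
  pirreducible Y -> F \is d.-homog -> G \is e.-homog ->
  vanishes_on (F * G) Y -> vanishes_on F Y \/ vanishes_on G Y.
Proof.
move=> [_ Yc irr] hF hG FG.
pose Z (P : {mpoly K[n]}) := [set v : 'rV[K]_n | v != 0 /\ forall H, H = P -> H.@[v 0] = 0].
have Zc P k : P \is k.-homog -> pclosed (Z P).
  by move=> hP; apply: pclosed_zeros => H ->; exists k.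
case: (irr (Z F) (Z G) (Zc _ _ hF) (Zc _ _ hG)) => [v Yv|h|h].
- have v0 := pclosed_neq0 Yc Yv; have /eqP := FG v Yv.
  by rewrite mevalM mulf_eq0 => /orP[] /eqP z; [left|right]; split=> // H ->.
- by left=> v /h[_]; apply.
- by right=> v /h[_]; apply.
Qed.

Lemma dim_dhomog m k : dim (dhomog m.+1 K k) = 'C(k + m, k).
Proof. by []. Qed.

(** Says that the Hilbert function of Y in degree e is at least r. *)
Definition indep_forms Y e r := exists p : 'I_r -> {mpoly K[n]},
  (forall i, p i \is e.-homog) /\
  forall c : 'I_r -> K, vanishes_on (\sum_i c i *: p i) Y -> forall i, c i = 0.

Lemma indep_forms1 Y e (F : {mpoly K[n]}) v :
  F \is e.-homog -> Y v -> F.@[v 0] != 0 -> indep_forms Y e 1.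
Proof.
move=> hF Yv Fv; exists (fun=> F); split=> // c /(_ v Yv); rewrite big_ord1 mevalZ => /eqP.
by rewrite mulf_eq0 (negPf Fv) orbF => /eqP c0 i; rewrite (ord1 i).
Qed.

(** Restricting a relation to Y removes the multiples of F and so kills the coefficients of the q's.
    What remains is divisible by F, which cancels because Y' is irreducible. *)
Lemma indep_forms_growth Y Y' e D r1 r2 (F : {mpoly K[n]}) :
    pirreducible Y' -> Y `<=` Y' -> F \is D.-homog -> vanishes_on F Y -> ~ vanishes_on F Y' ->
    indep_forms Y' e r1 -> indep_forms Y (D + e) r2 ->
  indep_forms Y' (D + e) (r1 + r2).
Proof.
move=> irr sub hF FY FY' [p [hp ip]] [q [hq iq]].
exists (fun i => match split i with inl a => F * p a | inr b => q b end); split.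
  by move=> i; case: split => a //; apply: dhomogM.
move=> c; rewrite big_split_ord /=.
under eq_bigr do rewrite (unsplitK (inl _)); under [X in _ + X]eq_bigr do rewrite (unsplitK (inr _)).
have -> : \sum_i c (lshift r2 i) *: (F * p i) = F * (\sum_i c (lshift r2 i) *: p i).
  by rewrite mulr_sumr; apply: eq_bigr => i _; rewrite scalerAr.
move=> van; have c2 : forall i, c (rshift r1 i) = 0.
  apply: iq => v Yv; have := van v (sub v Yv).
  by rewrite mevalD mevalM FY // mul0r add0r.
have c1 : forall i, c (lshift r2 i) = 0.
  apply: ip; have [||//|//] := @pirreducible_prod Y' F (\sum_i c (lshift r2 i) *: p i) D e irr hF.
    by apply: rpred_sum => i _; apply: dhomogZ.
  move=> v Yv; rewrite -(van v Yv) [X in _ + X]big1 ?addr0 // => i _.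
  by rewrite c2 scale0r.
by move=> i; rewrite -(splitK i); case: split => a /=.
Qed.

(* Let F vanish on Y i but not on Y i.+1. The multiples by F of independent forms
   on Y i.+1, together with independent forms on Y i, are independent on Y i.+1:
   this is Pascal's rule for the bound. *)
Lemma chain_indep_forms X l : has_chain X l ->
  exists2 Y, Y `<=` X & exists2 D, (0 < D)%N & forall k, indep_forms Y (k * D) 'C(k + l, l).
Proof.
move=> [Y [Yirr Ylt]]; exists (Y l); first by have [] := Yirr l (leqnn l).
have ex i : exists dF : nat * {mpoly K[n]}, (i < l)%N ->
   [/\ (0 < dF.1)%N, dF.2 \is dF.1.-homog, vanishes_on dF.2 (Y i) &
      exists2 v, Y i.+1 v & dF.2.@[v 0] != 0].
  have [il|il] := boolP (i < l)%N; last by exists (0%N, 0).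
  have [[Yi0 Yic _] _] := Yirr i (ltnW il); have [[_ Yi1c _] _] := Yirr i.+1 il.
  have [_ nsub] := Ylt i il.
  have [v Yv nYv] : exists2 v, Y i.+1 v & ~ Y i v.
    by apply: contrapT => h; apply: nsub => v Yv; apply: contrapT => nYv; apply: h; exists v.
  have [d [F [hF FY Fv]]] := pclosed_sep Yic (pclosed_neq0 Yi1c Yv) nYv.
  exists (d, F) => _; split=> //; last by exists v.
  rewrite lt0n; apply: contra Fv => /eqP /= d0; move: hF; rewrite /= d0 => /dhomog0_const FC.
  have [w Yw] := Yi0; have := FY w Yw; rewrite FC !mevalC => ->; exact: eqxx.
have [dF dFP] := boolp.choice ex.
(* A common multiple of the degrees, so that powers of all the separating forms can be taken of the
   same degree D. *)
pose D := (\prod_(i < l) (dF i).1)%N.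
have D0 : (0 < D)%N by apply: prodn_gt0 => i; have [] := dFP i (ltn_ord i).
exists D => //.
suff h i : (i <= l)%N -> forall k, indep_forms (Y i) (k * D) 'C(k + i, i) by exact: h.
elim: i => [|i IHi] il k.
  have [[[v Yv] Yc _] _] := Yirr 0%N il; have v0 := pclosed_neq0 Yc Yv.
  have /rV0Pn[j vj] := v0.
  rewrite bin0; apply: (@indep_forms1 _ _ ('X_j ^+ (k * D)) v) => //.
    by rewrite -[X in X.-homog]mul1n; apply: dhomogMn; rewrite dhomogX /= mdeg1.
  by rewrite rmorphXn /= mevalXU expf_neq0.
elim: k => [|k IHk].
  have [[[v Yv] _ _] _] := Yirr i.+1 il; rewrite binn.
  apply: (@indep_forms1 _ _ 1 v) => //; first exact: dhomog1.
  by rewrite meval1 oner_eq0.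
have [di hF FY [v Yv Fv]] := dFP i il.
pose e := (D %/ (dF i).1)%N; have De : ((dF i).1 * e = D)%N.
  by rewrite /e mulnC divnK // /D (bigD1 (Ordinal il)) //= dvdn_mulr.
have e0 : (0 < e)%N by move: D0; rewrite -De muln_gt0 => /andP[].
rewrite addSn binS -addSnnS mulSn.
apply: (@indep_forms_growth (Y i) (Y i.+1) (k * D) D _ _ ((dF i).2 ^+ e)).
- by have [] := Yirr i.+1 il.
- by have [] := Ylt i il.
- by rewrite -De; apply: dhomogMn.
- by move=> w Yw; rewrite rmorphXn /= FY // expr0n (gtn_eqF e0).
- by move=> /(_ v Yv) /eqP; rewrite rmorphXn /= expf_eq0 (negPf Fv) andbF.
- by rewrite addnS -addSn in IHk *; exact: IHk.
- by rewrite -mulSn; apply: IHi; exact: ltnW.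
Qed.

(** Forms independent on Y stay independent after composition with psi, whose image covers Y. They
    become forms of degree e d in m + 1 variables. *)
Lemma indep_forms_param m (psi : n.-tuple {mpoly K[m.+1]}) Y d e r :
    (forall i, tnth psi i \is d.-homog) ->
    (forall v, Y v -> exists s : 'rV[K]_m.+1, forall i, v 0 i = (tnth psi i).@[s 0]) ->
  indep_forms Y e r -> (r <= 'C(e * d + m, m))%N.
Proof.
move=> hpsi Ypsi [p [hp ip]].
have hq i : p i \mPo psi \is (e * d).-homog by apply: dhomog_comp.
pose q i : dhomog m.+1 K (e * d) := DHomog (hq i).
have fq : free [tuple q i | i < r].
  apply/freeP => c z0.
  have {z0} zE : \sum_i c i *: (p i \mPo psi) = 0.
    have /(congr1 (@mpoly_of_dhomog _ _ _)) : \sum_i c i *: q i = 0.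
      by rewrite -[RHS]z0; apply: eq_bigr => i _; rewrite -tnth_nth tnth_mktuple.
    by rewrite (linear_sum (@mpoly_of_dhomog _ _ _)).
  apply: ip => v /Ypsi[s vs].
  have := congr1 (meval (s 0)) zE; rewrite meval0 !raddf_sum /= => E.
  rewrite -[RHS]E; apply: eq_bigr => i _; rewrite !mevalZ comp_mpoly_meval.
  by congr (_ * _); apply: meval_eq => j; rewrite vs.
have := dimvS (subvf <<[tuple q i | i < r]>>).
rewrite (eqP fq) size_tuple dimvf dim_dhomog => /leq_trans; apply.
have -> : 'C(e * d + m, e * d) = 'C(e * d + m, m) by rewrite -[RHS]bin_sub ?leq_addl // addnK.
exact: leqnn.
Qed.

Lemma chain_param_bound m (psi : n.-tuple {mpoly K[m.+1]}) X d l :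
    (forall i, tnth psi i \is d.-homog) ->
    (forall v, X v -> exists s : 'rV[K]_m.+1, forall i, v 0 i = (tnth psi i).@[s 0]) ->
  has_chain X l -> (l <= m)%N.
Proof.
move=> hpsi Xpsi /chain_indep_forms[Y YX [D D0 H]]; rewrite leqNgt; apply/negP => ml.
have [k] := bin_growth (D * d) ml; rewrite ltnNge => /negP; apply.
rewrite mulnA; have Ypsi v (Yv : Y v) := Xpsi v (YX v Yv).
exact: (indep_forms_param hpsi Ypsi (H k)).
Qed.

Lemma pirreducible_param m (psi : n.-tuple {mpoly K[m]}) Y : Y !=set0 -> pclosed Y ->
    (forall v, Y v -> exists s : 'rV[K]_m, forall i, v 0 i = (tnth psi i).@[s 0]) ->
    (forall (s : 'rV[K]_m) v, (forall i, v 0 i = (tnth psi i).@[s 0]) -> v != 0 -> Y v) ->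
  pirreducible Y.
Proof.
move=> Y0 Yc Ypsi psiY; split=> // A B Ac Bc YAB; apply: contrapT => /not_orP[nA nB].
have sep Z : pclosed Z -> ~ Y `<=` Z -> exists F : {mpoly K[n]}, vanishes_on F Z /\ F \mPo psi != 0.
  move=> Zc nYZ; have [v Yv nZv] : exists2 v, Y v & ~ Z v.
    by apply: contrapT => h; apply: nYZ => v Yv; apply: contrapT => nZv; apply: h; exists v.
  have [d [F [hF FZ Fv]]] := pclosed_sep Zc (pclosed_neq0 Yc Yv) nZv.
  exists F; split=> //; apply: contra Fv => /eqP F0; have [s vs] := Ypsi v Yv.
  have := congr1 (meval (s 0)) F0; rewrite comp_mpoly_meval meval0 => <-.
  by apply/eqP/meval_eq => i; rewrite vs.
have [F [FA F0]] := sep A Ac nA; have [G [GB G0]] := sep B Bc nB.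
have [v Yv] := Y0; have v0 := pclosed_neq0 Yc Yv; have [s0 vs0] := Ypsi v Yv.
have /rV0Pn[j vj] := v0.
have P0 : tnth psi j != 0 by apply: contra vj => /eqP z; rewrite vs0 z meval0.
(* The extra factor takes care of the parameters that psi sends to the zero vector, which represents
   no point of Y. *)
have : (F \mPo psi) * (G \mPo psi) * tnth psi j = 0.
  apply: mpoly_zero => s; rewrite !mevalM !comp_mpoly_meval.
  pose w : 'rV[K]_n := \row_i (tnth psi i).@[s 0].
  have ww i : w 0 i = (tnth psi i).@[s 0] by rewrite mxE.
  have [w0|wn0] := eqVneq w 0; first by rewrite -[(tnth psi j).@[_]]ww w0 mxE mulr0.
  have E (H : {mpoly K[n]}) : H.@[fun i => (tnth psi i).@[s 0]] = H.@[w 0].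
    by apply: meval_eq => i; rewrite ww.
  rewrite !E; have := psiY s w ww wn0 => /YAB[Aw|Bw]; first by rewrite FA // !mul0r.
  by rewrite (GB w Bw) mulr0 mul0r.
by move/eqP; rewrite !mulf_eq0 (negPf F0) (negPf G0) (negPf P0).
Qed.

End Dimension.

(** * The quadric cone of rank three and its dual conic *)

Lemma has_dim_rowspace (K : fieldType) m n (W : 'M[K]_(m, n)) :
  has_dim [set v : 'rV[K]_n | (v <= W)%MS] (\rank W).
Proof.
exists (fun i => row i (row_base W)); split.
  apply/seteqP; split=> v /=.
    rewrite -(eq_row_base W) => /submxP[c ->]; exists (fun i => c 0 i).
    by rewrite mulmx_sum_row.
  move=> [c ->]; rewrite -(eq_row_base W); apply: summx_sub => i _.
  by rewrite scalemx_sub // row_sub.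
move=> c c0 i; have : (\row_i c i) *m row_base W = 0.
  by rewrite mulmx_sum_row -[RHS]c0; apply: eq_bigr => j _; rewrite mxE.
move=> h; have := row_base_free W; rewrite -kermx_eq0 => /rowV0P k0.
have /rowP/(_ i) : \row_i c i = 0 by apply: k0; apply/sub_kermxP.
by rewrite !mxE.
Qed.

Lemma mem_hyperplane (K : fieldType) n (c v : 'rV[K]_n) :
  (v <= kermx c^T)%MS = (dotr c v == 0).
Proof.
apply/sub_kermxP/eqP => [h|h].
  by rewrite dotrC dotrE h mxE.
by apply/matrixP => i j; rewrite !ord1 -dotrE dotrC h mxE.
Qed.

Lemma has_dim_hyperplane (K : fieldType) n (c : 'rV[K]_n.+1) : c != 0 ->
  has_dim [set v : 'rV[K]_n.+1 | dotr c v = 0] n.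
Proof.
move=> c0; have := has_dim_rowspace (kermx c^T).
rewrite mxrank_ker mxrank_tr rank_rV c0 subn1 /=; congr has_dim.
by apply/seteqP; split=> v /=; rewrite mem_hyperplane => /eqP.
Qed.

Lemma hyperplane_covector (K : fieldType) n (c a : 'rV[K]_n) :
  (forall v, dotr c v = 0 -> dotr a v = 0) -> exists e, a = e *: c.
Proof.
move=> h; have [cz|c0] := eqVneq c 0.
  by exists 0; rewrite scale0r; apply: dotr_eq0 => v; apply: h; rewrite cz dotr0l.
have /rV0Pn[i ci] := c0.
exists (a 0 i / c 0 i); apply/rowP => j; rewrite mxE.
have := h (c 0 i *: delta_mx 0 j - c 0 j *: delta_mx 0 i).
rewrite !dotrDr !dotrNr !dotrZr !dotr_delta mulrC subrr => /(_ erefl) /subr0_eq E.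
by apply: (mulfI ci); rewrite E mulrA [c 0 i * _]mulrC mulfVK // mulrC.
Qed.

Section LinearForms.
Context (K : numFieldType).
Implicit Types (l v : 'rV[K]_6).

Definition coord_form (M : 'M[K]_6) (i : nat) : {mpoly K[6]} := linear_form (col (inord i) M)^T.

Lemma meval_coord_form M i v : (coord_form M i).@[v 0] = (v *m M) 0 (inord i).
Proof.
by rewrite meval_linear_form dotrC dotrE trmxK !mxE; apply: eq_bigr => j _; rewrite !mxE.
Qed.

Definition pulled (m : nat) (q : nat -> {mpoly K[m]}) (B : 'M[K]_6) : 6.-tuple {mpoly K[m]} :=
  [tuple \sum_(a < 6) B a j *: q a | j < 6].

Lemma meval_pulled m q B (s : 'rV[K]_m) j :
  (tnth (pulled q B) j).@[s 0] = ((\row_(a < 6) (q a).@[s 0]) *m B) 0 j.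
Proof.
rewrite tnth_mktuple raddf_sum mxE; apply: eq_bigr => a _.
by rewrite /= mevalZ mxE mulrC.
Qed.

Lemma pulled_homog m q B d : (forall a, q a \is d.-homog) ->
  forall j, tnth (@pulled m q B) j \is d.-homog.
Proof.
by move=> hq j; rewrite tnth_mktuple; apply: rpred_sum => a _; apply: dhomogZ.
Qed.

Context (M B : 'M[K]_6) (BM : B *m M = 1%:M) (MB : M *m B = 1%:M).

Lemma mulM_inj v w : v *m M = w *m M -> v = w.
Proof. by move=> h; rewrite -[v]mulmx1 -MB mulmxA h -mulmxA MB mulmx1. Qed.

Lemma mulM_neq0 v : v != 0 -> v *m M != 0.
Proof. by apply: contra => /eqP h; apply/eqP/mulM_inj; rewrite h mul0mx. Qed.

Lemma mulB_neq0 v : v != 0 -> v *m B != 0.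
Proof.
by apply: contra => /eqP h; apply/eqP; rewrite -[v]mulmx1 -BM mulmxA h mul0mx.
Qed.

Lemma pulledP m (q : nat -> {mpoly K[m]}) v (s : 'rV[K]_m) :
  (forall i, v 0 i = (tnth (pulled q B) i).@[s 0]) <-> v *m M = \row_(a < 6) (q a).@[s 0].
Proof.
split=> [h|h i].
  rewrite -[RHS]mulmx1 -BM mulmxA; congr (_ *m M); apply/rowP => i.
  by rewrite h meval_pulled.
by rewrite meval_pulled -h -mulmxA MB mulmx1.
Qed.

(** The linear subspaces from which the chains for the lower bounds on dimension are built. *)
Definition coord_subspace (J : pred nat) : set 'rV[K]_6 :=
  [set v | v != 0 /\ forall a, (a < 6)%N -> ~~ J a -> (v *m M) 0 (inord a) = 0].

Lemma coord_subspace_irr (J : pred nat) a0 : (a0 < 6)%N -> J a0 -> pirreducible (coord_subspace J).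
Proof.
move=> a06 Ja0; pose q a : {mpoly K[6]} := if J a then 'X_(inord a) else 0.
apply: (@pirreducible_param _ _ _ (pulled q B)).
- exists (delta_mx 0 (inord a0) *m B); split.
    apply: mulB_neq0; apply/eqP => /rowP/(_ (inord a0)); rewrite !mxE !eqxx => /eqP.
    by rewrite oner_eq0.
  move=> a a6 Ja; rewrite -mulmxA BM mulmx1 mxE eqxx /=.
  case: eqP => // /(congr1 (@nat_of_ord _)); rewrite !inordK // => aa0.
  by rewrite aa0 Ja0 in Ja.
- have -> : coord_subspace J = [set v : 'rV[K]_6 | v != 0 /\
      forall F, (exists2 a, (a < 6)%N && ~~ J a & F = coord_form M a) -> F.@[v 0] = 0].
    apply/seteqP; split=> v /= [v0 h]; split=> //.
      by move=> F [a /andP[a6 Ja] ->]; rewrite meval_coord_form h.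
    by move=> a a6 Ja; rewrite -meval_coord_form; apply: h; exists a; rewrite ?a6.
  by apply: pclosed_zeros => F [a _ ->]; exists 1%N; exact: linear_form_homog.
- move=> v [v0 h]; exists (v *m M); apply/pulledP; apply/rowP => a; rewrite [RHS]mxE /q.
  case: ifP => Ja; first by rewrite mevalXU inord_val.
  by rewrite meval0 -(inord_val a) h ?Ja.
- move=> s v /pulledP h v0; split=> // a a6 Ja.
  by rewrite h mxE /q inordK // (negPf Ja) meval0.
Qed.

End LinearForms.

Section QuadricCone.
Context (K : numClosedFieldType) (M B : 'M[K]_6) (BM : B *m M = 1%:M) (MB : M *m B = 1%:M).
Implicit Types (v w z : 'rV[K]_6).

(* Equations are written in the coordinates y = v *m M, parametrisations in v = y *m B.
   [c = 1] gives the polar image and [c = 4] the cone over its dual conic. *)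
Definition rank3_form (c : K) (y : 'rV[K]_6) : K :=
  c * y 0 (inord 0) * y 0 (inord 2) - y 0 (inord 1) ^+ 2.

Definition rank3_poly c : {mpoly K[6]} :=
  c *: (coord_form M 0 * coord_form M 2) - coord_form M 1 ^+ 2.

Lemma meval_rank3_poly c v : (rank3_poly c).@[v 0] = rank3_form c (v *m M).
Proof. by rewrite mevalB mevalZ mevalM rmorphXn /= !meval_coord_form mulrA. Qed.

Lemma rank3_poly_homog c : rank3_poly c \is 2.-homog.
Proof.
apply: rpredB; first by apply: dhomogZ; apply: (@dhomogM _ _ _ 1 _ 1); exact: linear_form_homog.
by apply: (@dhomogMn _ _ _ 1); exact: linear_form_homog.
Qed.

Definition quadric_cone : set 'rV[K]_6 := [set v | v != 0 /\ rank3_form 1 (v *m M) = 0].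

Definition conic : set 'rV[K]_6 := [set v | [/\ v != 0, rank3_form 4 (v *m M) = 0 &
  forall a, (2 < a < 6)%N -> (v *m M) 0 (inord a) = 0]].

Lemma binary_square (c x y z : K) : c != 0 -> c ^+ 2 * x * z = y ^+ 2 ->
  exists s t, [/\ x = s ^+ 2, y = c * s * t & z = t ^+ 2].
Proof.
move=> c0 E; have [x0|x0] := eqVneq x 0.
  exists 0, (sqrtC z); rewrite sqrtCK expr0n mulr0 mul0r; split=> //.
  by apply/eqP; rewrite -sqrf_eq0 -E x0 mulr0 mul0r.
have s0 : sqrtC x != 0 by rewrite sqrtC_eq0.
exists (sqrtC x), (y / (c * sqrtC x)); rewrite sqrtCK; split=> //.
  by rewrite mulrC mulfVK // mulf_neq0.
rewrite expr_div_n -E exprMn sqrtCK; field; by rewrite c0 x0.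
Qed.

(** The last three coordinates are squares only to give all components the same degree 2; square
    roots keep the parametrisation onto. *)
Let q4 a : {mpoly K[5]} :=
  if a == 0%N then 'X_(inord 0) ^+ 2 else if a == 1%N then 'X_(inord 0) * 'X_(inord 1)
  else if a == 2%N then 'X_(inord 1) ^+ 2 else 'X_(inord a.-1) ^+ 2.

Let q2 a : {mpoly K[2]} :=
  if a == 0%N then 'X_(inord 0) ^+ 2 else if a == 1%N then 2 *: ('X_(inord 0) * 'X_(inord 1))
  else if a == 2%N then 'X_(inord 1) ^+ 2 else 0.

Lemma row6P (v w : 'rV[K]_6) : (forall a, (a < 6)%N -> v 0 (inord a) = w 0 (inord a)) -> v = w.
Proof. by move=> h; apply/rowP => i; rewrite -(inord_val i) h. Qed.

Lemma XU_homog n (i : 'I_n) : ('X_i : {mpoly K[n]}) \is 1.-homog.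
Proof. by rewrite dhomogX /= mdeg1. Qed.

Lemma quadric_cone_paramP v : v != 0 -> quadric_cone v <->
  exists s : 'rV[K]_5, v *m M = \row_(a < 6) (q4 a).@[s 0].
Proof.
move=> v0; split=> [[_ E]|[s E]]; last first.
  split=> //; rewrite E /rank3_form !mxE /q4 !inordK //= !rmorphXn rmorphM /= !mevalXU; ring.
move: (v *m M) E => y E; have [||s [t [y0 y1 y2]]] := @binary_square 1 (y 0 (inord 0)) (y 0 (inord 1)) (y 0 (inord 2)).
- exact: oner_neq0.
- by rewrite expr1n; apply/subr0_eq; exact: E.
exists (\row_i nth 0 [:: s; t; sqrtC (y 0 (inord 3)); sqrtC (y 0 (inord 4)); sqrtC (y 0 (inord 5))] i).
apply: row6P => a a6; rewrite [RHS]mxE inordK //.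
case: a a6 => [|[|[|[|[|[|//]]]]]] a6; rewrite /q4 /= ?rmorphXn ?rmorphM /= !mevalXU !mxE !inordK //= ?sqrtCK //.
by rewrite y1 mul1r.
Qed.

Lemma quadric_cone_closed : pclosed quadric_cone.
Proof.
have -> : quadric_cone = [set v : 'rV[K]_6 | v != 0 /\ forall F, F = rank3_poly 1 -> F.@[v 0] = 0].
  apply/seteqP; split=> v /= [v0 h]; split=> //; first by move=> F ->; rewrite meval_rank3_poly.
  by rewrite -meval_rank3_poly h.
by apply: pclosed_zeros => F ->; exists 2; exact: rank3_poly_homog.
Qed.

Let basis_pt a := (delta_mx 0 (inord a) : 'rV[K]_6) *m B.

Lemma basis_ptM a : basis_pt a *m M = delta_mx 0 (inord a).
Proof. by rewrite -mulmxA BM mulmx1. Qed.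

Lemma delta_inord a b : (a < 6)%N -> (b < 6)%N ->
  (delta_mx 0 (inord a) : 'rV[K]_6) 0 (inord b) = (a == b)%:R.
Proof.
move=> a6 b6; rewrite mxE eqxx /= eq_sym; congr (nat_of_bool _)%:R.
by rewrite -(inj_eq val_inj) /= !inordK.
Qed.

Lemma basis_pt_neq0 a : (a < 6)%N -> basis_pt a != 0.
Proof.
move=> a6; apply/eqP => h; have := basis_ptM a; rewrite h mul0mx => /rowP/(_ (inord a)).
by rewrite delta_inord // eqxx mxE => /esym/eqP; rewrite oner_eq0.
Qed.

Lemma quadric_cone_irr : pirreducible quadric_cone.
Proof.
apply: (@pirreducible_param _ _ _ (pulled q4 B)).
- exists (basis_pt 0); split; first exact: basis_pt_neq0.
  by rewrite basis_ptM /rank3_form !delta_inord //= !(mulr0, expr0n, subr0).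
- exact: quadric_cone_closed.
- move=> v Zv; have [v0 _] := Zv; have [s E] := (quadric_cone_paramP v0).1 Zv.
  by exists s; apply/(pulledP BM MB).
- by move=> s v /(pulledP BM MB) h v0; apply/quadric_cone_paramP => //; exists s.
Qed.

Lemma pdim_quadric_cone : pdim quadric_cone 4.
Proof.
split; last first.
  move=> /(@chain_param_bound _ _ _ (pulled q4 B) _ 2) h; suff : (5 <= 4)%N by [].
  apply: h => [|v Zv].
    apply: pulled_homog => a; rewrite /q4; do 3 ?case: ifP => _;
      by [apply: (@dhomogMn _ _ _ 1); exact: XU_homog|apply: (@dhomogM _ _ _ 1 _ 1); exact: XU_homog].
  have [v0 _] := Zv; have [s E] := (quadric_cone_paramP v0).1 Zv.
  by exists s; apply/(pulledP BM MB).
(* The chain is a flag P^0 < P^1 < P^2 < P^3 in the linear space y1 = y2 = 0, which lies on the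
   quadric, followed by the quadric itself. *)
pose J i : pred nat := fun a => (a == 0%N) || (2 < a < 3 + i)%N.
pose Y i := if (i < 4)%N then coord_subspace M (J i) else quadric_cone.
have JZ i : coord_subspace M (J i) `<=` quadric_cone.
  move=> v [v0 h]; split=> //; rewrite /rank3_form !(h 1%N, h 2%N) //=.
  by rewrite mulr0 expr0n subrr.
exists Y; split=> i il.
  rewrite /Y; case: ifP => i4; last by split=> //; exact: quadric_cone_irr.
  split; last exact: JZ.
  exact: (coord_subspace_irr BM MB (a0 := 0)).
rewrite /Y il; have [i3|i3] := ltnP i.+1 4.
  split=> [v [v0 h]|/(_ (basis_pt (3 + i)))].
    split=> // a a6 Ja; apply: h => //; apply: contra Ja; rewrite /J; lia.
  have i6 : (3 + i < 6)%N by lia.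
  case=> [|_ /(_ (3 + i)%N i6)].
    split=> [|a a6 Ja]; first exact: basis_pt_neq0.
    by rewrite basis_ptM delta_inord //; case: eqP => // E; move: Ja; rewrite /J; lia.
  rewrite basis_ptM delta_inord // eqxx => h.
  have nJ : ~~ J i (3 + i)%N by rewrite /J; lia.
  by have /eqP := h nJ; rewrite oner_eq0.
split=> [|/(_ (basis_pt 2))]; first exact: JZ.
case=> [|_ /(_ 2 isT)].
  split; first exact: basis_pt_neq0.
  by rewrite basis_ptM /rank3_form !delta_inord //= !(mulr0, mul0r, mulr1, expr0n, subr0).
rewrite basis_ptM delta_inord // eqxx => h.
by have /eqP := h isT; rewrite oner_eq0.
Qed.

Lemma conic_paramP v : v != 0 -> conic v <->
  exists s : 'rV[K]_2, v *m M = \row_(a < 6) (q2 a).@[s 0].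
Proof.
move=> v0; split=> [[_ E Z]|[s E]]; last first.
  split=> //.
    rewrite E /rank3_form !mxE /q2 !inordK //= mevalZ !rmorphXn rmorphM /= !mevalXU; ring.
  move=> a /andP[a2 a6]; rewrite E mxE inordK // /q2.
  by case: a a2 a6 => [|[|[|a]]] //=; rewrite meval0.
move: (v *m M) E Z => y E Z; have [||s [t [y0 y1 y2]]] := @binary_square 2 (y 0 (inord 0)) (y 0 (inord 1)) (y 0 (inord 2)).
- by rewrite pnatr_eq0.
- by rewrite -natrX; apply/subr0_eq; exact: E.
exists (\row_i nth 0 [:: s; t] i).
apply: row6P => a a6; rewrite [RHS]mxE inordK //.
case: a a6 => [|[|[|a]]] a6; rewrite /q2 /= ?mevalZ ?rmorphXn ?rmorphM /= ?mevalXU ?mxE ?inordK //=.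
  by rewrite y1 mulrA.
by rewrite meval0 Z.
Qed.

Lemma conic_closed : pclosed conic.
Proof.
have -> : conic = [set v : 'rV[K]_6 | v != 0 /\ forall F, (F = rank3_poly 4 \/
    exists2 a, (2 < a < 6)%N & F = coord_form M a) -> F.@[v 0] = 0].
  apply/seteqP; split=> v /=.
    move=> [v0 E h]; split=> // F [->|[a a6 ->]]; first by rewrite meval_rank3_poly.
    by rewrite meval_coord_form h.
  move=> [v0 h]; split=> //; first by rewrite -meval_rank3_poly h //; left.
  by move=> a a6; rewrite -meval_coord_form h //; right; exists a.
apply: pclosed_zeros => F [->|[a _ ->]]; first by exists 2; exact: rank3_poly_homog.
by exists 1%N; exact: linear_form_homog.
Qed.

Lemma conic_irr : pirreducible conic.
Proof.
apply: (@pirreducible_param _ _ _ (pulled q2 B)).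
- exists (basis_pt 0); split; first exact: basis_pt_neq0.
    by rewrite basis_ptM /rank3_form !delta_inord //= !(mulr0, expr0n, subr0).
  by move=> a /andP[a2 a6]; rewrite basis_ptM delta_inord // (ltn_eqF (ltn_trans _ a2)).
- exact: conic_closed.
- move=> v Zv; have [v0 _ _] := Zv; have [s E] := (conic_paramP v0).1 Zv.
  by exists s; apply/(pulledP BM MB).
- by move=> s v /(pulledP BM MB) h v0; apply/conic_paramP => //; exists s.
Qed.

Lemma pdim_conic : pdim conic 1.
Proof.
split; last first.
  move=> /(@chain_param_bound _ _ _ (pulled q2 B) _ 2) h; suff : (2 <= 1)%N by [].
  apply: h => [|v Zv].
    apply: pulled_homog => a; rewrite /q2; do 3 ?case: ifP => _; last exact: dhomog0;
      by [apply: (@dhomogMn _ _ _ 1); exact: XU_homog|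
          apply: dhomogZ; apply: (@dhomogM _ _ _ 1 _ 1); exact: XU_homog].
  have [v0 _ _] := Zv; have [s E] := (conic_paramP v0).1 Zv.
  by exists s; apply/(pulledP BM MB).
pose Y i := if i == 0%N then coord_subspace M (pred1 0%N) else conic.
have JZ : coord_subspace M (pred1 0%N) `<=` conic.
  move=> v [v0 h]; split=> //.
    by rewrite /rank3_form !(h 1%N, h 2%N) //= mulr0 expr0n subrr.
  by move=> a /andP[a2 a6]; apply: h => //=; rewrite -lt0n; apply: ltn_trans a2.
exists Y; split=> -[|[|i]] //= _.
- split; last exact: JZ.
  exact: (coord_subspace_irr BM MB (a0 := 0)).
- by split=> //; exact: conic_irr.
split=> [|/(_ (basis_pt 2))]; first exact: JZ.
case=> [|_ /(_ 2 isT)].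
  split; first exact: basis_pt_neq0.
    by rewrite basis_ptM /rank3_form !delta_inord //= !(mulr0, mul0r, mulr1, expr0n, subr0).
  by move=> a /andP[a2 a6]; rewrite basis_ptM delta_inord // (ltn_eqF a2).
rewrite basis_ptM delta_inord // eqxx => h.
by have /eqP := h isT; rewrite oner_eq0.
Qed.

End QuadricCone.

Section DualOfCone.
Context (K : numClosedFieldType) (M B : 'M[K]_6) (BM : B *m M = 1%:M) (MB : M *m B = 1%:M).
Implicit Types (v w z : 'rV[K]_6).
Local Notation Z := (quadric_cone M).

(** The gradient at y of y0 y2 - y1^2. *)
Definition conormal (y : 'rV[K]_6) : 'rV[K]_6 :=
  \row_i nth 0 [:: y 0 (inord 2); - (2 * y 0 (inord 1)); y 0 (inord 0)] i.

Lemma dotr6 (a b : 'rV[K]_6) : dotr a b =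
  a 0 (inord 0) * b 0 (inord 0) + a 0 (inord 1) * b 0 (inord 1)
  + a 0 (inord 2) * b 0 (inord 2) + a 0 (inord 3) * b 0 (inord 3)
  + a 0 (inord 4) * b 0 (inord 4) + a 0 (inord 5) * b 0 (inord 5).
Proof.
rewrite /dotr !big_ord_recl big_ord0 addr0 !addrA.
by do ![congr (_ + _)]; congr (a 0 _ * b 0 _); apply: val_inj; rewrite /= inordK.
Qed.

Lemma dotr_conormal y u : dotr (conormal y) u = y 0 (inord 2) * u 0 (inord 0)
  - 2 * y 0 (inord 1) * u 0 (inord 1) + y 0 (inord 0) * u 0 (inord 2).
Proof. by rewrite dotr6 !mxE !inordK //=; ring. Qed.

Lemma conormal_eq0 (y : 'rV[K]_6) :
  y 0 (inord 0) = 0 -> y 0 (inord 1) = 0 -> y 0 (inord 2) = 0 -> conormal y = 0.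
Proof.
move=> y0 y1 y2; apply: row6P => a a6; rewrite !mxE inordK // y0 y1 y2 mulr0 oppr0.
by case: a a6 => [|[|[|a]]] //= _; rewrite nth_nil.
Qed.

(** Needed because an arc in the affine cone may pass through the origin, which is not in Z. *)
Lemma cone_form0 d (F : {mpoly K[6]}) : F \is d.-homog -> vanishes_on F Z -> F.@[(0 : 'rV[K]_6) 0] = 0.
Proof.
move=> hF FZ; have [[v Zv] _ _] := quadric_cone_irr BM MB.
case: d hF => [|d] hF; last by rewrite -(scale0r v) (dhomog_scale _ _ hF) expr0n mul0r.
by have := FZ v Zv; rewrite (dhomog0_const hF) !mevalC.
Qed.

(** Velocities of arcs are tangent whatever forms vanish on Z, so the ideal of Z need not be
    determined. *)
Lemma tangent_arc (y : nat -> {poly K}) z v :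
    (forall e, (y 0%N).[e] * (y 2).[e] = (y 1%N).[e] ^+ 2) ->
    (forall a, (a < 6)%N -> (y a).[0] = (z *m M) 0 (inord a)) ->
    (forall a, (a < 6)%N -> (y a)^`().[0] = (v *m M) 0 (inord a)) ->
  tangent Z z v.
Proof.
move=> yq yz yv d F hF FZ.
pose h (i : 'I_6) : {poly K} := \sum_(a < 6) B a i *: y a.
have hE e i : (h i).[e] = ((\row_(a < 6) (y a).[e]) *m B) 0 i.
  by rewrite /h horner_sum mxE; apply: eq_bigr => a _; rewrite hornerZ mxE mulrC.
have hM (u : 'rV[K]_6) : u = u *m M *m B by rewrite -mulmxA MB mulmx1.
have h0 i : (h i).[0] = z 0 i.
  rewrite hE [z]hM; congr (fun_of_matrix (_ *m B) 0 i); apply: row6P => a a6.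
  by rewrite mxE inordK // yz.
have hd i : (h i)^`().[0] = v 0 i.
  rewrite [v]hM /h linear_sum horner_sum [RHS]mxE; apply: eq_bigr => a _.
  by rewrite /= derivZ hornerZ mulrC yv // inord_val.
have [|_] := @curve_tangent _ _ h F.
  move=> e _; rewrite (meval_eq _ (hE e)).
  set w := _ *m B; have [->|w0] := eqVneq w 0; first exact: cone_form0 hF FZ.
  apply: FZ; split=> //; rewrite /w -mulmxA BM mulmx1 /rank3_form !mxE !inordK // mul1r yq subrr //.
move=> E; rewrite -[RHS]E; apply: eq_bigr => i _; rewrite hd; congr (_ * _).
by apply: meval_eq => j; rewrite h0.
Qed.

Lemma tangent_cone_sub z v : tangent Z z v -> dotr (conormal (z *m M)) (v *m M) = 0.
Proof.
move=> /(_ 2 (rank3_poly M 1) (rank3_poly_homog M 1)) h.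
have /h : vanishes_on (rank3_poly M 1) Z by move=> u [_ uZ]; rewrite meval_rank3_poly.
under eq_bigr do rewrite mulrC; rewrite -meval_dird => E.
rewrite -[RHS]E /rank3_poly linearB linearZ /= expr2 !dirdM.
have dl a : dird v (coord_form M a) = ((v *m M) 0 (inord a))%:MP.
  rewrite /coord_form /linear_form (linear_sum (dird v)) /= mxE rmorph_sum.
  apply: eq_bigr => j _; rewrite linearZ /= dirdXU -mul_mpolyC -mpolyCM !mxE mulrC //.
rewrite !dl mevalB mevalZ !mevalD !mevalM !mevalC !meval_coord_form dotr_conormal; ring.
Qed.

Lemma tangent_cone_smooth z v : Z z -> conormal (z *m M) != 0 ->
  dotr (conormal (z *m M)) (v *m M) = 0 -> tangent Z z v.
Proof.
move=> [z0 zZ] cn; rewrite dotr_conormal.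
have [||s [t [y0 y1 y2]]] := @binary_square K 1 ((z *m M) 0 (inord 0)) ((z *m M) 0 (inord 1)) ((z *m M) 0 (inord 2)).
- exact: oner_neq0.
- by rewrite expr1n; apply/subr0_eq; exact: zZ.
rewrite mul1r in y1; rewrite y0 y1 y2 => E.
(* Lifts the first three coordinates of the tangent vector through the differential of (s, t) |->
   (s^2, s t, t^2). This is possible because s and t are not both zero. *)
have [s' [t' [E0 E1 E2]]] : exists s' t', [/\ 2 * s * s' = (v *m M) 0 (inord 0),
    s * t' + s' * t = (v *m M) 0 (inord 1) & 2 * t * t' = (v *m M) 0 (inord 2)].
  move: E; move: ((v *m M) 0 (inord 0)) ((v *m M) 0 (inord 1)) ((v *m M) 0 (inord 2)) => u0 u1 u2 E.
  have [s0|s0] := eqVneq s 0.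
    have t0 : t != 0.
      apply: contra cn => /eqP t0; apply/eqP/conormal_eq0.
      - by rewrite y0 s0 expr0n.
      - by rewrite y1 s0 mul0r.
      - by rewrite y2 t0 expr0n.
    move: E; rewrite s0 expr0n !(mul0r, mulr0, addr0, subr0) => /eqP.
    rewrite mulf_eq0 expf_eq0 (negPf t0) /= => /eqP u00.
    exists (u1 / t), (u2 / (2 * t)); rewrite u00 !(mul0r, mulr0, add0r); split=> //.
      by rewrite mulfVK.
    by rewrite mulrC mulfVK // mulf_neq0 // pnatr_eq0.
  exists (u0 / (2 * s)), ((u1 - u0 / (2 * s) * t) / s); split.
  - by rewrite mulrC mulfVK // mulf_neq0 // pnatr_eq0.
  - by field.
  have -> : u2 = (2 * (s * t) * u1 - t ^+ 2 * u0) / s ^+ 2.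
    apply: (mulfI (_ : s ^+ 2 != 0)); first by rewrite expf_neq0.
    rewrite mulrC [RHS]mulrC mulfVK ?expf_neq0 //; apply/eqP; rewrite -subr_eq0 -E; apply/eqP; ring.
  by field.
pose ln (a b : K) : {poly K} := a%:P + b *: 'X.
have ln0 a b : (ln a b).[0] = a by rewrite hornerD hornerC hornerZ hornerX mulr0 addr0.
have lnd a b : (ln a b)^`().[0] = b.
  by rewrite derivD derivC add0r derivZ derivX hornerZ hornerC mulr1.
pose y a := nth 0 [:: ln s s' ^+ 2; ln s s' * ln t t'; ln t t' ^+ 2;
   ln ((z *m M) 0 (inord 3)) ((v *m M) 0 (inord 3));
   ln ((z *m M) 0 (inord 4)) ((v *m M) 0 (inord 4));
   ln ((z *m M) 0 (inord 5)) ((v *m M) 0 (inord 5))] a.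
apply: (@tangent_arc y).
- by move=> e; rewrite /y /= !(horner_exp, hornerM); ring.
- move=> a a6; case: a a6 => [|[|[|[|[|[|//]]]]]] _; rewrite /y /= ?horner_exp ?hornerM !ln0 ?y0 ?y1 ?y2 //.
- move=> a a6; case: a a6 => [|[|[|[|[|[|//]]]]]] _; rewrite /y /= ?lnd // ?expr2 ?derivM ?hornerD ?hornerM !ln0 !lnd.
  + by rewrite -E0; ring.
  + by rewrite -E1; ring.
  + by rewrite -E2; ring.
Qed.

Lemma tangentD z u v : tangent Z z u -> tangent Z z v -> tangent Z z (u + v).
Proof.
move=> hu hv d F hF FZ; have hu' := hu d F hF FZ; have hv' := hv d F hF FZ.
transitivity (\sum_i (F^`M(i)).@[z 0] * u 0 i + \sum_i (F^`M(i)).@[z 0] * v 0 i).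
  by rewrite -big_split; apply: eq_bigr => i _; rewrite mxE mulrDr.
by rewrite hu' hv' addr0.
Qed.

Lemma tangentZ z c u : tangent Z z u -> tangent Z z (c *: u).
Proof.
move=> hu d F hF FZ; transitivity (c * \sum_i (F^`M(i)).@[z 0] * u 0 i).
  by rewrite mulr_sumr; apply: eq_bigr => i _; rewrite mxE mulrCA.
by rewrite (hu d F hF FZ) mulr0.
Qed.

(* Every vector is tangent along the vertex because the tangent cone there,
   the whole cone, spans. *)
Lemma tangent_cone_vertex z : Z z -> conormal (z *m M) = 0 -> forall v, tangent Z z v.
Proof.
move=> [z0 zZ] cn v.
have y2 : (z *m M) 0 (inord 2) = 0.
  by have /rowP/(_ (inord 0)) := cn; rewrite [LHS]mxE inordK //= [RHS]mxE.
have y0 : (z *m M) 0 (inord 0) = 0.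
  by have /rowP/(_ (inord 2)) := cn; rewrite [LHS]mxE inordK //= [RHS]mxE.
have y1 : (z *m M) 0 (inord 1) = 0.
  by move: zZ; rewrite /rank3_form y0 y2 mulr0 sub0r => /eqP; rewrite oppr_eq0 sqrf_eq0 => /eqP.
have line w : (w *m M) 0 (inord 0) * (w *m M) 0 (inord 2) = (w *m M) 0 (inord 1) ^+ 2 -> tangent Z z w.
  move=> wq; apply: (@tangent_arc (fun a => ((z *m M) 0 (inord a))%:P + (w *m M) 0 (inord a) *: 'X)).
  - by move=> e; rewrite !hornerE y0 y1 y2 !add0r mulrACA wq; ring.
  - by move=> a a6; rewrite hornerD hornerC hornerZ hornerX mulr0 addr0.
  - by move=> a a6; rewrite derivD derivC add0r derivZ derivX hornerZ hornerC mulr1.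
have b (u : 'rV[K]_6) : u 0 (inord 0) * u 0 (inord 2) = u 0 (inord 1) ^+ 2 -> tangent Z z (u *m B).
  by move=> uq; apply: line; rewrite -mulmxA BM mulmx1.
(* v is split into three vectors of the cone: a multiple of (1, 1, 1, 0, 0, 0), one along axis 0,
   and one with y0 = y1 = 0. *)
pose e01 : 'rV[K]_6 := \row_i nth 0 [:: 1; 1; 1] i.
pose u0 := v *m M - (v *m M) 0 (inord 1) *: e01.
have e1 : u0 0 (inord 1) = 0 by rewrite /u0 [LHS]mxE [X in _ + X]mxE [X in _ - X]mxE [e01 _ _]mxE inordK //= mulr1 subrr.
pose p0 := u0 0 (inord 0) *: (delta_mx 0 (inord 0) : 'rV[K]_6).
have -> : v = p0 *m B + (u0 - p0) *m B + (v *m M) 0 (inord 1) *: (e01 *m B).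
  by rewrite -mulmxDl [p0 + _]addrC subrK scalemxAl -mulmxDl subrK -mulmxA MB mulmx1.
apply: tangentD; last by apply/tangentZ/b; rewrite !mxE !inordK //= mulr1 expr1n.
apply: tangentD; apply: b.
  by rewrite /p0 !mxE -!(inj_eq val_inj) /= !inordK //= !(mulr0, expr0n).
rewrite /p0; clearbody u0; rewrite !mxE e1 -!(inj_eq val_inj) /= !inordK //=.
by rewrite mulr1 subrr mul0r mulr0 subrr expr0n.
Qed.

(** Covectors transform contragrediently, hence B^T. Vertex points have the whole space as tangent
    space and contribute no hyperplane; elsewhere the hyperplane is the conormal, so the tangent
    hyperplanes already form a closed set. *)
Lemma dual_quadric_cone : dual_variety Z = conic B^T.
Proof.
have uB : B^T *m M^T = 1%:M by rewrite -trmx_mul MB trmx1.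
have uM : M^T *m B^T = 1%:M by rewrite -trmx_mul BM trmx1.
rewrite -[RHS](conic_closed B^T); congr pclosure.
have dw (w v : 'rV[K]_6) : \sum_i w 0 i * v 0 i = dotr (w *m B^T) (v *m M).
  by rewrite dotrC dotr_mulmx -mulmxA -trmx_mul MB trmx1 mulmx1 dotrC.
apply/seteqP; split=> w /=.
  move=> [w0 [z [Zz _] ht]].
  have [cn0|cn] := eqVneq (conormal (z *m M)) 0.
    case/eqP: w0; apply: dotr_eq0 => v; rewrite -[RHS](ht v) //.
    exact: tangent_cone_vertex.
  have [e we] : exists e, w *m B^T = e *: conormal (z *m M).
    apply: hyperplane_covector => u cu; have := dw w (u *m B).
    rewrite -mulmxA BM mulmx1 => <-; apply: ht; apply: tangent_cone_smooth => //.
    by rewrite -mulmxA BM mulmx1.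
  have [_ zZ] := Zz; split=> //.
    rewrite we /rank3_form; move: zZ; rewrite /rank3_form; move: (z *m M) => y yZ.
    rewrite !mxE !inordK //=.
    transitivity (4 * e ^+ 2 * (1 * y 0 (inord 0) * y 0 (inord 2) - y 0 (inord 1) ^+ 2)); first by ring.
    by rewrite yZ mulr0.
  move=> a /andP[a2 a6]; rewrite we !mxE inordK //.
  by case: a a2 a6 => [|[|[|a]]] //= _ _; rewrite nth_nil mulr0.
move=> [w0 wC w345]; split=> //.
move: (mulM_neq0 uB w0) wC w345 (dw w); move: (w *m B^T) => a a0 aC a345 dwa.
(* A preimage of a under the conormal map. *)
pose y : 'rV[K]_6 := \row_i nth 0 [:: a 0 (inord 2); - (a 0 (inord 1) / 2); a 0 (inord 0)] i.
have cy : conormal y = a.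
  apply: row6P => b b6; rewrite !mxE !inordK //=.
  case: b b6 => [|[|[|b]]] //= b6; first by field.
  by rewrite nth_nil a345.
have yn0 : y != 0.
  by apply: contra a0 => /eqP y0; rewrite -cy conormal_eq0 ?y0 ?mxE.
have yM : y *m B *m M = y by rewrite -mulmxA BM mulmx1.
have Zz : Z (y *m B).
  split; first by apply: mulB_neq0 BM _ yn0.
  rewrite yM /rank3_form !mxE !inordK //=; move: aC; rewrite /rank3_form => aC.
  transitivity (4^-1 * (4 * a 0 (inord 0) * a 0 (inord 2) - a 0 (inord 1) ^+ 2)); first by field.
  by rewrite aC mulr0.
exists (y *m B); last first.
  by move=> v /tangent_cone_sub; rewrite yM cy dwa.
split=> //; exists 4%N; first exact: pdim_quadric_cone BM MB.
have tE : tangent Z (y *m B) = [set v : 'rV[K]_6 | dotr (a *m M^T) v = 0].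
  apply/seteqP; split=> v /=.
    by move/tangent_cone_sub; rewrite yM cy dotr_mulmx trmxK.
  by move=> av; apply: tangent_cone_smooth => //; rewrite yM cy // -[M]trmxK -dotr_mulmx.
rewrite tE; apply: has_dim_hyperplane.
exact: mulM_neq0 uM _ a0.
Qed.

End DualOfCone.

(** * A dense orbit in the minimal family *)

Section StandardPerazzo.
Context (K : numClosedFieldType) (g : cubic K) (N : 'M[K]_6) (uN : N \in unitmx).
Local Notation f := (mpoly_of_dhomog (form_of g)).
Hypothesis gN : forall x : 'rV[K]_6, f.@[x 0] = perazzo_std (x *m N).
Implicit Types (x y v w : 'rV[K]_6).
Let M := (invmx N)^T.
Let B := N^T.
Let hf : f \is 3.-homog := dhomogP3 (form_of g).
Let ts : symt (polar_coef f) := polar_coef_sym f.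
Local Notation bil := (bil (polar_coef f)).

Let BM : B *m M = 1%:M. Proof. by rewrite -trmx_mul mulVmx // trmx1. Qed.
Let MB : M *m B = 1%:M. Proof. by rewrite -trmx_mul mulmxV // trmx1. Qed.

Definition grad_std y : 'rV[K]_6 := \row_i nth 0
  [:: y 0 (inord 4) ^+ 2; y 0 (inord 4) * y 0 (inord 5); y 0 (inord 5) ^+ 2;
      3 * y 0 (inord 3) ^+ 2;
      2 * y 0 (inord 0) * y 0 (inord 4) + y 0 (inord 1) * y 0 (inord 5);
      y 0 (inord 1) * y 0 (inord 4) + 2 * y 0 (inord 2) * y 0 (inord 5)] i.

Lemma dotr_grad_std y z : dotr (grad_std y) z =
  y 0 (inord 4) ^+ 2 * z 0 (inord 0) + y 0 (inord 4) * y 0 (inord 5) * z 0 (inord 1)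
  + y 0 (inord 5) ^+ 2 * z 0 (inord 2) + 3 * y 0 (inord 3) ^+ 2 * z 0 (inord 3)
  + (2 * y 0 (inord 0) * y 0 (inord 4) + y 0 (inord 1) * y 0 (inord 5)) * z 0 (inord 4)
  + (y 0 (inord 1) * y 0 (inord 4) + 2 * y 0 (inord 2) * y 0 (inord 5)) * z 0 (inord 5).
Proof. by rewrite dotr6 !mxE !inordK. Qed.

Lemma perazzo_std_expand y z (c : K) : perazzo_std (y + c *: z) =
  perazzo_std y + c * dotr (grad_std y) z + c ^+ 2 * dotr (grad_std z) y + c ^+ 3 * perazzo_std z.
Proof.
by rewrite !dotr_grad_std /perazzo_std !mxE; ring.
Qed.

(** Both sides are read off as the coefficient of c in f(x + c w), isolated by taking c = 1 and c =
    -1 and subtracting the cubic term. *)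
Lemma grad_pullback x : grad f x = grad_std (x *m N) *m B.
Proof.
have half : (2 : K) != 0 by rewrite pnatr_eq0.
apply/subr0_eq/dotr_eq0 => w; rewrite dotrDl dotrNl dotr_mulmx /B trmxK.
rewrite (grad_bil hf) dotrZl.
have T (c : K) : 6^-1 * dotr (bil (x + c *: w) (x + c *: w)) (x + c *: w)
    = perazzo_std (x *m N + c *: (w *m N)).
  by rewrite -(meval_cubic hf) gN mulmxDl scalemxAl.
have E c : dotr (bil (x + c *: w) (x + c *: w)) (x + c *: w)
    = dotr (bil x x) x + 3 * c * dotr (bil x x) w + 3 * c ^+ 2 * dotr (bil w w) x + c ^+ 3 * dotr (bil w w) w.
  rewrite !(bilDl ts) !bilDr !(bilZl ts) !bilZr !dotrDl !dotrDr !dotrZl !dotrZr.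
  rewrite !(bilC ts w x) [dotr (bil x w) x](dotr_bilC ts).
  have -> : dotr (bil x w) w = dotr (bil w w) x by rewrite (bilC ts) (dotr_bilC ts).
  by ring.
have h1 := T 1; have h2 := T (-1); move: h1 h2; rewrite !E !perazzo_std_expand.
set a := dotr (bil x x) w; set b := dotr _ (w *m N) => h1 h2.
have Tw : 6^-1 * dotr (bil w w) w = perazzo_std (w *m N) by rewrite -(meval_cubic hf) gN.
apply: (mulfI half); rewrite mulr0.
transitivity (6^-1 * (dotr (bil x x) x + 3 * 1 * a + 3 * 1 ^+ 2 * dotr (bil w w) x + 1 ^+ 3 * dotr (bil w w) w)
  - 6^-1 * (dotr (bil x x) x + 3 * -1 * a + 3 * (-1) ^+ 2 * dotr (bil w w) x + (-1) ^+ 3 * dotr (bil w w) w)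
  - 2 * (6^-1 * dotr (bil w w) w) - 2 * b); first by field.
rewrite h1 h2 Tw; ring.
Qed.

Lemma polar_bil_std x w : 2^-1 * dotr (bil x x) w = dotr (grad_std (x *m N)) (w *m N).
Proof. by rewrite -dotrZl -(grad_bil hf) grad_pullback dotr_mulmx /B trmxK. Qed.

Lemma hess_perazzo : hess f = 0.
Proof.
have invK v : v *m invmx N *m N = v by rewrite mulmxKV.
have g0 : coord_form N 4 != 0.
  apply/eqP => c0; have := meval_coord_form N 4 (delta_mx 0 (inord 4) *m invmx N).
  by rewrite c0 meval0 invK delta_inord // eqxx => /esym/eqP; rewrite oner_eq0.
apply: (mpoly_zero_generic g0) => x; rewrite meval_coord_form (meval_hess hf) => y4.
move: (polar_bil_std x) y4; move yE : (x *m N) => y Ty y4.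
(* Differentiating the relation g0 g2 = g1^2 between the partials y4^2, y4 y5, y5^2 gives this
   kernel vector of the Hessian matrix, nonzero where y4 is. *)
pose k : 'rV[K]_6 := \row_i nth 0 [:: y 0 (inord 5) ^+ 2; - (2 * y 0 (inord 4) * y 0 (inord 5)); y 0 (inord 4) ^+ 2] i.
have k0 : k *m invmx N != 0.
  apply/eqP => h; have := invK k; rewrite h mul0mx => /rowP/(_ (inord 2)).
  rewrite !mxE inordK //= => /esym/eqP; rewrite sqrf_eq0; exact/negP.
apply/eqP/det0P; exists (k *m invmx N) => //.
rewrite mul_bilmx; apply: dotr_eq0 => w.
have := polar_bil_std (x + k *m invmx N) w; have := polar_bil_std (k *m invmx N) w; have := Ty w.
rewrite !mulmxDl invK yE; move: (w *m N) => z h1 h2.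
rewrite (bilDl ts) !bilDr !dotrDl (bilC ts (k *m invmx N) x).
rewrite !mulrDr h1 h2 => h3.
transitivity (dotr (grad_std (y + k)) z - dotr (grad_std y) z - dotr (grad_std k) z).
  by rewrite -h3; field.
have kE a : (a < 6)%N -> k 0 (inord a) = nth 0 [:: y 0 (inord 5) ^+ 2;
    - (2 * y 0 (inord 4) * y 0 (inord 5)); y 0 (inord 4) ^+ 2] a.
  by move=> a6; rewrite mxE inordK.
have ykE a : (y + k) 0 (inord a) = y 0 (inord a) + k 0 (inord a) by rewrite mxE.
by rewrite !dotr_grad_std !ykE !kE //=; ring.
Qed.

(** A vertex u satisfies grad(y).u = 0 at every zero y of the cubic, by comparing y + u with y - u.
    Six explicit zeros then kill its coordinates one at a time. *)
Lemma perazzo_not_cone : ~ is_cone f.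
Proof.
move=> [v v0 hv]; pose u := v *m N.
have un0 : u != 0 by apply: contra v0 => /eqP u0; rewrite -(mulmxK uN v) -/u u0 mul0mx.
have hy y s t : perazzo_std y = 0 -> perazzo_std (t *: y + s *: u) = 0.
  move=> y0; have := hv (y *m invmx N); rewrite gN mulmxKV // => /(_ y0 s t).
  by rewrite gN mulmxDl -!scalemxAl mulmxKV // addrC.
have std0 : perazzo_std (0 : 'rV[K]_6) = 0.
  have z i : (0 : 'rV[K]_6) 0 i = 0 by rewrite mxE.
  by rewrite /perazzo_std !z; ring.
have u_std : perazzo_std u = 0.
  by have := hy 0 1 1 std0; rewrite scaler0 add0r scale1r.
have gu y : perazzo_std y = 0 -> dotr (grad_std y) u = 0.
  move=> y0; have h s : perazzo_std (y + s *: u) = 0 by have := hy y s 1 y0; rewrite scale1r.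
  move: (h 1) (h (-1)); rewrite !perazzo_std_expand y0 u_std => h1 h2.
  have two : (2 : K) != 0 by rewrite pnatr_eq0.
  apply: (mulfI two); rewrite mulr0; move: h1 h2; set p := dotr _ u; set q := dotr _ y => h1 h2.
  transitivity (0 + 1 * p + 1 ^+ 2 * q + 1 ^+ 3 * 0 - (0 + -1 * p + (-1) ^+ 2 * q + (-1) ^+ 3 * 0)); first by ring.
  by rewrite h1 h2 subrr.
pose pt (l : seq K) : 'rV[K]_6 := \row_i nth 0 l i.
have ptE l a : (a < 6)%N -> pt l 0 (inord a) = nth 0 l a by move=> a6; rewrite mxE inordK.
have G l : perazzo_std (pt l) = 0 -> dotr (grad_std (pt l)) u = 0 by exact: gu.
have E (l : seq K) : perazzo_std (pt l) = 0 ->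
   nth 0 l 4 ^+ 2 * u 0 (inord 0) + nth 0 l 4 * nth 0 l 5 * u 0 (inord 1)
   + nth 0 l 5 ^+ 2 * u 0 (inord 2) + 3 * nth 0 l 3 ^+ 2 * u 0 (inord 3)
   + (2 * nth 0 l 0 * nth 0 l 4 + nth 0 l 1 * nth 0 l 5) * u 0 (inord 4)
   + (nth 0 l 1 * nth 0 l 4 + 2 * nth 0 l 2 * nth 0 l 5) * u 0 (inord 5) = 0.
  by move=> /gu; rewrite dotr_grad_std !ptE.
have stdE l : perazzo_std (pt l) = nth 0 l 0 * nth 0 l 4 ^+ 2 + nth 0 l 1 * nth 0 l 4 * nth 0 l 5
   + nth 0 l 2 * nth 0 l 5 ^+ 2 + nth 0 l 3 ^+ 3 by rewrite /perazzo_std !ptE.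
have u0 : u 0 (inord 0) = 0.
  have := E [:: 0; 0; 0; 0; 1; 0]; rewrite stdE /= => h; rewrite -[RHS]h; ring.
have u5 : u 0 (inord 5) = 0.
  have := E [:: 0; 1; 0; 0; 1; 0]; rewrite stdE /= u0 => h; rewrite -[RHS]h; ring.
have u2 : u 0 (inord 2) = 0.
  have := E [:: 0; 0; 0; 0; 0; 1]; rewrite stdE /= => h; rewrite -[RHS]h; ring.
have u4 : u 0 (inord 4) = 0.
  have := E [:: 0; 1; 0; 0; 0; 1]; rewrite stdE /= u2 => h; rewrite -[RHS]h; ring.
have u1 : u 0 (inord 1) = 0.
  have := E [:: 0; 0; 0; 0; 1; 1]; rewrite stdE /= u0 u2 => h; rewrite -[RHS]h; ring.
have u3 : u 0 (inord 3) = 0.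
  have three : (3 : K) != 0 by rewrite pnatr_eq0.
  apply: (mulfI three).
  have := E [:: -1; 0; 0; 1; 1; 0]; rewrite stdE /= u0 u4 u5 => h; rewrite mulr0 -[RHS]h; ring.
case/eqP: un0; apply: row6P => a a6; rewrite [RHS]mxE.
by case: a a6 => [|[|[|[|[|[|//]]]]]].
Qed.

Lemma polar_image_perazzo : polar_image f = quadric_cone M.
Proof.
have gM p : grad f p *m M = grad_std (p *m N) by rewrite grad_pullback -mulmxA BM mulmx1.
have gZ p : rank3_form 1 (grad_std p) = 0.
  rewrite /rank3_form !mxE !inordK //=; ring.
apply/seteqP; split=> v.
  move=> [v0 h]; split=> //; rewrite -meval_rank3_poly.
  apply: (h 2 _ (rank3_poly_homog M 1)) => w [_ [p _ ->]].
  by rewrite meval_rank3_poly gM gZ.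
move=> [v0 vZ]; split=> // d F hF van.
have two : (2 : K) != 0 by rewrite pnatr_eq0.
have three : (3 : K) != 0 by rewrite pnatr_eq0.
(* Off y0 = y2 = 0 a point of the quadric is itself a gradient: s, t and p3 come from square roots,
   and the last two equations are linear in the first three coordinates of p. *)
have main w : w != 0 -> rank3_form 1 (w *m M) = 0 ->
    (w *m M) 0 (inord 0) != 0 \/ (w *m M) 0 (inord 2) != 0 -> F.@[w 0] = 0.
  move=> w0 wZ wn; apply: van; split=> //.
  have [p pE] : exists p, grad_std p = w *m M.
    move: (w *m M) wZ wn => y yZ yn.
    have [||s [t [y0 y1 y2]]] := @binary_square K 1 (y 0 (inord 0)) (y 0 (inord 1)) (y 0 (inord 2)).
    - exact: oner_neq0.
    - by rewrite expr1n; apply/subr0_eq; exact: yZ.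
    pose p3 := sqrtC (y 0 (inord 3) / 3).
    have p3E : 3 * p3 ^+ 2 = y 0 (inord 3) by rewrite sqrtCK mulrC mulfVK.
    pose P a b c := \row_i nth 0 [:: a; b; c; p3; s; t] i : 'rV[K]_6.
    have PE a b c : 2 * a * s + b * t = y 0 (inord 4) -> b * s + 2 * c * t = y 0 (inord 5) ->
        grad_std (P a b c) = y.
      move=> h4 h5; apply: row6P => i i6; rewrite [LHS]mxE inordK //.
      by case: i i6 => [|[|[|[|[|[|//]]]]]] _; rewrite /= !mxE !inordK //= ?y0 ?y1 ?y2 ?mul1r.
    have [s0|s0] := eqVneq s 0.
      have t0 : t != 0.
        by case: yn; rewrite ?y0 ?y2 ?s0 ?expr0n ?eqxx //= expf_eq0.
      exists (P 0 (y 0 (inord 4) / t) (y 0 (inord 5) / (2 * t))); apply: PE.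
        by rewrite mulr0 mul0r add0r mulfVK.
      by rewrite s0 mulr0 add0r; field; rewrite t0.
    exists (P ((y 0 (inord 4) - y 0 (inord 5) / s * t) / (2 * s)) (y 0 (inord 5) / s) 0); apply: PE.
      by field; rewrite s0.
    by rewrite mulr0 mul0r addr0 mulfVK.
  have gp : w = grad f (p *m invmx N).
    by rewrite grad_pullback mulmxKV // pE -mulmxA MB mulmx1.
  exists (p *m invmx N) => //; apply: contra w0 => /eqP p0.
  rewrite gp p0 grad_pullback mul0mx; apply/eqP.
  suff -> : grad_std 0 = 0 by rewrite mul0mx.
  by apply: row6P => i i6; rewrite !mxE inordK //; case: i i6 => [|[|[|[|[|[|//]]]]]] _ /=; ring.
have [y0|y0] := eqVneq ((v *m M) 0 (inord 0)) 0; last by apply: main => //; left.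
have [y2|y2] := eqVneq ((v *m M) 0 (inord 2)) 0; last by apply: main => //; right.
have y1 : (v *m M) 0 (inord 1) = 0.
  by move: vZ; rewrite /rank3_form y0 y2 mulr0 sub0r => /eqP; rewrite oppr_eq0 sqrf_eq0 => /eqP.
(* The remaining points have y0 = y1 = y2 = 0 and are limits of v + e d0, which stays on the quadric
   with y0 = e. *)
pose d0 : 'rV[K]_6 := delta_mx 0 (inord 0) *m B.
have d0M : d0 *m M = delta_mx 0 (inord 0) by rewrite -mulmxA BM mulmx1.
pose h (i : 'I_6) : {poly K} := (v 0 i)%:P + d0 0 i *: 'X.
have hE e i : (h i).[e] = (v + e *: d0) 0 i.
  by rewrite /h hornerD hornerC hornerZ hornerX [RHS]mxE [X in _ = _ + X]mxE mulrC.
have [|h0 _] := @curve_tangent _ _ h F.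
  move=> e e0; rewrite (meval_eq _ (hE e)).
  have W a : ((v + e *: d0) *m M) 0 (inord a)
      = (v *m M) 0 (inord a) + e * (delta_mx 0 (inord 0) : 'rV[K]_6) 0 (inord a).
    by rewrite mulmxDl -scalemxAl d0M [LHS]mxE [X in _ + X]mxE.
  have E0 : ((v + e *: d0) *m M) 0 (inord 0) = e.
    by rewrite W y0 add0r delta_inord // mulr1.
  apply: main; last by left; rewrite E0.
    by apply: contraTneq e0 => z; rewrite -E0 z mul0mx mxE eqxx.
  by rewrite /rank3_form !W !delta_inord //= y1 y2 !(mulr0, addr0) expr0n subrr.
rewrite -[RHS]h0; apply: meval_eq => i.
by rewrite hE scale0r addr0.
Qed.

Lemma perazzo_minimal : minimal_family K g.
Proof.
split; first exact: hess_perazzo.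
- exact: perazzo_not_cone.
- by rewrite polar_image_perazzo; exists 4%N => //; exact: pdim_quadric_cone BM MB.
rewrite polar_image_perazzo (dual_quadric_cone BM MB).
have uB : B^T *m M^T = 1%:M by rewrite -trmx_mul MB trmx1.
have uM : M^T *m B^T = 1%:M by rewrite -trmx_mul BM trmx1.
exact: pdim_conic uM uB.
Qed.

End StandardPerazzo.

(** * Normal forms are limits of members of the minimal family *)

Section CompleteTheCube.
Context (K : numClosedFieldType).
Local Notation polar f := (polar_coef (mpoly_of_dhomog f)).

Lemma in_closure_minimal (f : dhomog 6 K 3) (N : 'M[K]_6) : N \in unitmx ->
  (forall x : 'rV[K]_6, (f : {mpoly K[6]}).@[x 0] = perazzo_std (x *m N)) -> in_closure f.
Proof.
move=> uN fN; have fn0 : f != 0.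
  apply/eqP => f0; have := fN (delta_mx 0 (inord 3) *m invmx N).
  rewrite mulmxKV // f0 meval0 /perazzo_std !mxE !eqxx /=.
  rewrite -!(inj_eq val_inj) /= !inordK //= => /eqP.
  by rewrite !(mulr0, mul0r, expr0n, expr1n, add0r) /= eq_sym oner_eq0.
move=> d F hF; apply; exists (PPoint fn0) => //.
exact: (@perazzo_minimal K (PPoint fn0) N uN fN).
Qed.

Lemma row6E (v : 'rV[K]_6) (N : 'M[K]_6) : v *m N =
  v 0 (inord 0) *: row (inord 0) N + v 0 (inord 1) *: row (inord 1) N
  + v 0 (inord 2) *: row (inord 2) N + v 0 (inord 3) *: row (inord 3) N
  + v 0 (inord 4) *: row (inord 4) N + v 0 (inord 5) *: row (inord 5) N.
Proof.
rewrite mulmx_sum_row !big_ord_recl big_ord0 addr0 /= !addrA.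
by do ![congr (_ + _)]; congr (v 0 _ *: row _ N); apply: val_inj; rewrite /= inordK.
Qed.

Lemma in_closure_normal_form (f : dhomog 6 K 3) (E : 'M[K]_6) : E \in unitmx ->
  (forall v w : 'rV[K]_6,
  [/\ dotr (bil (polar f) (row (inord 0) E) (v *m E)) (w *m E)
        = 2 * (v 0 (inord 4) * w 0 (inord 4)),
      dotr (bil (polar f) (row (inord 1) E) (v *m E)) (w *m E)
        = v 0 (inord 4) * w 0 (inord 5) + v 0 (inord 5) * w 0 (inord 4) &
      dotr (bil (polar f) (row (inord 2) E) (v *m E)) (w *m E)
        = 2 * (v 0 (inord 5) * w 0 (inord 5))]) ->
  in_closure f.
Proof.
move=> uE TE; have ts : symt (polar f) := polar_coef_sym _.
pose T u v w := dotr (bil (polar f) u v) w.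
pose e i := row (inord i) E.
have TC12 u v w : T u v w = T v u w by rewrite /T (bilC ts).
have TC23 u v w : T u v w = T u w v by rewrite /T (dotr_bilC ts).
have TD a b u v w : T (a *: u + b) v w = a * T u v w + T b v w.
  by rewrite /T (bilDl ts) (bilZl ts) dotrDl dotrZl.
pose p (v : 'rV[K]_6) := v 0 (inord 0) *: e 0%N + v 0 (inord 1) *: e 1%N + v 0 (inord 2) *: e 2%N : 'rV[K]_6.
pose q (v : 'rV[K]_6) := v 0 (inord 3) *: e 3%N + v 0 (inord 4) *: e 4%N + v 0 (inord 5) *: e 5%N : 'rV[K]_6.
pose qc (v : 'rV[K]_6) : 'rV[K]_6 := \row_i (if (i < 3)%N then 0 else v 0 i).
have qcE v : q v = qc v *m E.
  by rewrite (row6E (qc v)) !mxE !inordK //= !scale0r !add0r.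
have vE (v : 'rV[K]_6) : v *m E = p v + q v by rewrite (row6E) /p /q !addrA.
pose P (v : 'rV[K]_6) := v 0 (inord 0) * v 0 (inord 4) ^+ 2
   + v 0 (inord 1) * v 0 (inord 4) * v 0 (inord 5) + v 0 (inord 2) * v 0 (inord 5) ^+ 2.
(* Only coordinates 4 and 5 of the other two arguments matter. Hence expanding T(p + q, p + q, p +
   q) one slot at a time gives 3 times 2 P(v) and the cubic in q alone. *)
have Tp (v a b : 'rV[K]_6) : a 0 (inord 4) = v 0 (inord 4) -> a 0 (inord 5) = v 0 (inord 5) ->
    b 0 (inord 4) = v 0 (inord 4) -> b 0 (inord 5) = v 0 (inord 5) ->
    T (p v) (a *m E) (b *m E) = 2 * P v.
  move=> a4 a5 b4 b5; have [h0 h1 h2] := TE a b.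
  rewrite /p -addrA TD TD -[v 0 _ *: e 2%N]addr0 TD /T h0 h1 h2 (bil0l ts) dotr0l a4 a5 b4 b5 /P; ring.
have q4 (v : 'rV[K]_6) : qc v 0 (inord 4) = v 0 (inord 4) by rewrite mxE inordK.
have q5 (v : 'rV[K]_6) : qc v 0 (inord 5) = v 0 (inord 5) by rewrite mxE inordK.
have fE (v : 'rV[K]_6) : 6 * (f : {mpoly K[6]}).@[(v *m E) 0] = 6 * P v + T (q v) (q v) (q v).
  rewrite (meval_cubic (dhomogP3 f)) mulrA mulfV ?pnatr_eq0 // mul1r -/(T _ _ _).
  rewrite {1}vE -[p v]scale1r TD mul1r (Tp v v v) //.
  rewrite TC12 {1}vE -[p v]scale1r TD mul1r {1}qcE (Tp v) //.
  rewrite TC23 TC12 {1}vE -[p v]scale1r TD mul1r {1 2}qcE (Tp v) //.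
  by ring.
pose a (i j k : nat) := T (e i) (e j) (e k).
have Tq (v : 'rV[K]_6) : T (q v) (q v) (q v) = a 3%N 3%N 3%N * v 0 (inord 3) ^+ 3
   + 3 * a 3%N 3%N 4%N * v 0 (inord 3) ^+ 2 * v 0 (inord 4)
   + 3 * a 3%N 3%N 5%N * v 0 (inord 3) ^+ 2 * v 0 (inord 5)
   + 3 * a 3%N 4%N 4%N * v 0 (inord 3) * v 0 (inord 4) ^+ 2
   + 6 * a 3%N 4%N 5%N * v 0 (inord 3) * v 0 (inord 4) * v 0 (inord 5)
   + 3 * a 3%N 5%N 5%N * v 0 (inord 3) * v 0 (inord 5) ^+ 2
   + a 4%N 4%N 4%N * v 0 (inord 4) ^+ 3 + 3 * a 4%N 4%N 5%N * v 0 (inord 4) ^+ 2 * v 0 (inord 5)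
   + 3 * a 4%N 5%N 5%N * v 0 (inord 4) * v 0 (inord 5) ^+ 2 + a 5%N 5%N 5%N * v 0 (inord 5) ^+ 3.
  rewrite /q; move: (v 0 (inord 3)) (v 0 (inord 4)) (v 0 (inord 5)) => y3 y4 y5.
  have X u w : T (y3 *: e 3%N + y4 *: e 4%N + y5 *: e 5%N) u w
      = y3 * T (e 3%N) u w + y4 * T (e 4%N) u w + y5 * T (e 5%N) u w.
    by rewrite -addrA TD TD -[y5 *: _]addr0 TD [T 0 _ _](_ : _ = 0) ?addr0 ?addrA // /T (bil0l ts) dotr0l.
  have X2 u w : T u (y3 *: e 3%N + y4 *: e 4%N + y5 *: e 5%N) w
      = y3 * T u (e 3%N) w + y4 * T u (e 4%N) w + y5 * T u (e 5%N) w.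
    by rewrite TC12 X !(TC12 _ u).
  have X3 u w : T u w (y3 *: e 3%N + y4 *: e 4%N + y5 *: e 5%N)
      = y3 * T u w (e 3%N) + y4 * T u w (e 4%N) + y5 * T u w (e 5%N).
    by rewrite TC23 X2 !(TC23 u _ w).
  rewrite X !X2 !X3 -!/(a _ _ _).
  have s1 (i j k : nat) : a i j k = a j i k by rewrite /a TC12.
  have s2 (i j k : nat) : a i j k = a i k j by rewrite /a TC23.
  rewrite (s1 4%N 3%N 3%N) (s1 4%N 3%N 4%N) (s1 4%N 3%N 5%N) (s1 5%N 3%N 3%N) (s1 5%N 3%N 4%N) (s1 5%N 3%N 5%N) (s1 5%N 4%N 3%N) (s1 5%N 4%N 4%N) (s1 5%N 4%N 5%N)
    (s2 3%N 4%N 3%N) (s2 3%N 5%N 3%N) (s2 3%N 5%N 4%N) (s2 4%N 4%N 3%N) (s2 4%N 5%N 3%N) (s2 4%N 5%N 4%N) (s1 4%N 3%N 4%N) (s1 4%N 3%N 5%N)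
    (s2 5%N 5%N 3%N) (s1 5%N 3%N 5%N) (s2 5%N 5%N 4%N) (s1 5%N 4%N 5%N).
  by ring.
pose xi := (delta_mx 0 (inord 3) : 'rV[K]_6) *m (invmx E)^T.
have xiE (v : 'rV[K]_6) : dotr xi (v *m E) = v 0 (inord 3).
  rewrite /xi dotr_mulmx trmxK -mulmxA mulmxV // mulmx1 dotrC dotr_delta //.
(* The coefficient of v3^3 in f + s xi^3, which only has to be nonzero. *)
have a3n0 : 'X + (a 3%N 3%N 3%N / 6)%:P != 0 :> {poly K}.
  by rewrite -size_poly_eq0 size_XaddC.
apply: (@in_closure_line _ f (cube xi) _ a3n0) => s; rewrite hornerD hornerX hornerC.
set al := s + _ => aln0.
pose r := 3.-root al; have r3 : r ^+ 3 = al by rewrite rootCK.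
have rn0 : r != 0 by apply: contra aln0 => /eqP r0; rewrite -r3 r0 expr0n.
(* The new coordinate 3 is r (v3 + b4 v4 + b5 v5), whose cube accounts for v3^3, v3^2 v4 and v3^2
   v5. Every other monomial is divisible by v4^2, v4 v5 or v5^2, and its cofactor is absorbed into
   coordinate 0, 1 or 2. *)
pose b4 := a 3%N 3%N 4%N / (6 * al); pose b5 := a 3%N 3%N 5%N / (6 * al).
pose rows := [:: [:: 1; 0; 0; 0; 0; 0]; [:: 0; 1; 0; 0; 0; 0]; [:: 0; 0; 1; 0; 0; 0];
  [:: a 3%N 4%N 4%N / 2 - 3 * al * b4 ^+ 2; a 3%N 4%N 5%N - 6 * al * b4 * b5; a 3%N 5%N 5%N / 2 - 3 * al * b5 ^+ 2; r; 0; 0];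
  [:: a 4%N 4%N 4%N / 6 - al * b4 ^+ 3; a 4%N 4%N 5%N / 2 - 3 * al * b4 ^+ 2 * b5; 0; r * b4; 1; 0];
  [:: 0; a 4%N 5%N 5%N / 2 - 3 * al * b4 * b5 ^+ 2; a 5%N 5%N 5%N / 6 - al * b5 ^+ 3; r * b5; 0; 1]].
pose N : 'M[K]_6 := \matrix_(i, j) nth 0 (nth [::] rows i) j.
have vN (v : 'rV[K]_6) (j : 'I_6) : (v *m N) 0 j = \sum_(i < 6) v 0 (inord i) * nth 0 (nth [::] rows i) j.
  by rewrite mxE; apply: eq_bigr => i _; rewrite inord_val mxE.
have vNE (v : 'rV[K]_6) j : (j < 6)%N -> (v *m N) 0 (inord j) = v 0 (inord 0) * nth 0 (nth [::] rows 0) j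
   + v 0 (inord 1) * nth 0 (nth [::] rows 1) j + v 0 (inord 2) * nth 0 (nth [::] rows 2) j
   + v 0 (inord 3) * nth 0 (nth [::] rows 3) j + v 0 (inord 4) * nth 0 (nth [::] rows 4) j
   + v 0 (inord 5) * nth 0 (nth [::] rows 5) j.
  by move=> j6; rewrite vN !big_ord_recl big_ord0 addr0 !addrA inordK.
have uN : N \in unitmx.
  rewrite -row_free_unit -kermx_eq0; apply/rowV0P => v /sub_kermxP vN0.
  have z j : (j < 6)%N -> (v *m N) 0 (inord j) = 0 by rewrite vN0 mxE.
  have := z 5 isT; rewrite vNE //= !(mulr0, add0r, addr0, mulr1) => v5.
  have := z 4%N isT; rewrite vNE //= v5 !(mulr0, mul0r, add0r, addr0, mulr1) => v4.
  have := z 3%N isT; rewrite vNE //= v5 v4 !(mulr0, mul0r, add0r, addr0, mulr1) => /eqP.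
  rewrite mulf_eq0 (negPf rn0) orbF => /eqP v3.
  have := z 0%N isT; rewrite vNE //= v5 v4 v3 !(mulr0, mul0r, add0r, addr0, mulr1) => v0.
  have := z 1%N isT; rewrite vNE //= v5 v4 v3 !(mulr0, mul0r, add0r, addr0, mulr1) => v1.
  have := z 2%N isT; rewrite vNE //= v5 v4 v3 !(mulr0, mul0r, add0r, addr0, mulr1) => v2.
  apply/rowP => i; rewrite mxE -(inord_val i).
  by case: i => -[|[|[|[|[|[|]]]]]] //= _.
apply: (@in_closure_minimal _ (invmx E *m N)).
  by rewrite unitmx_mul unitmx_inv uE uN.
move=> x; have [v ->] : exists v, x = v *m E by exists (x *m invmx E); rewrite mulmxKV.
rewrite mulmxA mulmxK // /= mevalD mevalZ rmorphXn /= meval_linear_form xiE.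
apply: (@mulfI _ 6); first by rewrite pnatr_eq0.
rewrite mulrDr fE Tq /P /perazzo_std !vNE //=.
have -> : s = r ^+ 3 - a 3%N 3%N 3%N / 6 by rewrite r3 /al addrK.
rewrite /b4 /b5 -r3; move: (v 0 _) (v 0 _) (v 0 _) (v 0 _) (v 0 _) (v 0 _) => y0 y1 y2 y3 y4 y5.
by field; rewrite rn0.
Qed.

End CompleteTheCube.

(** * The strong Lefschetz property *)

Section XminHessian.
Context (K : numFieldType).
Local Notation polar f := (polar_coef (mpoly_of_dhomog f)).
Implicit Types (f g : dhomog 6 K 3).

Lemma bilmx_coords f (p : 'rV[K]_6) : bilmx (polar f) p =
  \sum_i coords f 0 i *: bilmx (polar (vbasis (@fullv K (dhomog 6 K 3)))`_i) p.
Proof.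
have lin s g h : bilmx (polar (s *: g + h)) p = s *: bilmx (polar g) p + bilmx (polar h) p.
  by rewrite [in LHS]addrC bilmx_line addrC.
have bil0 : bilmx (polar (0 : dhomog 6 K 3)) p = 0.
  by have := lin (-1) 0 0; rewrite scaler0 addr0 scaleN1r addNr.
rewrite {1}(coord_vbasis (memvf f)); elim/big_rec2: _ => [//|i x y _ E].
by rewrite lin E; congr (_ *: _ + _); rewrite mxE.
Qed.

(** For each fixed point p the value of the hessian at p is a form of degree 6 in the coordinates of
    f, so no coefficients need be extracted. *)
Lemma hess_Xmin (f : cubic K) : Xmin K f -> hess (form_of f : {mpoly K[6]}) = 0.
Proof.
move=> [_ h]; apply: mpoly_zero => p; rewrite (meval_hess (dhomogP3 _)).
pose F : {mpoly K[_]} := \det (\matrix_(a < 6, b < 6)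
  \sum_(i < \dim (@fullv K (dhomog 6 K 3))) bilmx (polar (vbasis (@fullv K (dhomog 6 K 3)))`_i) p a b *: 'X_i).
have FE (g : dhomog 6 K 3) : F.@[coords g 0] = \det (bilmx (polar g) p).
  rewrite /F -det_map_mx; congr (\det _); apply/matrixP => a b.
  rewrite bilmx_coords summxE !mxE raddf_sum; apply: eq_bigr => i _ /=.
  by rewrite mevalZ mevalXU [RHS]mxE mulrC.
rewrite -FE; apply: (h 6).
  apply: dhomog_det => a b; rewrite mxE; apply: rpred_sum => i _.
  by apply: dhomogZ; rewrite dhomogX /= mdeg1.
move=> _ [g [hg _ _ _] <-]; rewrite FE -(meval_hess (dhomogP3 _)) hg meval0 //.
Qed.

End XminHessian.

Section Dimensions.
Context (K : fieldType) (V W : lmodType K).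

Lemma has_dim_span_le (E : set V) r q (x : 'I_q -> V) : has_dim E r ->
  (forall v, E v -> exists c : 'I_q -> K, v = \sum_i c i *: x i) -> (r <= q)%N.
Proof.
move=> [b [EE bfree]] Ex; rewrite leqNgt; apply/negP => lt.
have Eb i : E (b i).
  rewrite EE; exists (fun j => (j == i)%:R); rewrite (bigD1 i) //= eqxx scale1r big1 ?addr0 // => j ji.
  by rewrite (negPf ji) scale0r.
have [M ME] := boolp.choice (fun i => Ex (b i) (Eb i)).
pose MM : 'M[K]_(r, q) := \matrix_(i, j) M i j.
have /rowV0Pn[u /sub_kermxP uM u0] : kermx MM != 0.
  by rewrite -mxrank_eq0 mxrank_ker -lt0n subn_gt0 (leq_ltn_trans (rank_leq_col _)).
case/eqP: u0; apply/rowP => i; rewrite mxE.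
apply: (bfree (fun i => u 0 i)); under eq_bigr do rewrite ME scaler_sumr.
rewrite exchange_big big1 // => j _ /=; under eq_bigr do rewrite scalerA.
rewrite -scaler_suml; have /rowP/(_ j) := uM; rewrite !mxE => h.
rewrite [X in X *: _](_ : _ = 0) ?scale0r // -[RHS]h; apply: eq_bigr => k _.
by rewrite mxE.
Qed.

Lemma has_dim_uniq (E : set V) r q : has_dim E r -> has_dim E q -> r = q.
Proof.
move=> hr hq; have [b [Eb _]] := hr; have [b' [Eb' _]] := hq.
apply/eqP; rewrite eqn_leq; apply/andP; split.
  by apply: (has_dim_span_le (x := b') hr) => v; rewrite Eb' => -[c ->]; exists c.
by apply: (has_dim_span_le (x := b) hq) => v; rewrite Eb.
Qed.

Lemma has_dim_inj_image (u : V -> W) (E : set V) r :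
  (forall c x y, u (c *: x + y) = c *: u x + u y) ->
  (forall x, E x -> u x = 0 -> x = 0) -> has_dim E r -> has_dim (u @` E) r.
Proof.
move=> ulin uinj [b [EE bfree]]; have u0 : u 0 = 0.
  by have := ulin (-1) 0 0; rewrite scaler0 addr0 scaleN1r addNr.
have usum (c : 'I_r -> K) : u (\sum_i c i *: b i) = \sum_i c i *: u (b i).
  by elim/big_rec2: _ => [//|i x y _ <-]; rewrite ulin.
exists (fun i => u (b i)); split.
  apply/seteqP; split=> x /=.
    by move=> [v]; rewrite EE => -[c ->] <-; exists c.
  by move=> [c ->]; exists (\sum_i c i *: b i); rewrite // EE; exists c.
move=> c; rewrite -usum => h; apply: bfree; apply: uinj h.
by rewrite EE; exists c.
Qed.

Lemma has_dim1_sub (E F : set V) : has_dim F 1 -> E `<=` F ->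
  (forall (c : K) x, E x -> E (c *: x)) -> (exists2 x, E x & x != 0) -> has_dim E 1.
Proof.
move=> F1 EF Ez [x Ex x0]; have [b [FE _]] := F1.
suff -> : E = F by [].
apply/seteqP; split=> // y Fy; have Fx := EF x Ex.
move: Fx Fy; rewrite FE => -[c]; rewrite big_ord1 => xE [e]; rewrite big_ord1 => yE.
have c0 : c 0 != 0 by apply: contra x0 => /eqP c0; rewrite xE c0 scale0r.
have -> : y = (e 0 / c 0) *: x by rewrite xE scalerA mulfVK.
exact: Ez.
Qed.

(** Lifting n independent elements of E through phi would give an invertible matrix and make phi
    injective. *)
Lemma not_has_dim (n : nat) (phi : 'rV[K]_n -> V) (E : set V) (v : 'rV[K]_n) :
  (forall c x y, phi (c *: x + y) = c *: phi x + phi y) ->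
  v != 0 -> phi v = 0 -> (forall x, E x -> exists c, x = phi c) -> ~ has_dim E n.
Proof.
move=> plin v0 pv Ephi [b [EE bfree]].
have Eb i : E (b i).
  rewrite EE; exists (fun j => (j == i)%:R); rewrite (bigD1 i) //= eqxx scale1r big1 ?addr0 // => j ji.
  by rewrite (negPf ji) scale0r.
have p0 : phi 0 = 0 by have := plin (-1) 0 0; rewrite scaler0 addr0 scaleN1r addNr.
have [M ME] := boolp.choice (fun i => Ephi (b i) (Eb i)).
pose MM : 'M[K]_n := \matrix_i M i.
have sumE (c : 'rV[K]_n) : \sum_i c 0 i *: b i = phi (c *m MM).
  rewrite mulmx_sum_row; elim/big_rec2: _ => [//|i x y _ ->].
  by rewrite plin rowK -ME.
have ker c : phi (c *m MM) = 0 -> c = 0.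
  by rewrite -sumE => h; apply/rowP => i; rewrite mxE (bfree (fun i => c 0 i) h).
have uM : MM \in unitmx.
  rewrite -row_free_unit -kermx_eq0; apply/rowV0P => c /sub_kermxP cM.
  by apply: ker; rewrite cM.
case/eqP: v0; rewrite -(mulmxKV uM v); rewrite (ker (v *m invmx MM)) ?mul0mx //.
by rewrite mulmxKV.
Qed.

End Dimensions.

(** * Lefschetz elements and the hessian *)

Section Lefschetz.
Context (K : numFieldType) (f : cubic K).
Local Notation F := (mpoly_of_dhomog (form_of f)).
Local Notation t := (polar_coef F).
Local Notation gr := (@Agr K 6 3 f).
Local Notation pr := (@Aproj K 6 3 f).
Implicit Types (a b : {mpoly K[6]}) (u v w : 'rV[K]_6).
Let hF : F \is 3.-homog := dhomogP3 (form_of f).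
Let ts : symt t := polar_coef_sym F.

Lemma AprojD a b : pr (a + b) = pr a + pr b.
Proof. by rewrite /Aproj rmorphD. Qed.
Lemma AprojM a b : pr (a * b) = pr a * pr b.
Proof. by rewrite /Aproj rmorphM. Qed.
Lemma AprojZ c a : pr (c *: a) = c *: pr a.
Proof. by rewrite -mul_mpolyC AprojM. Qed.
Lemma AprojX a k : pr (a ^+ k) = pr a ^+ k.
Proof. by rewrite /Aproj rmorphXn. Qed.

Lemma Aalg_scalerAr (c : K) (x y : Aalg f) : x * (c *: y) = c *: (x * y).
Proof. by rewrite mulrC -scalerAl mulrC. Qed.

Lemma homog1_linear_form a : a \is 1.-homog -> exists v, a = linear_form v.
Proof.
move=> ha; exists (\row_i (a^`M(i))@_0%MM).
rewrite -[LHS]scale1r -(dhomog_euler ha); apply: eq_bigr => i _.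
by rewrite {1}(dhomog0_const (dhomog_mderiv i ha)) mxE -mul_mpolyC mulrC.
Qed.

Lemma dact_linear_form v (p : {mpoly K[6]}) : dact (linear_form v) p = dird v p.
Proof.
have E (c : 'I_6 -> K) : dact (\sum_i c i *: 'X_i) p = \sum_i c i *: p^`M(i).
  elim/big_rec2: _ => [|i x y _ <-]; first exact: dact0l.
  by rewrite dactDl dactZl dactX mderivmU1m.
exact: E.
Qed.

Lemma dird2_cubic u v : dird u (dird v F) = linear_form (bil t u v).
Proof.
apply/subr0_eq/mpoly_zero => w; rewrite mevalB meval_linear_form meval_dird.
apply/subr0_eq; rewrite subr0.
have E i : ((dird v F)^`M(i)).@[w 0] = \sum_j v 0 j * bilmx t w j i.
  rewrite -dird_delta dird_comm meval_dird; apply: eq_bigr => j _.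
  by rewrite dird_delta mderiv_comm (meval_mderiv2 hF).
under eq_bigr do rewrite E.
have -> : \sum_i u 0 i * \sum_j v 0 j * bilmx t w j i = dotr u (v *m bilmx t w).
  by apply: eq_bigr => i _; rewrite mxE.
by rewrite mul_bilmx dotrC (dotr_bilC ts) (bilC ts) (dotr_bilC ts) (bilC ts) subrr.
Qed.

Lemma dird_linear_form u v : dird u (linear_form v) = (dotr u v)%:MP.
Proof.
rewrite /linear_form (linear_sum (dird u)) /dotr rmorph_sum; apply: eq_bigr => i _ /=.
by rewrite linearZ /= dirdXU -mul_mpolyC -mpolyCM mulrC.
Qed.

Lemma linear_formP c u v : linear_form (c *: u + v) = c *: linear_form u + linear_form v.
Proof.
rewrite /linear_form scaler_sumr -big_split; apply: eq_bigr => i _.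
by rewrite !mxE scalerDl scalerA.
Qed.

Lemma linear_form_eq0 v : linear_form v = 0 -> v = 0.
Proof.
move=> v0; apply: dotr_eq0 => w; have := congr1 (meval (w 0)) v0.
by rewrite meval_linear_form meval0.
Qed.

(** Thus multiplication by the class of u on A_1 is governed by the Hessian matrix of f at u. *)
Lemma Aproj_linear_mul u v : pr (linear_form u) * pr (linear_form v) = 0 <-> bil t u v = 0.
Proof.
rewrite -AprojM; split=> [/eqP|E]; last first.
  by apply/eqP; rewrite Aproj_eq0 dactM !dact_linear_form dird2_cubic E /linear_form big1 // => i _; rewrite mxE scale0r.
by rewrite Aproj_eq0 dactM !dact_linear_form dird2_cubic => /eqP/linear_form_eq0.
Qed.

(** A nonzero v with T(v, -, -) = 0 is a linear operator annihilating f, which would make dim A_1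
    less than 6. *)
Lemma Gor_free_partials : Gor1661 K f -> free_partials (form_of f).
Proof.
move=> /(_ 1%N) /= g1 v hv; apply: contrapT => /eqP v0.
apply: (@not_has_dim _ _ 6 (fun u => pr (linear_form u)) _ v _ v0 _ _ g1).
- by move=> c x y; rewrite linear_formP AprojD AprojZ.
- apply/eqP; rewrite Aproj_eq0 dact_linear_form; apply/eqP/mpoly_zero => w.
  rewrite meval_dird; transitivity (dotr v (grad F w)).
    by apply: eq_bigr => i _; rewrite mxE.
  by rewrite (grad_bil hF) dotrZr dotrC (dotr_bilC ts) (bilC ts) hv dotr0l mulr0.
- by move=> x [a ha <-]; have [u ->] := homog1_linear_form ha; exists u.
Qed.

(** Only the map L : A_1 -> A_2 is used: between spaces of dimension 6, full rank excludes a kernel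
    of the Hessian matrix at L. *)
Lemma SLP_hess : Gor1661 K f -> SLP gr 3 -> hess F != 0.
Proof.
move=> g [_ [a ha <-] slp]; have [l aE] := homog1_linear_form ha.
have [p [q [hp hq]]] := slp 1%N 1%N isT isT.
rewrite (has_dim_uniq hp (g 1%N)) (has_dim_uniq hq (g 2)) /= => him.
apply/eqP => h0; have /eqP/det0P[v v0 vl] : \det (bilmx t l) = 0.
  by rewrite -(meval_hess hF) h0 meval0.
apply: (@not_has_dim _ _ 6 (fun u => pr (linear_form l) * pr (linear_form u)) _ v _ v0 _ _ him).
- by move=> c x y; rewrite linear_formP AprojD AprojZ mulrDr Aalg_scalerAr.
- by apply/Aproj_linear_mul; rewrite -mul_bilmx.
- move=> _ [_ [b hb <-] <-]; have [u ->] := homog1_linear_form hb.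
  by exists u; rewrite expr1 aE.
Qed.

Lemma hess_SLP : Gor1661 K f -> hess F != 0 -> SLP gr 3.
Proof.
move=> g hn0; have Fn0 : F != 0.
  by apply: contra (form_neq0 f) => /eqP F0; apply/eqP/val_inj.
have /mpoly_neq0P[p] : hess F * F != 0 by rewrite mulf_neq0.
rewrite mevalM mulf_eq0 negb_or (meval_hess hF) (meval_cubic hF) => /andP[dp].
rewrite mulf_eq0 negb_or => /andP[_ fp].
pose l := linear_form p; pose L := pr l.
have hl : l \is 1.-homog := linear_form_homog p.
(* L^3 applied to f is the constant T(p, p, p) = 6 f(p). *)
have L3 : L ^+ 3 != 0.
  rewrite -AprojX Aproj_eq0 !exprS expr0 mulr1 !dactM !dact_linear_form dird2_cubic.
  by rewrite dird_linear_form dotrC mpolyC_eq0.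
have Lk k : (k <= 3)%N -> L ^+ k != 0.
  move=> k3; apply: contra L3 => /eqP Lk0.
  have -> : L ^+ 3 = L ^+ (3 - k) * L ^+ k by rewrite -exprD subnK.
  by rewrite Lk0 mulr0.
have lin k (c : K) (x y : Aalg f) : L ^+ k * (c *: x + y) = c *: (L ^+ k * x) + L ^+ k * y.
  by rewrite mulrDr Aalg_scalerAr.
have grL i k : [set L ^+ k * x | x in gr i] `<=` gr (i + k)%N.
  move=> _ [_ [a ha <-] <-]; exists (l ^+ k * a); last by rewrite AprojM AprojX.
  by rewrite addnC; apply: dhomogM => //; rewrite -[X in X.-homog]mul1n; apply: dhomogMn.
have grZ i k (c : K) x : [set L ^+ k * x | x in gr i] x -> [set L ^+ k * x | x in gr i] (c *: x).
  move=> [_ [a ha <-] <-]; exists (pr (c *: a)); first by exists (c *: a) => //; apply: dhomogZ.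
  by rewrite AprojZ Aalg_scalerAr.
have grX i : gr i (L ^+ i).
  by exists (l ^+ i); rewrite ?AprojX // -[X in X.-homog]mul1n; apply: dhomogMn.
exists L; first by exists l.
move=> i k /andP[_ i2] /andP[k1 k3]; exists (nth 0%N [:: 1; 6; 6; 1]%N i), (nth 0%N [:: 1; 6; 6; 1]%N (i + k)).
split; [exact: g|exact: g|].
(* Maps out of A_0 and maps into A_3 have rank at most 1 and are nonzero because L^3 is; the only
   other case is A_1 -> A_2, where the Hessian matrix at p is invertible. *)
have [i0|i0] := eqVneq i 0%N.
  subst i; have -> : minn (nth 0%N [:: 1; 6; 6; 1]%N 0) (nth 0%N [:: 1; 6; 6; 1]%N (0 + k)) = 1%N.
    by case: k k1 k3 => [|[|[|[|]]]].
  apply: has_dim_inj_image (g 0%N); first exact: lin.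
  move=> _ [a ha <-]; rewrite (dhomog0_const ha) -[_%:MP]alg_mpolyC AprojZ Aalg_scalerAr.
  have -> : pr 1 = 1 by rewrite /Aproj rmorph1.
  rewrite mulr1 => /eqP; rewrite scaler_eq0 (negPf (Lk k _)) ?orbF; last by move: k3; rewrite subn0.
  by move=> /eqP ->; rewrite scale0r.
have [ik|ik] := eqVneq (i + k)%N 3.
  have -> : minn (nth 0%N [:: 1; 6; 6; 1]%N i) (nth 0%N [:: 1; 6; 6; 1]%N (i + k)) = 1%N.
    rewrite ik /=; case: i i2 i0 {ik k3} => [|[|[|]]] //.
  have g3 := g (i + k)%N; rewrite ik /= in g3.
  apply: (has_dim1_sub g3); [by rewrite -ik; exact: grL|exact: grZ|].
  exists (L ^+ 3) => //; exists (L ^+ i); first exact: grX.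
  by rewrite -exprD addnC ik.
have [-> ->] : i = 1%N /\ k = 1%N by lia.
apply: has_dim_inj_image (g 1%N); first exact: lin.
move=> _ [a ha <-]; have [v ->] := homog1_linear_form ha.
rewrite expr1 => /Aproj_linear_mul; rewrite -mul_bilmx => vp.
have up : bilmx t p \in unitmx by rewrite unitmxE unitfE.
have -> : v = 0 by rewrite -(mulmxK up v) vp mul0mx.
by apply/eqP; rewrite Aproj_eq0 /linear_form big1 ?dact0l // => i' _; rewrite mxE scale0r.
Qed.

End Lefschetz.

Lemma hess0_Xmin (K : numClosedFieldType) (f : cubic K) :
  Gor1661 K f -> hess (form_of f : {mpoly K[6]}) = 0 -> Xmin K f.
Proof.
move=> g h0; have nd := Gor_free_partials g.
have cl : in_closure (form_of f).
  apply: in_closure_perturb nd _ => [f' nd' sing [x0 rx0]|x]; last first.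
    by rewrite -(meval_hess (dhomogP3 _)) h0 meval0.
  have [E uE TE] := normal_form_corank1 (polar_coef_sym _) nd' sing rx0.
  exact: (in_closure_normal_form uE TE).
split=> //; apply: contra (form_neq0 f) => /eqP c0; apply/eqP.
rewrite (coord_vbasis (memvf (form_of f))) big1 // => i _.
by have /rowP/(_ i) := c0; rewrite !mxE => ->; rewrite scale0r.
Qed.

Local Open Scope complex_scope.

Theorem proposition5p1 (R : realType) :
  SLP_locus R[i] = Gor1661 R[i] `\` Xmin R[i].
Proof.
apply/seteqP; split=> f; last first.
  move=> [gor nX]; split=> //; apply: (hess_SLP gor); apply/eqP => h0.
  by apply: nX; exact: hess0_Xmin.
move=> [gor slp]; split=> // /hess_Xmin h0.
by have := SLP_hess gor slp; rewrite h0 eqxx.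
Qed.
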